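(* Let $T>0$, $1\le p<\infty$, $\alpha=m-1+\sigma$ with $m\in\mathbb{N}$ and $0<\sigma<1$, and $0<\varepsilon<\alpha$. Then: (i) ${}_{0}W^{\alpha+\varepsilon,p}(0,T)\subset \mathcal{D}(\partial_t^{\alpha})\subset {}_{0}W^{\alpha-\varepsilon,p}(0,T)$ algebraically and topologically (that is, both inclusions hold and are continuous, $\mathcal{D}(\partial_t^\alpha)=W_{\alpha,p}(0,T)$ carrying the norm $\Vert\cdot\Vert_{W_{\alpha,p}(0,T)}$). In particular, there exists a constant $C=C(\alpha,\varepsilon)>0$ (for the fixed $p$ and $T$) such that $$C^{-1}\Vert u\Vert_{W^{\alpha-\varepsilon,p}(0,T)}\le\Vert\partial_t^{\alpha}u\Vert_{L^p(0,T)}\le C\Vert u\Vert_{W^{\alpha+\varepsilon,p}(0,T)}\quad\text{for all } u\in {}_{0}W^{\alpha+\varepsilon,p}(0,T).$$ (ii) $\partial_t^{\alpha}W_{\alpha+\beta,p}(0,T)=W_{\beta,p}(0,T)$ for every $\beta\ge 0$.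
   Context: All functions are real-valued; $\mathbb{N}=\{1,2,3,\dots\}$; derivatives are weak derivatives. Riemann-Liouville integral: for $\alpha>0$ and $v\in L^1(0,T)$, $J^{\alpha}v(t)=\frac{1}{\Gamma(\alpha)}\int_0^t(t-s)^{\alpha-1}v(s)\,ds$, $0<t<T$. It maps $L^p(0,T)$ into itself and is injective there. For $\alpha>0$, $W_{\alpha,p}(0,T):=J^{\alpha}L^p(0,T)$, with norm $\Vert u\Vert_{W_{\alpha,p}(0,T)}:=\Vert (J^{\alpha})^{-1}u\Vert_{L^p(0,T)}$; $W_{0,p}(0,T):=L^p(0,T)$. Fractional derivative: for $\alpha>0$, $\alpha\notin\mathbb{N}$, $\partial_t^{\alpha}:=(J^{\alpha})^{-1}$ with domain $\mathcal{D}(\partial_t^{\alpha})=W_{\alpha,p}(0,T)$. Sobolev-Slobodecki spaces: for $s=k-1+\theta$ with $k\in\mathbb{N}$, $0<\theta<1$, $W^{s,p}(0,T)$ is the set of $u\in L^p(0,T)$ with $$\Vert u\Vert_{W^{s,p}(0,T)}:=\left(\Vert u\Vert^p_{W^{k-1,p}(0,T)}+\int_0^T\int_0^T\frac{\left|\frac{d^{k-1}u}{dt^{k-1}}(t)-\frac{d^{k-1}u}{dt^{k-1}}(\xi)\right|^p}{|t-\xi|^{1+\theta p}}\,dt\,d\xi\right)^{1/p}<\infty,$$ where for nonnegative integers $j$, $W^{j,p}(0,T)$ is the usual Sobolev space and $W^{0,p}(0,T)=L^p(0,T)$. For $k\in\mathbb{N}$, ${}_{0}C^k[0,T]:=\{v\in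 C^k[0,T]: \frac{d^jv}{dt^j}(0)=0 \text{ for } j=0,1,\dots,k-1\}$. For $s=k-1+\theta$ with $k\in\mathbb{N}$, $0<\theta<1$, ${}_{0}W^{s,p}(0,T)$ is the closure of ${}_{0}C^k[0,T]$ in $W^{s,p}(0,T)$. For an integer $s=k\ge1$, ${}_{0}W^{k,p}(0,T)$ is the closure of ${}_{0}C^k[0,T]$ in $W^{k,p}(0,T)$. *)

(* Defs.v *)
From HB Require Import structures.
From mathcomp Require Import all_boot all_order all_algebra.
From mathcomp Require Import all_classical all_reals all_analysis.

Set Implicit Arguments.
Unset Strict Implicit.
Unset Printing Implicit Defensive.

Import Order.TTheory GRing.Theory Num.Theory.
Import numFieldNormedType.Exports.

Local Open Scope classical_set_scope.
Local Open Scope ring_scope.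

(* An element of a function space on (0,T) is represented by a function
   R -> R of which only the values on `]0, T[ matter.  Elements are identified
   when they agree a.e. on `]0, T[, so that norms of the spaces below are
   seminorms on representatives, and the set-valued definitions contain exactly
   the (Borel) representatives.  Norms take values in \bar R, and are meaningful
   on elements of the corresponding space. *)

Definition ae_on {R : realType} (T : R) (u v : R -> R) : Prop :=
  ae_eq (@lebesgue_measure R) `]0, T[%classic u v.

Definition Lp {R : realType} (T p : R) : set (R -> R) :=
  [set u | u \_ `]0, T[%classic \in Lfun (@lebesgue_measure R) p%:E].

Definition Lp_norm {R : realType} (T p : R) (u : R -> R) : \bar R :=
  Lnorm (@lebesgue_measure R) p%:E (EFin \o (u \_ `]0, T[%classic)).

Definition Gamma {R : realType} (a : R) : R :=
  \int[@lebesgue_measure R]_(x in `]0, +oo[) (x `^ (a - 1) * expR (- x)).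

Definition RL_int {R : realType} (a : R) (v : R -> R) (t : R) : R :=
  (Gamma a)^-1 *
  \int[@lebesgue_measure R]_(s in `]0, t[) ((t - s) `^ (a - 1) * v s).

(* W_{a,p}(0,T) = J^a L^p(0,T) for a > 0, and W_{0,p}(0,T) = L^p(0,T). *)
Definition RL_space {R : realType} (T p a : R) : set (R -> R) :=
  if a == 0 then Lp T p
  else [set u | Lp T p u /\ exists2 v, Lp T p v & ae_on T u (RL_int a v)].

(* The preimage is unique a.e., J^a being injective on L^p(0,T). *)
Definition RL_inv {R : realType} (T p a : R) (u : R -> R) : R -> R :=
  get [set v | Lp T p v /\ ae_on T u (RL_int a v)].

Definition RL_norm {R : realType} (T p a : R) (u : R -> R) : \bar R :=
  if a == 0 then Lp_norm T p u else Lp_norm T p (RL_inv T p a u).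

Definition frac_deriv {R : realType} (T p a : R) : (R -> R) -> (R -> R) :=
  RL_inv T p a.

Definition frac_deriv_dom {R : realType} (T p a : R) : set (R -> R) :=
  RL_space T p a.

(* Image of a set of (classes of) functions, as a set of representatives. *)
Definition frac_deriv_image {R : realType} (T p a : R) (A : set (R -> R)) :
    set (R -> R) :=
  [set w | Lp T p w /\ exists2 u, A u & ae_on T w (frac_deriv T p a u)].

Definition test_function {R : realType} (T : R) (phi : R -> R) : Prop :=
  (forall n x, derivable (derive1n n phi) x 1) /\
  exists a b : R, [/\ 0 < a, b < T & forall x, x \notin `[a, b] -> phi x = 0].

(* Used for u and v in L^p(0,T), where both integrals converge. *)
Definition is_weak_deriv {R : realType} (T : R) (j : nat) (u v : R -> R) : Prop :=
  forall phi : R -> R, test_function T phi ->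
    \int[@lebesgue_measure R]_(x in `]0, T[) (u x * derive1n j phi x) =
    (-1) ^+ j * \int[@lebesgue_measure R]_(x in `]0, T[) (v x * phi x).

(* Unique a.e. when it exists. *)
Definition weak_deriv {R : realType} (T p : R) (j : nat) (u : R -> R) : R -> R :=
  if j is 0%N then u else get [set v | Lp T p v /\ is_weak_deriv T j u v].

Definition Sobolev_nat {R : realType} (T p : R) (n : nat) : set (R -> R) :=
  [set u | Lp T p u /\ forall j : nat, (1 <= j <= n)%N ->
     exists2 v, Lp T p v & is_weak_deriv T j u v].

Definition Sobolev_nat_norm {R : realType} (T p : R) (n : nat) (u : R -> R) :
    \bar R :=
  ((\sum_(j < n.+1) (Lp_norm T p (weak_deriv T p j u)) `^ p) `^ (p^-1)%R)%E.

(* The p-th power of the Slobodecki seminorm; the integrand is 0 for t = x. *)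
Definition Slobodecki {R : realType} (T p theta : R) (w : R -> R) : \bar R :=
  (\int[@lebesgue_measure R]_(x in `]0%R, T[)
   \int[@lebesgue_measure R]_(t in `]0%R, T[)
     (`|w t - w x| `^ p / `|t - x| `^ (1 + theta * p))%R%:E)%E.

(* For s >= 0, s = n + theta with n = Num.truncn s and 0 <= theta < 1;
   theta = 0 is the integer-order case. *)
Definition Sobolev_norm {R : realType} (T p s : R) (u : R -> R) : \bar R :=
  let n := Num.truncn s in
  let theta := s - n%:R in
  if theta == 0 then Sobolev_nat_norm T p n u
  else (((Sobolev_nat_norm T p n u) `^ p +
         Slobodecki T p theta (weak_deriv T p n u)) `^ (p^-1)%R)%E.

Definition Sobolev {R : realType} (T p s : R) : set (R -> R) :=
  [set u | Sobolev_nat T p (Num.truncn s) u /\ (Sobolev_norm T p s u < +oo)%E].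

(* v is C^k on [0,T] with vanishing derivatives of order < k at 0; w j is the
   j-th derivative of v, extended continuously to the end points. *)
Definition zero_C {R : realType} (T : R) (k : nat) : set (R -> R) :=
  [set v | exists w : nat -> R -> R,
    [/\ w 0%N = v,
        forall j : nat, (j <= k)%N -> {within `[0, T], continuous (w j)},
        forall j : nat, (j < k)%N ->
          forall t : R, t \in `]0, T[ -> is_derive t (1 : R) (w j) (w j.+1 t) &
        forall j : nat, (j < k)%N -> w j 0 = 0]].

(* The k such that the closure of zero_C T k defines the space of order s > 0:
   k = s if s is an integer, and s = k - 1 + theta, 0 < theta < 1, otherwise. *)
Definition smooth_order {R : realType} (s : R) : nat :=
  if s == (Num.truncn s)%:R then Num.truncn s else (Num.truncn s).+1.

Definition zero_Sobolev {R : realType} (T p s : R) : set (R -> R) :=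
  [set u | Sobolev T p s u /\ forall e : R, 0 < e ->
     exists2 v, zero_C T (smooth_order s) v &
                (Sobolev_norm T p s (u \- v)%R < e%:E)%E].

(* Continuity of the inclusion map is for the metrics induced by nA and nB. *)
Definition continuously_included {R : realType}
    (A : set (R -> R)) (nA : (R -> R) -> \bar R)
    (B : set (R -> R)) (nB : (R -> R) -> \bar R) : Prop :=
  A `<=` B /\
  forall u, A u -> forall e : R, 0 < e -> exists2 d : R, 0 < d &
    forall v, A v -> (nA (v \- u)%R < d%:E)%E -> (nB (v \- u)%R < e%:E)%E.

(* Main.v *)
(* Write J^a for the Riemann-Liouville integral up to a positive factor.  By the
   Beta integral, J^a J^b is a multiple of J^(a+b), and J^a is injective since J^1
   is; this gives (ii).  The upper embedding follows from Young's inequality and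
   the L^1 modulus of continuity h^b of the kernel x^(b-1), which bounds the
   Slobodecki seminorm of J^b v for every theta < b < 1; J^n of smooth functions
   is dense because the range of each J^b is.  For the lower embedding, a smooth f
   vanishing at 0 to order k is the k-fold integral of its k-th derivative h, so
   that f = J^a v with v = J^(k-a) h explicit.  When k - 1 < a < k and b = a - k + 1,
   Marchaud's formula writes J^(1-b) h through g = J^1 h as
   t^(-b) g(t) + b \int_0^t (t - s)^(-b-1) (g(t) - g(s)) ds: Jensen's inequality
   controls the integral by the Slobodecki seminorm of order theta > b, and Hardy's
   inequality controls the first term.  The closure is reached by completeness
   of L^p. *)
Require Import Defs.
From HB Require Import structures.
From mathcomp Require Import all_boot all_order all_algebra.
From mathcomp Require Import all_classical all_reals all_analysis.
From mathcomp Require Import measurable_realfun ring lra.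
Set Implicit Arguments.
Unset Strict Implicit.
Unset Printing Implicit Defensive.
Import Order.TTheory GRing.Theory Num.Theory.
Import numFieldNormedType.Exports.
Local Open Scope classical_set_scope.
Local Open Scope ring_scope.

(** Hardy's inequality for the weight x^(-bp) degenerates at the critical exponent bp = 1; the gap
    between [b] and [theta], ultimately the loss [eps], leaves room for an order strictly in
    between. Its proof absorbs a small multiple of the left-hand side, which is legitimate only once
    that side is known to be finite. This is known for f = J^1 g with g bounded, where |f x| <= M x;
    hence the lower embedding is first an a priori estimate on [zero_C] and then passes to the
    closure. Marchaud's formula enters only if no integer lies in []alpha, alpha + eps]]; if alpha <
    n = truncn (alpha + eps), the preimage of f is a multiple of J^(n - alpha) of the n-th
    derivative, and Young's inequality suffices. Functions are extended by zero to the line, so that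
    fractional integrals are convolutions with a truncated power, and norms are replaced by their
    p-th powers, at the cost of constants 2^p. The range of J^b is dense because it contains that of
    J^N for an integer N > b, and J^1 of the backward difference quotients of a bounded v are means
    of v, which converge to v almost everywhere. *)

(** * Changes of variables for the Lebesgue integral on the line *)

Section change_of_variables.
Context {R : realType}.
Notation mu := (@lebesgue_measure R).
Local Open Scope ereal_scope.

(** The pushforward of [mu] under the affine map, scaled by [a], gives every interval []x, y]] its
    own length, so it is Lebesgue measure by uniqueness. *)
Lemma ge0_integral_affine (a b : R) (f : R -> \bar R) : (0 < a)%R ->
  measurable_fun [set: R] f -> (forall x, 0 <= f x) ->
  \int[mu]_x f x = a%:E * \int[mu]_x f (a * x + b)%R.
Proof.
move=> a0 mf f0.
pose phi (x : measurableTypeR R) : measurableTypeR R := (a * x + b)%R.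
have mphi : measurable_fun [set: R] phi.
  by apply: measurable_funD => //; exact: measurable_funM.
pose k : {nonneg R} := NngNum (ltW a0).
pose phiM : {mfun _ >-> _} := HB.pack phi (isMeasurableFun.Build _ _ _ _ phi mphi).
have E A : measurable A -> mu A = mscale k (pushforward mu phiM) A.
  apply: lebesgue_measure_unique => //= _ [[x y]] _ <-.
  pose u := ((x - b) / a)%R; pose v := ((y - b) / a)%R.
  have E0 : phi @^-1` `]x, y] = `]u, v]%classic.
    apply/seteqP; split => z /=; rewrite /phi !in_itv/= ltr_pdivrMr// ler_pdivlMr//;
      by rewrite ltrBlDr lerBrDr mulrC.
  transitivity (a%:E * mu `]u, v]); last by rewrite -E0.
  rewrite /u /v !lebesgue_measure_itv/= !lte_fin ltr_pM2r ?invr_gt0// ltrD2r.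
  case: ifPn => // xy; rewrite ?mule0//.
  by rewrite -EFinD -EFinM; congr (_%:E); field; rewrite gt_eqF.
rewrite (@eq_measure_integral _ _ _ _ (mscale k (pushforward mu phiM))); last first.
  by move=> A mA _; exact: E.
by rewrite ge0_integral_mscale// ge0_integral_pushforward// preimage_setT.
Qed.

Lemma ge0_integral_shift (b : R) (f : R -> \bar R) :
  measurable_fun [set: R] f -> (forall x, 0 <= f x) ->
  \int[mu]_x f (x + b)%R = \int[mu]_x f x.
Proof.
move=> mf f0; rewrite [RHS](@ge0_integral_affine 1 b)// mul1e.
by apply: eq_integral => x _; rewrite mul1r.
Qed.

Lemma ge0_integral_subr (b : R) (f : R -> \bar R) :
  measurable_fun [set: R] f -> (forall x, 0 <= f x) ->
  \int[mu]_x f (b - x)%R = \int[mu]_x f x.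
Proof.
move=> mf f0.
rewrite -[RHS](@ge0_integral_shift b)//.
have mg : measurable_fun [set: R] (fun x => f (x + b)%R).
  by apply: measurableT_comp => //; exact: measurable_funD.
pose op (x : measurableTypeR R) : measurableTypeR R := (- x)%R.
have mop : measurable_fun [set: R] op by exact: oppr_measurable.
pose opM : {mfun _ >-> _} := HB.pack op (isMeasurableFun.Build _ _ _ _ op mop).
rewrite [RHS](@eq_measure_integral _ _ _ _ (pushforward mu opM)); last first.
  by move=> A mA _; apply/esym; exact: lebesgue_measureN.
rewrite ge0_integral_pushforward// preimage_setT.
by apply: eq_integral => x _ /=; rewrite addrC.
Qed.

End change_of_variables.

(** * Jensen's inequality for a weight of bounded mass *)

Section jensen.
Context d {T : measurableType d} {R : realType}.
Variable mu : {measure set T -> \bar R}.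

(** A convex function lies above its tangent at [c]. This is Young's inequality for the conjugate
    exponents [p] and [p / (p - 1)]; for [p = 1] the latter is infinite, but then both sides are
    equal. *)
Lemma tangent_powR (p c y : R) : 1 <= p -> 0 <= c -> 0 <= y ->
  p * (c `^ (p - 1) * y) <= y `^ p + (p - 1) * c `^ p.
Proof.
move=> p1 c0 y0.
have [->|pn1] := eqVneq p 1.
  by rewrite !subrr powRr0 powRr1// !mul1r mul0r addr0.
have p1' : 1 < p by rewrite lt_neqAle eq_sym pn1.
have p0 : 0 < p by exact: lt_trans p1'.
have q0 : 0 < p - 1 by rewrite subr_gt0.
have q'0 : 0 < p / (p - 1) by rewrite divr_gt0.
have pq : p^-1 + (p / (p - 1))^-1 = 1.
  by rewrite invf_div; field; rewrite gt_eqF.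
have := conjugate_powR y0 (powR_ge0 c (p - 1)) p0 q'0 pq.
rewrite -powRrM.
rewrite (_ : (p - 1) * (p / (p - 1)) = p); last first.
  by rewrite mulrCA mulrA mulfK// gt_eqF.
move=> h; rewrite -(ler_pM2l p0) in h.
rewrite [c `^ _ * y]mulrC (le_trans h)// le_eqVlt; apply/orP; left; apply/eqP.
by field; rewrite !gt_eqF.
Qed.

Local Open Scope ereal_scope.

(** Integrating [tangent_powR] against the weight gives an affine bound [KJ] for each [c]; taking
    for [c] the mean [I / A] turns it into the claim. The mass enters [KJ] with the nonnegative
    coefficient (p - 1) c^p, so its upper bound [A] can replace it. *)
Lemma weighted_jensen (p A : R) (k g : T -> R) : (1 <= p)%R -> (0 < A)%R ->
  measurable_fun [set: T] k -> measurable_fun [set: T] g ->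
  (forall x, 0 <= k x)%R -> (forall x, 0 <= g x)%R ->
  \int[mu]_x (k x)%:E <= A%:E ->
  (\int[mu]_x (k x * g x)%:E) `^ p <=
    (A `^ (p - 1))%:E * \int[mu]_x (k x * g x `^ p)%:E.
Proof.
move=> p1 A0 mk mg k0 g0 kA.
have p0 : (0 < p)%R by exact: lt_le_trans p1.
set I := \int[mu]_x (k x * g x)%:E; set J := \int[mu]_x (k x * g x `^ p)%:E.
have mkg : measurable_fun setT (fun x => (k x * g x)%:E).
  by apply/measurable_EFinP; exact: measurable_funM.
have mkp : measurable_fun setT (fun x => (k x * g x `^ p)%:E).
  apply/measurable_EFinP; apply: measurable_funM => //.
  exact: (measurableT_comp (measurable_powR _)).
have I0 : 0 <= I by apply: integral_ge0 => x _; rewrite lee_fin mulr_ge0.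
have J0 : 0 <= J by apply: integral_ge0 => x _; rewrite lee_fin mulr_ge0 ?powR_ge0.
have KJ (c : R) : (0 <= c)%R ->
    (p * c `^ (p - 1))%:E * I <= J + ((p - 1) * c `^ p)%:E * A%:E.
  move=> c0.
  have -> : (p * c `^ (p - 1))%:E * I =
      \int[mu]_x ((p * c `^ (p - 1))%:E * (k x * g x)%:E).
    rewrite ge0_integralZl//; last by rewrite lee_fin mulr_ge0 ?powR_ge0 ?(ltW p0).
    by move=> x _; rewrite lee_fin mulr_ge0.
  have c1 : (0 <= (p - 1) * c `^ p)%R by rewrite mulr_ge0 ?powR_ge0 ?subr_ge0.
  have h : J + ((p - 1) * c `^ p)%:E * \int[mu]_x (k x)%:E =
     \int[mu]_x ((k x * g x `^ p)%:E + ((p - 1) * c `^ p)%:E * (k x)%:E).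
    rewrite ge0_integralD//=.
    - rewrite ge0_integralZl//; first exact/measurable_EFinP.
      + by move=> x _; rewrite lee_fin.
    - by move=> x _; rewrite lee_fin mulr_ge0 ?powR_ge0.
    - by move=> x _; rewrite -EFinM lee_fin mulr_ge0.
    - by apply: measurable_funeM; exact/measurable_EFinP.
  apply: (@le_trans _ _ (J + ((p - 1) * c `^ p)%:E * \int[mu]_x (k x)%:E)); last first.
    by rewrite leeD2l// lee_wpmul2l// lee_fin.
  rewrite h; apply: ge0_le_integral => //=.
  - move=> x _; rewrite -EFinM lee_fin; apply: mulr_ge0; last exact: mulr_ge0.
    by rewrite mulr_ge0 ?powR_ge0 ?(ltW p0).
  - exact: measurable_funeM.
  - apply: emeasurable_funD => //; apply: measurable_funeM; exact/measurable_EFinP.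
  - move=> x _; rewrite -!EFinM -EFinD lee_fin.
    have := ler_wpM2l (k0 x) (tangent_powR p1 c0 (g0 x)).
    by congr (_ <= _)%R; ring.
have AP : (0 < A `^ (p - 1))%R by exact: powR_gt0.
have [Joo|Joo] := eqVneq J +oo.
  by rewrite Joo gt0_muley ?leey// lte_fin.
have Jfin : J \is a fin_num by rewrite ge0_fin_numE// ltey.
(* The mean [I / A] is an admissible constant only if [I] is finite, which comes from [KJ] at
   [c = 1]. *)
have Ifin : I \is a fin_num.
  rewrite ge0_fin_numE//.
  have := KJ 1%R ler01; rewrite !powR1 !mulr1 => h.
  rewrite ltNge leye_eq; apply/negP => /eqP Ioo; move: h.
  rewrite Ioo gt0_muley ?lte_fin// leye_eq -(fineK Jfin) -EFinM -EFinD.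
  by move/eqP.
have [i Ei] : exists i, I = i%:E by exists (fine I); rewrite fineK.
have [j Ej] : exists j, J = j%:E by exists (fine J); rewrite fineK.
have i0 : (0 <= i)%R by rewrite -lee_fin -Ei.
have c0 : (0 <= i / A)%R by rewrite divr_ge0// ltW.
have := KJ _ c0; rewrite Ei Ej poweR_EFin -!EFinM -EFinD !lee_fin.
set c := (i / A)%R => h; rewrite -/c in c0.
have iE : i = (c * A)%R by rewrite /c divfK// gt_eqF.
rewrite iE powRM// ?(ltW A0)// -(mulr_powRB1 (ltW A0) p0).
have e : (p * c `^ (p - 1) * (c * A) = p * c `^ p * A)%R.
  by rewrite -(mulr_powRB1 c0 p0); ring.
rewrite iE e in h.
have h2 : (c `^ p * A <= j)%R by lra.
by rewrite [leLHS]mulrA [leLHS]mulrC ler_pM2l.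
Qed.

End jensen.

(** The [p]-th power of the norm over the whole line. Its arguments will vanish outside []0, T[];
    the root is taken only on the return to [Lp_norm] and [Sobolev_norm]. *)
Definition Lpow {R : realType} (p : R) (v : R -> R) : \bar R :=
  (\int[@lebesgue_measure R]_x (`|v x| `^ p)%:E)%E.

(** * Tonelli, Young's convolution inequality and integrals of powers *)

Section integral_aux.
Context {R : realType}.
Notation mu := (@lebesgue_measure R).
Local Open Scope ereal_scope.

Lemma tonelli (F : R * R -> \bar R) :
  measurable_fun [set: R * R] F -> (forall z, 0 <= F z) ->
  \int[mu]_x \int[mu]_y F (x, y) = \int[mu]_y \int[mu]_x F (x, y).
Proof. by move=> mF F0; exact: fubini_tonelli. Qed.

Lemma ge0_integral_EFinZl (c : R) (f : R -> R) : (0 <= c)%R ->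
  measurable_fun [set: R] f -> (forall x, 0 <= f x)%R ->
  \int[mu]_x (c * f x)%:E = c%:E * \int[mu]_x (f x)%:E.
Proof.
move=> c0 mf f0; under eq_integral do rewrite EFinM.
apply: ge0_integralZl_EFin => //; last exact/measurable_EFinP.
by move=> x _; rewrite lee_fin.
Qed.

Lemma ge0_integral_EFinD (f g : R -> R) :
  measurable_fun [set: R] f -> (forall x, 0 <= f x)%R ->
  measurable_fun [set: R] g -> (forall x, 0 <= g x)%R ->
  \int[mu]_x (f x + g x)%:E = \int[mu]_x (f x)%:E + \int[mu]_x (g x)%:E.
Proof.
move=> mf f0 mg g0; under eq_integral do rewrite EFinD.
by rewrite ge0_integralD//; first [exact/measurable_EFinP | move=> x _; rewrite lee_fin].
Qed.

Lemma ge0_le_integral_EFin (f g : R -> R) :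
  measurable_fun [set: R] f -> (forall x, 0 <= f x)%R ->
  measurable_fun [set: R] g -> (forall x, f x <= g x)%R ->
  \int[mu]_x (f x)%:E <= \int[mu]_x (g x)%:E.
Proof.
move=> mf f0 mg fg; apply: ge0_le_integral => //; try exact/measurable_EFinP; by move=> x _; rewrite lee_fin.
Qed.

Lemma integral_gt0_itv (a b : R) (f : R -> R) : (a < b)%R ->
  measurable_fun [set: R] f -> (forall x, 0 <= f x)%R ->
  (forall x, a < x < b -> 0 < f x)%R -> 0 < \int[mu]_x (f x)%:E.
Proof.
move=> ab mf f0 fab.
have I0 : 0 <= \int[mu]_x (f x)%:E by apply: integral_ge0 => x _; rewrite lee_fin.
rewrite lt0e I0 andbT; apply/eqP => I00.
have : ae_eq mu setT (EFin \o f) (cst 0).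
  apply/ae_eq_integral_abs => //; first exact/measurable_EFinP.
  rewrite -[RHS]I00; apply: eq_integral => x _.
  by rewrite gee0_abs// lee_fin.
move=> [N [mN N0 sN]].
have : mu `]a, b[ <= mu N.
  apply: le_measure; rewrite ?inE//; apply: subset_trans sN => x /= xab /(_ I) [] f00.
  by move: (fab x); rewrite in_itv/= in xab; rewrite xab f00 ltxx => /(_ isT).
rewrite N0 lebesgue_measure_itv/= lte_fin ab -EFinD lee_fin subr_le0.
by rewrite leNgt ab.
Qed.

Lemma measurable_convolution (k v : R -> R) :
  measurable_fun [set: R] k -> measurable_fun [set: R] v ->
  measurable_fun [set: R * R] (fun z => k (z.1 - z.2)%R * v z.2)%R.
Proof.
move=> mk mv; apply: measurable_funM.
  by apply: measurableT_comp => //; exact: measurable_funB.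
by apply: measurableT_comp.
Qed.

Lemma measurable_subl (k : R -> R) (t : R) :
  measurable_fun [set: R] k -> measurable_fun [set: R] (fun s => k (t - s))%R.
Proof. by move=> mk; apply: measurableT_comp => //; exact: measurable_funB. Qed.

Lemma measurable_subr (k : R -> R) (t : R) :
  measurable_fun [set: R] k -> measurable_fun [set: R] (fun s => k (s - t))%R.
Proof. by move=> mk; apply: measurableT_comp => //; exact: measurable_funB. Qed.

Lemma measurable_normr_powR (p : R) (v : R -> R) :
  measurable_fun [set: R] v -> measurable_fun [set: R] (fun x => `|v x| `^ p)%R.
Proof.
move=> mv; apply: (measurableT_comp (measurable_powR _)).
exact: measurableT_comp.
Qed.

(** For each [t], [weighted_jensen] with the weight [k (t - s)] moves the power inside at the cost
    of A^(p - 1); after Tonelli, integration in [t] yields the last factor [A]. *)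
Lemma young_convolution (p A : R) (k v : R -> R) : (1 <= p)%R -> (0 < A)%R ->
  measurable_fun [set: R] k -> measurable_fun [set: R] v ->
  (forall x, 0 <= k x)%R -> \int[mu]_x (k x)%:E <= A%:E ->
  \int[mu]_t ((\int[mu]_s (k (t - s)%R * `|v s|)%:E) `^ p) <=
    (A `^ p)%:E * Lpow p v.
Proof.
move=> p1 A0 mk mv k0 kA.
have p0 : (0 < p)%R by exact: lt_le_trans p1.
have mnv : measurable_fun [set: R] (fun x => `|v x|)%R by exact: measurableT_comp.
have mpv : measurable_fun [set: R] (fun x => `|v x| `^ p)%R.
  exact: measurable_normr_powR.
have m2 := measurable_convolution mk mpv.
pose F (z : R * R) := (k (z.1 - z.2)%R * `|v z.2| `^ p)%:E.
have mF : measurable_fun [set: R * R] F by exact/measurable_EFinP.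
have F0 z : 0 <= F z by rewrite lee_fin mulr_ge0 ?powR_ge0.
have m1 := measurable_convolution mk mnv.
pose G (z : R * R) := (k (z.1 - z.2)%R * `|v z.2|)%:E.
have mG : measurable_fun [set: R * R] G by exact/measurable_EFinP.
have G0 z : 0 <= G z by rewrite lee_fin mulr_ge0.
apply: (@le_trans _ _
    (\int[mu]_t ((A `^ (p - 1))%:E * \int[mu]_s F (t, s)))).
  apply: ge0_le_integral => //.
  - by move=> x _; rewrite poweR_ge0.
  - apply: (measurableT_comp (measurable_poweR _)).
    exact: (@measurable_fun_fubini_tonelli_F _ _ _ _ _ mu G).
  - by apply: measurable_funeM; exact: (@measurable_fun_fubini_tonelli_F _ _ _ _ _ mu F).
  - move=> t _; apply: weighted_jensen => //.
    + exact: measurable_subl.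
    + rewrite (@ge0_integral_subr _ t (fun x => (k x)%:E))//.
      exact/measurable_EFinP.
rewrite ge0_integralZl//; last 3 first.
- exact: (@measurable_fun_fubini_tonelli_F _ _ _ _ _ mu F).
- by move=> t _; apply: integral_ge0.
- by rewrite lee_fin powR_ge0.
rewrite (tonelli mF)//.
apply: (@le_trans _ _
    ((A `^ (p - 1))%:E * \int[mu]_s (A * `|v s| `^ p)%:E)).
  rewrite lee_wpmul2l// ?lee_fin ?powR_ge0//; apply: ge0_le_integral => //.
  - by move=> s _; exact: integral_ge0.
  - exact: (@measurable_fun_fubini_tonelli_G _ _ _ _ _ mu F).
  - by apply/measurable_EFinP; exact: measurable_funM.
  - move=> s _; rewrite /F/=.
    under eq_integral do rewrite mulrC.
    rewrite ge0_integral_EFinZl ?powR_ge0//; last exact: measurable_subr.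
    rewrite muleC EFinM lee_wpmul2r ?lee_fin ?powR_ge0//.
    rewrite (@ge0_integral_shift _ (- s) (fun x => (k x)%:E))//.
    exact/measurable_EFinP.
rewrite ge0_integral_EFinZl ?(ltW A0)//.
by rewrite muleA -EFinM mulrC mulr_powRB1// ltW.
Qed.

(** Away from the origin z^c / c is a primitive for negative [c] too; negative exponents serve the
    tails in Marchaud's formula and in Hardy's inequality. *)
Lemma integral_powR_pos (c x y : R) : c != 0%R -> (0 < x)%R -> (x <= y)%R ->
  \int[mu]_(z in `]x, y[) (z `^ (c - 1))%:E = ((y `^ c - x `^ c) / c)%:E.
Proof.
move=> c0 x0; rewrite le_eqVlt => /predU1P[<-|xy].
  by rewrite set_itvoo0 integral_set0 subrr mul0r.
have cont : {in `[x, y], continuous (fun z : R => z `^ (c - 1))%R}.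
  move=> z /=; rewrite in_itv/= => /andP[xz _].
  apply: differentiable_continuous; apply/derivable1_diffP.
  by apply: derivable_powR; rewrite in_itv/= andbT (lt_le_trans x0).
rewrite -(@integral_itv_bndoo _ _ _ _ true false); last first.
  apply/measurable_EFinP; apply: measurable_funTS; exact: measurable_powR.
pose F (z : R) := (z `^ c / c)%R.
have dF (z : R) : (0 < z)%R -> is_derive z 1%R F (z `^ (c - 1))%R.
  move=> z0; rewrite (_ : F = (c^-1 *: (fun z : R => z `^ c))%R); last first.
    by apply/funext => w; rewrite /F /GRing.scale/= mulrC.
  have := @is_deriveZ _ _ _ (fun z : R => z `^ c)%R c^-1 z 1%R _ (is_derive1_powR c z0).
  by rewrite /GRing.scale/= mulrA mulVf// mul1r.
have cF (z : R) : (0 < z)%R -> {for z, continuous F}.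
  move=> z0; apply: differentiable_continuous; apply/derivable1_diffP.
  by have [] := dF z z0.
rewrite (@continuous_FTC2 _ (fun z => z `^ (c - 1))%R F)//.
- by rewrite /F -EFinB -mulrBl.
- by apply: continuous_in_subspaceT => z; rewrite inE; exact: cont.
- split.
  + by move=> z; rewrite in_itv/= => /andP[xz _]; have [] := dF z (lt_trans x0 xz).
  + by apply: cvg_at_right_filter; exact: cF.
  + by apply: cvg_at_left_filter; apply: cF; exact: lt_trans xy.
- move=> z; rewrite in_itv/= => /andP[xz _].
  by rewrite derive1E; have [_ ->] := dF z (lt_trans x0 xz).
Qed.

(** At the left end 0 the integrand may be singular, so the interval is exhausted by []y / (n + 1),
    y[] and monotone convergence applies; the boundary terms vanish in the limit because [c > 0]. *)
Lemma integral_powR (c x y : R) : (0 < c)%R -> (0 <= x)%R -> (x <= y)%R ->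
  \int[mu]_(z in `]x, y[) (z `^ (c - 1))%:E = ((y `^ c - x `^ c) / c)%:E.
Proof.
move=> c0; rewrite le_eqVlt => /predU1P[<-|x0]; last first.
  by move=> xy; apply: integral_powR_pos => //; rewrite gt_eqF.
rewrite le_eqVlt => /predU1P[<-|y0].
  by rewrite set_itvoo0 integral_set0 subrr mul0r.
pose F n := `](y / n.+1%:R)%R, y[%classic : set R.
have UF : `]0%R, y[%classic = \bigcup_i F i.
  apply/seteqP; split => z /=; rewrite in_itv/=.
    move=> /andP[z0 zy]; have [n _ hn] : exists2 n : nat, True & (y / z < n.+1%:R)%R.
      exists (Num.truncn (y / z)) => //.
      by have /andP[] := truncn_itv (ltW (divr_gt0 y0 z0)).
    exists n => //; rewrite /F/= in_itv/= zy andbT ltr_pdivrMr// mulrC -ltr_pdivrMr//.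
  move=> [n _]; rewrite /F/= in_itv/= => /andP[h ->]; rewrite andbT.
  by apply: lt_trans h; rewrite divr_gt0.
have mf (D : set R) : measurable_fun D (fun z : R => (z `^ (c - 1))%:E).
  apply/measurable_EFinP; apply: measurable_funTS; exact: measurable_powR.
have nd : nondecreasing_seq F.
  apply/nondecreasing_seqP => n; rewrite subsetEset => z.
  rewrite /F/= !in_itv/= => /andP[h ->]; rewrite andbT; apply: le_lt_trans h.
  by rewrite ler_pM2l// lef_pV2 ?posrE// ler_nat.
have := @ge0_nondecreasing_set_cvg_integral _ (measurableTypeR R) R F
  (fun z : R => (z `^ (c - 1))%:E) mu nd (fun=> measurable_itv _) (fun i => mf _).
rewrite -UF => /(_ _)/wrap[].
  by move=> i z _; rewrite lee_fin powR_ge0.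
move=> h1.
have h2 : \int[mu]_(x in F i) (x `^ (c - 1))%:E @[i --> \oo] -->
    ((y `^ c - 0 `^ c) / c)%:E.
  rewrite (_ : (fun i => _) =
    (fun i : nat => ((y `^ c - (y / i.+1%:R) `^ c) / c)%:E)); last first.
    apply/funext => i; rewrite integral_powR_pos ?gt_eqF ?divr_gt0//.
    by rewrite ler_pdivrMr// ler_peMr ?ler1n// ltW.
  apply: cvg_EFin; first exact: nearW.
  rewrite /comp/=.
  apply: cvgMl; apply: cvgB; first exact: cvg_cst.
  rewrite powR0 ?gt_eqF//.
  have /cvg_at_rightP := powR_cvg0 c0; apply; split.
    by move=> n; rewrite divr_gt0.
  by rewrite -[X in _ --> X](mulr0 y); apply: cvgM; [exact: cvg_cst|exact: cvg_harmonic].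
by have := cvg_unique _ h1 h2; apply.
Qed.

End integral_aux.

(** * The truncated power kernel, with its Beta and Gamma integrals *)

Section kernel.
Context {R : realType}.
Notation mu := (@lebesgue_measure R).

Lemma gt0_powRD (x r s : R) : 0 < x -> x `^ (r + s) = x `^ r * x `^ s.
Proof. by move=> x0; rewrite powRD// (gt_eqF x0) implybT. Qed.

(** The truncated power x_+^(a - 1), set to 0 at 0 as well, so that [kern 1] is the indicator of
    []0, +oo[]. Orders [a <= 0] occur too: [kern (- b)] is Marchaud's kernel, and [kern 0] is 1/x in
    the averaging weights for Hardy's inequality. *)
Definition kern (a x : R) : R := if 0 < x then x `^ (a - 1) else 0.

Lemma kern_ge0 a x : 0 <= kern a x.
Proof. by rewrite /kern; case: ifP => // _; exact: powR_ge0. Qed.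

Lemma kern_gt0 a x : 0 < x -> 0 < kern a x.
Proof. by move=> x0; rewrite /kern x0 powR_gt0. Qed.

Lemma kern_le0 a x : x <= 0 -> kern a x = 0.
Proof. by rewrite /kern ltNge => ->. Qed.

Lemma measurable_kern a : measurable_fun [set: R] (kern a).
Proof.
apply: measurable_fun_ifT => //.
exact: measurable_fun_ltr.
Qed.
Hint Resolve measurable_kern kern_ge0 : core.

Lemma kernM a c x : 0 < c -> kern a (c * x) = c `^ (a - 1) * kern a x.
Proof.
move=> c0; rewrite /kern pmulr_rgt0//; case: ifPn => x0; last by rewrite mulr0.
by rewrite powRM// ltW.
Qed.

Lemma integral_kern (a x y : R) : 0 < a -> 0 <= x -> x <= y ->
  (\int[mu]_(z in `]x, y[) (kern a z)%:E = ((y `^ a - x `^ a) / a)%:E)%E.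
Proof.
move=> a0 x0 xy; rewrite -(@integral_powR _ a)//; apply: eq_integral => z.
by rewrite inE/= in_itv/= => /andP[xz _]; rewrite /kern (le_lt_trans x0 xz).
Qed.

Lemma integral_restrict_EFin (D : set R) (f : R -> R) : measurable D ->
  (\int[mu]_x ((f \_ D) x)%:E = \int[mu]_(x in D) (f x)%:E)%E.
Proof.
move=> mD; rewrite [RHS]integral_mkcond; apply: eq_integral => x _.
by rewrite restrict_EFin.
Qed.

Lemma restrict_ge0 (D : set R) (f : R -> R) : (forall x, 0 <= f x) ->
  forall x, 0 <= (f \_ D) x.
Proof. by move=> f0 x; rewrite patchE; case: ifP. Qed.

Lemma measurable_restrict_itv (D : set R) (f : R -> R) : measurable D ->
  measurable_fun [set: R] f -> measurable_fun [set: R] (f \_ D).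
Proof.
by move=> mD mf; apply/(measurable_restrictT _ _).1 => //; exact: measurable_funTS.
Qed.

Let Bf a b : R -> R := fun s => kern a (1 - s) * kern b s.

Let mBf a b : measurable_fun [set: R] (Bf a b).
Proof. by apply: measurable_funM => //; exact: measurable_subl. Qed.

(** Euler's Beta integral. Its finiteness and positivity allow it to be divided out of the
    composition rule. *)
Definition beta_kern a b : R := fine (\int[mu]_s (Bf a b s)%:E).

Let kern_le a x : 2^-1 <= x <= 1 -> kern a x <= 1 + 2^-1 `^ (a - 1).
Proof.
move=> /andP[x2 x1]; have x0 : 0 < x by rewrite (lt_le_trans _ x2)// invr_gt0.
rewrite /kern x0; have [a1|a1] := leP 1 a.
  apply: (@le_trans _ _ (1 `^ (a - 1))); last by rewrite powR1 lerDl powR_ge0.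
  by rewrite ge0_ler_powR ?nnegrE ?subr_ge0// ltW.
rewrite (@le_trans _ _ (2^-1 `^ (a - 1))) ?lerDr//.
rewrite -(opprB 1 a) !powRN lef_pV2 ?posrE ?powR_gt0// ?invr_gt0//.
by rewrite ge0_ler_powR ?nnegrE ?subr_ge0 ?invr_ge0// ltW.
Qed.

(** Cut at 1/2: on each half one factor is nonsingular, hence bounded by [kern_le], and the other is
    an integrable power. *)
Let beta_fin a b : 0 < a -> 0 < b -> (\int[mu]_s (Bf a b s)%:E < +oo)%E.
Proof.
move=> a0 b0.
pose ca := 1 + 2^-1 `^ (a - 1); pose cb := 1 + 2^-1 `^ (b - 1).
have ca0 : 0 <= ca by rewrite addr_ge0 ?powR_ge0.
have cb0 : 0 <= cb by rewrite addr_ge0 ?powR_ge0.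
pose ka := kern a \_ `]0, 1[; pose kb := kern b \_ `]0, 1[.
have mka : measurable_fun [set: R] ka by exact: measurable_restrict_itv.
have mkb : measurable_fun [set: R] kb by exact: measurable_restrict_itv.
have ka0 x : 0 <= ka x by exact: restrict_ge0.
have kb0 x : 0 <= kb x by exact: restrict_ge0.
have h : (\int[mu]_s (Bf a b s)%:E <=
    \int[mu]_s (ca * kb s + cb * ka (1 - s))%:E)%E.
  apply: ge0_le_integral_EFin => //.
  - by move=> x; rewrite /Bf mulr_ge0.
  - apply: measurable_funD; first exact: measurable_funM.
    by apply: measurable_funM => //; exact: measurable_subl.
  - move=> s; rewrite /Bf.
    have [s0|s0] := leP s 0.
      by rewrite (kern_le0 b s0) mulr0 addr_ge0 ?mulr_ge0.
    have [s1|s1] := leP 1 s.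
      by rewrite (kern_le0 a) ?mul0r ?addr_ge0 ?mulr_ge0// subr_le0.
    rewrite /kb /ka !patchE !mem_set/= ?in_itv/= ?s0 ?s1//; last first.
      by rewrite subr_gt0 s1 ltrBlDr ltrDl.
    have [s2|s2] := leP s 2^-1.
      rewrite -[leLHS]addr0 lerD ?mulr_ge0// ler_wpM2r// kern_le//.
      by rewrite lerBlDr lerDl (ltW s0) andbT lerBrDr -lerBrDl; lra.
    rewrite -[leLHS]add0r lerD ?mulr_ge0// mulrC ler_wpM2r// kern_le//.
    by rewrite !ltW.
apply: (le_lt_trans h).
rewrite ge0_integral_EFinD//; last 4 first.
- exact: measurable_funM.
- by move=> x; rewrite mulr_ge0.
- by apply: measurable_funM => //; exact: measurable_subl.
- by move=> x; rewrite mulr_ge0.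
rewrite !ge0_integral_EFinZl//; last exact: measurable_subl.
rewrite (@ge0_integral_subr _ 1 (fun x => (ka x)%:E))//; last exact/measurable_EFinP.
rewrite !integral_restrict_EFin// !integral_kern//.
by rewrite -!EFinM -EFinD ltry.
Qed.

Lemma beta_kern_gt0 a b : 0 < a -> 0 < b -> 0 < beta_kern a b.
Proof.
move=> a0 b0; apply: fine_gt0; rewrite beta_fin// andbT.
apply: (@integral_gt0_itv _ 0 1) => //.
- by move=> x; rewrite mulr_ge0.
- by move=> x /andP[x0 x1]; rewrite mulr_gt0 ?kern_gt0// subr_gt0.
Qed.

(** The kernels are homogeneous, so the substitution s -> t s reduces to [t = 1]; the collected
    power of [t], of exponent (a - 1) + (b - 1) + 1, is that of [kern (a + b)]. *)
Lemma kern_convolution a b t : 0 < a -> 0 < b ->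
  (\int[mu]_s (kern a (t - s) * kern b s)%:E =
   (beta_kern a b * kern (a + b) t)%:E)%E.
Proof.
move=> a0 b0; have [t0|t0] := leP t 0.
  rewrite (kern_le0 _ t0) mulr0 integral0_eq// => s _.
  have [s0|s0] := leP s 0; first by rewrite (kern_le0 b s0) mulr0.
  by rewrite (kern_le0 a) ?mul0r// subr_le0 (le_trans t0)// ltW.
rewrite (@ge0_integral_affine _ t 0)//; last 2 first.
- apply/measurable_EFinP; apply: measurable_funM => //; exact: measurable_subl.
- by move=> x; rewrite lee_fin mulr_ge0.
under eq_integral => s _.
  rewrite addr0 -{1}(mulr1 t) -mulrBr !kernM//.
  rewrite mulrACA -gt0_powRD//.
  over.
rewrite ge0_integral_EFinZl ?powR_ge0//; last 2 first.
- exact: mBf.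
- by move=> x; rewrite mulr_ge0.
rewrite -[X in (_ * (_ * X))%E]fineK; last first.
  rewrite ge0_fin_numE ?beta_fin//.
  by apply: integral_ge0 => x _; rewrite lee_fin mulr_ge0.
rewrite -!EFinM -/(beta_kern a b); congr (_%:E).
rewrite mulrA mulrC; congr (_ * _); rewrite /kern t0.
rewrite -{1}(powRr1 (ltW t0)) -gt0_powRD//.
by congr (_ `^ _); ring.
Qed.

(** For - h < x <= 0 only [kern b (x + h)] is present and contributes h^b / b. For x > 0 the kernel
    decreases since [b < 1], so the absolute value integrates to the difference of the integrals
    over []0, T[] and []h, T + h[], again at most h^b / b. *)
Lemma kern_shift_bound (T b h : R) : 0 < T -> 0 < b < 1 -> 0 < h ->
  (\int[mu]_(x in `](- T)%R, T[) (`|kern b (x + h) - kern b x|)%:E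
    <= (2 * h `^ b / b)%:E)%E.
Proof.
move=> T0 /andP[b0 b1] h0.
pose f1 x := (kern b \_ `]0, h]) (x + h).
pose f2 := (fun x => `|kern b (x + h) - kern b x|) \_ `]0, T[.
pose f3 x := (kern b \_ `]h, T + h[) (x + h).
have mf0 : measurable_fun [set: R] (fun x => kern b (x + h)).
  by apply: measurableT_comp => //; exact: measurable_funD.
have mfd : measurable_fun [set: R] (fun x => `|kern b (x + h) - kern b x|).
  by apply: measurableT_comp => //; exact: measurable_funB.
have mf1 : measurable_fun [set: R] f1.
  apply: (measurableT_comp (measurable_restrict_itv _ _)) => //.
  exact: measurable_funD.
have mf2 : measurable_fun [set: R] f2 by exact: measurable_restrict_itv.
have mf3 : measurable_fun [set: R] f3.
  apply: (measurableT_comp (measurable_restrict_itv _ _)) => //.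
  exact: measurable_funD.
have f10 x : 0 <= f1 x by exact: restrict_ge0.
have f20 x : 0 <= f2 x by exact: restrict_ge0.
have f30 x : 0 <= f3 x by exact: restrict_ge0.
have kerndec (x y : R) : 0 < x -> x <= y -> kern b y <= kern b x.
  move=> x0 xy; rewrite /kern x0 (lt_le_trans x0 xy).
  rewrite -(opprB 1 b) !powRN lef_pV2 ?posrE ?powR_gt0 ?(lt_le_trans x0 xy)//.
  rewrite ge0_ler_powR ?nnegrE ?subr_ge0 ?(ltW b1) ?(ltW x0)//.
  exact: le_trans (ltW x0) xy.
rewrite -integral_restrict_EFin//.
apply: (@le_trans _ _ (\int[mu]_x (f1 x + f2 x)%:E)%E).
  apply: ge0_le_integral_EFin.
  - exact: measurable_restrict_itv.
  - exact: restrict_ge0.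
  - exact: measurable_funD.
  - move=> x; rewrite patchE; case: ifPn => [|_]; last by rewrite addr_ge0.
    rewrite inE/= in_itv/= => /andP[Tx xT].
    have [x0|x0] := leP x 0; last first.
      by rewrite -[leLHS]add0r lerD// /f2 patchE mem_set//= in_itv/= x0.
    rewrite (kern_le0 b x0) subr0 ger0_norm// -[leLHS]addr0 lerD// /f1.
    have [xh|xh] := leP (x + h) 0; first by rewrite (kern_le0 b xh) restrict_ge0.
    by rewrite patchE mem_set//= in_itv/= xh/= gerDr.
rewrite ge0_integral_EFinD//.
have -> : (\int[mu]_x (f1 x)%:E = (h `^ b / b)%:E)%E.
  rewrite (@ge0_integral_shift _ h (fun x => ((kern b \_ `]0, h]) x)%:E))//; last 2 first.
  - by apply/measurable_EFinP; exact: measurable_restrict_itv.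
  - by move=> x; rewrite lee_fin restrict_ge0.
  rewrite integral_restrict_EFin// -integral_itv_bndo_bndc; last first.
    by apply: measurable_funTS; exact/measurable_EFinP.
  by rewrite integral_kern ?(ltW h0)// powR0 ?gt_eqF// subr0.
have I3 : (\int[mu]_x (f3 x)%:E = (((T + h) `^ b - h `^ b) / b)%:E)%E.
  rewrite (@ge0_integral_shift _ h (fun x => ((kern b \_ `]h, T + h[) x)%:E))//; last 2 first.
  - by apply/measurable_EFinP; exact: measurable_restrict_itv.
  - by move=> x; rewrite lee_fin restrict_ge0.
  by rewrite integral_restrict_EFin// integral_kern ?(ltW h0)// lerDr ltW.
(* The integral of [f2] is found by subtraction: adding [f3] restores [kern b] on []0, T[], and the
   integral of [f3] is finite. *)
have I23 : (\int[mu]_x (f2 x)%:E + \int[mu]_x (f3 x)%:E = (T `^ b / b)%:E)%E.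
  rewrite -ge0_integral_EFinD//.
  transitivity (\int[mu]_x ((kern b \_ `]0, T[) x)%:E)%E.
    apply: eq_integral => x _; congr (_%:E); rewrite /f2 /f3 !patchE.
    have -> : (x + h \in `]h, T + h[%classic) = (x \in `]0, T[%classic).
      by apply/idP/idP; rewrite !inE/= !in_itv/= ltrD2r ltrDr.
    case: ifPn; last by rewrite addr0.
    rewrite inE/= in_itv/= => /andP[x0 _].
    by rewrite ler0_norm ?subr_le0 ?kerndec ?lerDl ?(ltW h0)// opprB subrK.
  by rewrite integral_restrict_EFin// integral_kern ?(ltW T0)// powR0 ?gt_eqF// subr0.
rewrite I3 in I23.
have -> : (\int[mu]_x (f2 x)%:E =
    (T `^ b / b)%:E - (((T + h) `^ b - h `^ b) / b)%:E)%E.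
  by rewrite -I23 addeK.
rewrite -EFinB -EFinD lee_fin.
rewrite -mulrBl -mulrDl ler_pM2r ?invr_gt0//.
have : T `^ b <= (T + h) `^ b.
  by apply: ge0_ler_powR; rewrite ?nnegrE; lra.
lra.
Qed.

(** Finiteness is half of the claim, since the real-valued integral would be 0 if the extended one
    were infinite. Below 1 the integrand is dominated by [kern a], beyond 1 by a multiple of the
    exponential density of rate 1/2. *)
Lemma Gamma_gt0 (a : R) : 0 < a -> 0 < Gamma a.
Proof.
move=> a0; pose g (x : R) := x `^ (a - 1) * expR (- x).
have mg : measurable_fun [set: R] g.
  apply: measurable_funM => //.
  by apply: (measurableT_comp (@measurable_expR R)) => //; exact: oppr_measurable.
have g0 x : 0 <= g x by rewrite mulr_ge0 ?powR_ge0 ?expR_ge0.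
have mg' : measurable_fun [set: R] (g \_ `]0, +oo[) by exact: measurable_restrict_itv.
apply: fine_gt0; rewrite -(integral_restrict_EFin g)//.
apply/andP; split.
  apply: (@integral_gt0_itv _ 0 1) => //; first exact: restrict_ge0.
  move=> x /andP[x0 _]; rewrite patchE mem_set/= ?in_itv/= ?x0//.
  by rewrite mulr_gt0 ?powR_gt0 ?expR_gt0.
(* From ln y <= y at y = x / (2a) one gets a ln x <= a ln (2a) + x / 2, so x^a exp (- x) is at most
   exp (a ln (2a)) exp (- x / 2). The factor 2 cancels the rate in the density. *)
pose C := 2 * expR (a * ln (2 * a)).
have C0 : 0 <= C by rewrite mulr_ge0 ?expR_ge0.
pose e : R -> R := exponential_pdf 2^-1.
have e0 x : 0 <= e x by rewrite exponential_pdf_ge0// invr_gt0.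
have me : measurable_fun [set: R] e by exact: measurable_exponential_pdf.
have mk1 : measurable_fun [set: R] (kern a \_ `]0, 1[) by exact: measurable_restrict_itv.
have k10 : forall x, 0 <= (kern a \_ `]0, 1[) x by exact: restrict_ge0.
apply: (@le_lt_trans _ _
  (\int[mu]_x ((kern a \_ `]0, 1[) x + C * e x)%:E)%E).
  apply: ge0_le_integral_EFin => //; first exact: restrict_ge0.
    by apply: measurable_funD => //; exact: measurable_funM.
  move=> x; rewrite patchE; case: ifPn => [|_]; last by rewrite addr_ge0 ?mulr_ge0.
  rewrite inE/= in_itv/= andbT => x0.
  have [x1|x1] := ltP x 1.
    rewrite -[leLHS]addr0 lerD ?mulr_ge0// patchE mem_set/= ?in_itv/= ?x0//.
    by rewrite /kern x0 /g ler_piMr ?powR_ge0// -expR0 ler_expR oppr_le0 ltW.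
  rewrite -[leLHS]add0r lerD// /g /e exponential_pdfE ?(ltW x0)//.
  rewrite -[leRHS]/(C * (2^-1 * expR (- 2^-1 * x))).
  rewrite /C mulrACA divff// mul1r -expRD.
  apply: (@le_trans _ _ (x `^ a * expR (- x))).
    by rewrite ler_pM2r ?expR_gt0// ler_powR// gerBl.
  rewrite /powR gt_eqF// -expRD ler_expR.
  have : a * ln x <= a * ln (2 * a) + x / 2.
    have -> : ln x = ln (2 * a) + ln (x / (2 * a)).
      rewrite -lnM ?posrE ?mulr_gt0 ?invr_gt0 ?divr_gt0 ?mulr_gt0//.
      by rewrite mulrC divfK// gt_eqF// mulr_gt0.
    rewrite mulrDr lerD2l.
    have : ln (x / (2 * a)) <= x / (2 * a).
      by apply/ltW/ln_sublinear; rewrite divr_gt0// mulr_gt0.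
    rewrite -(ler_pM2l a0) => /le_trans; apply.
    by rewrite le_eqVlt; apply/orP; left; apply/eqP; field; rewrite gt_eqF.
  lra.
rewrite ge0_integral_EFinD//; last 2 first.
- exact: measurable_funM.
- by move=> x; rewrite mulr_ge0.
rewrite ge0_integral_EFinZl// integral_exponential_pdf ?invr_gt0//.
by rewrite integral_restrict_EFin// integral_kern// mule1 -EFinD ltry.
Qed.

End kernel.
#[global] Hint Resolve measurable_kern kern_ge0 : core.

(** * Fractional integrals as convolutions, and their composition *)

Section fractional_integral.
Context {R : realType}.
Notation mu := (@lebesgue_measure R).

(** The integral runs over the whole line and carries no 1 / Gamma. Where it does not converge
    absolutely its value is 0 by default, so pointwise identities are conditional on finiteness of
    [EI]. *)
Definition RI (a : R) (v : R -> R) (t : R) : R :=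
  \int[mu]_s (kern a (t - s) * v s).

Definition EI (a : R) (v : R -> R) (t : R) : \bar R :=
  (\int[mu]_s (kern a (t - s) * `|v s|)%:E)%E.

Implicit Types (a b t : R) (v w : R -> R).

Lemma EI_ge0 a v t : (0 <= EI a v t)%E.
Proof.
by rewrite /EI; apply: integral_ge0 => s _; rewrite lee_fin mulr_ge0 ?kern_ge0.
Qed.

Lemma measurable_RI_integrand a t v : measurable_fun [set: R] v ->
  measurable_fun [set: R] (fun s => kern a (t - s) * v s).
Proof. by move=> mv; apply: measurable_funM => //; exact: measurable_subl. Qed.

Lemma normr_fine_le (x : \bar R) : (`|fine x|%:E <= `|x|)%E.
Proof. by case: x => [x| |]//=; rewrite ?normr0 ?leey. Qed.

Lemma normr_RI_le a v t : measurable_fun [set: R] v ->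
  (`|RI a v t|%:E <= EI a v t)%E.
Proof.
move=> mv; apply: (le_trans (normr_fine_le (\int[mu]_s (kern a (t - s) * v s)%:E)%E)).
apply: (le_trans (le_abse_integral mu _ _)) => //.
  by apply/measurable_EFinP; exact: measurable_RI_integrand.
rewrite le_eqVlt; apply/orP; left; apply/eqP; apply: eq_integral => s _.
by rewrite abse_EFin normrM ger0_norm ?kern_ge0.
Qed.

Lemma integrable_RI a v t : measurable_fun [set: R] v -> (EI a v t < +oo)%E ->
  mu.-integrable [set: R] (fun s => (kern a (t - s) * v s)%:E).
Proof.
move=> mv EIoo; apply/integrableP; split.
  by apply/measurable_EFinP; exact: measurable_RI_integrand.
apply: le_lt_trans EIoo; rewrite le_eqVlt; apply/orP; left; apply/eqP.
by apply: eq_integral => s _; rewrite abse_EFin normrM ger0_norm ?kern_ge0.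
Qed.

Lemma measurable_EI a v : measurable_fun [set: R] v ->
  measurable_fun [set: R] (EI a v).
Proof.
move=> mv; have mnv : measurable_fun [set: R] (fun x => `|v x|) by exact: measurableT_comp.
have m := measurable_convolution (measurable_kern a) mnv.
pose F (z : R * R) : \bar R := (kern a (z.1 - z.2) * `|v z.2|)%:E.
have mF : measurable_fun [set: R * R] F by exact/measurable_EFinP.
have F0 z : (0 <= F z)%E by rewrite lee_fin mulr_ge0 ?kern_ge0.
exact: (@measurable_fun_fubini_tonelli_F _ _ _ _ _ mu F mF F0).
Qed.

Lemma measurable_RI a v : measurable_fun [set: R] v ->
  measurable_fun [set: R] (RI a v).
Proof.
move=> mv; have m := measurable_convolution (measurable_kern a) mv.
pose F (z : R * R) : \bar R := (kern a (z.1 - z.2) * v z.2)%:E.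
have mF : measurable_fun [set: R * R] F by exact/measurable_EFinP.
rewrite (_ : RI a v = fun t => fine
    (\int[mu]_s (F^\+%E (t, s)) - \int[mu]_s (F^\-%E (t, s)))%E); last first.
  apply/funext => t; rewrite /RI /Rintegral integralE.
  rewrite (_ : (fun s => (kern a (t - s) * v s)%:E) = F \o pair t)//.
  by rewrite funepos_comp funeneg_comp.
apply: (measurableT_comp (fine_measurable measurableT)) => //.
apply: emeasurable_funB.
- apply: (@measurable_fun_fubini_tonelli_F _ _ _ _ _ mu (F^\+)%E); last by [].
  exact: measurable_funepos.
- apply: (@measurable_fun_fubini_tonelli_F _ _ _ _ _ mu (F^\-)%E); last by [].
  exact: measurable_funeneg.
Qed.

Lemma ae_eq_RI a v w : measurable_fun [set: R] v -> measurable_fun [set: R] w ->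
  ae_eq mu [set: R] v w -> RI a v = RI a w.
Proof.
move=> mv mw vw; apply/funext => t; congr fine; apply: ae_eq_integral => //.
- by apply/measurable_EFinP; exact: measurable_RI_integrand.
- by apply/measurable_EFinP; exact: measurable_RI_integrand.
- by apply: filterS vw => s /= /(_ I) ->.
Qed.

(** Tonelli brings the integral in [s] inside; translated by [r], it is [kern_convolution] at
    [t - r]. *)
Lemma EI_semigroup a b v t : 0 < a -> 0 < b -> measurable_fun [set: R] v ->
  (\int[mu]_s \int[mu]_r (kern b (t - s) * (kern a (s - r) * `|v r|))%:E =
   (beta_kern b a)%:E * EI (a + b) v t)%E.
Proof.
move=> a0 b0 mv.
have mnv : measurable_fun [set: R] (fun x => `|v x|) by exact: measurableT_comp.
have m := measurable_convolution (measurable_kern a) mnv.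
pose F (z : R * R) := (kern b (t - z.1) * (kern a (z.1 - z.2) * `|v z.2|))%:E.
have mF : measurable_fun [set: R * R] F.
  apply/measurable_EFinP; apply: measurable_funM => //.
  by apply: (measurableT_comp (measurable_subl t (measurable_kern b))).
rewrite (@tonelli _ F)//; last by move=> z; rewrite lee_fin !mulr_ge0 ?kern_ge0.
rewrite /EI -ge0_integral_EFinZl; last 3 first.
- by apply/ltW/beta_kern_gt0.
- exact: measurable_RI_integrand.
- by move=> x; rewrite mulr_ge0 ?kern_ge0.
apply: eq_integral => r _; rewrite /F/=.
under eq_integral => s _ do rewrite mulrA mulrC.
rewrite ge0_integral_EFinZl//; last 2 first.
- apply: measurable_funM; first exact: measurable_subl.
  exact: measurable_subr.
- by move=> x; rewrite mulr_ge0 ?kern_ge0.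
rewrite -(@ge0_integral_shift _ r (fun s => (kern b (t - s) * kern a (s - r))%:E)); last 2 first.
- apply/measurable_EFinP; apply: measurable_funM; first exact: measurable_subl.
  exact: measurable_subr.
- by move=> x; rewrite lee_fin mulr_ge0 ?kern_ge0.
under eq_integral => s _ do rewrite addrK opprD addrA addrAC.
by rewrite kern_convolution// -EFinM mulrC [in RHS]mulrA [a + b]addrC.
Qed.

(** [EI_semigroup] makes the double integral absolutely convergent, which permits Fubini for the
    signed integrand. *)
Lemma RI_semigroup a b v t : 0 < a -> 0 < b -> measurable_fun [set: R] v ->
  (EI (a + b) v t < +oo)%E ->
  RI b (RI a v) t = beta_kern b a * RI (a + b) v t.
Proof.
move=> a0 b0 mv EIoo.
have B0 := beta_kern_gt0 b0 a0.
have m := measurable_convolution (measurable_kern a) mv.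
pose F (z : R * R) := (kern b (t - z.1) * (kern a (z.1 - z.2) * v z.2))%:E.
have mF : measurable_fun [set: R * R] F.
  apply/measurable_EFinP; apply: measurable_funM => //.
  by apply: (measurableT_comp (measurable_subl t (measurable_kern b))).
have iF : (mu \x mu)%E.-integrable [set: R * R] F.
  apply/integrable12ltyP => //.
  rewrite [ltLHS](_ : _ = (beta_kern b a)%:E * EI (a + b) v t)%E; last first.
    rewrite -(EI_semigroup t a0 b0 mv); apply: eq_integral => s _; apply: eq_integral => r _.
    by rewrite /F/= !normrM !(ger0_norm (kern_ge0 _ _)).
  by rewrite lte_mul_pinfty// ?lee_fin ltW.
have h1 : (\int[mu]_s \int[mu]_r F (s, r) = \int[mu]_r \int[mu]_s F (s, r))%E.
  exact: (Fubini iF).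
have h2 : (\int[mu]_r \int[mu]_s F (s, r) =
    \int[mu]_r ((beta_kern b a)%:E * (kern (a + b) (t - r) * v r)%:E))%E.
  apply: eq_integral => r _; rewrite /F/=.
  under eq_integral => s _ do rewrite mulrA mulrC EFinM.
  have kfin : (\int[mu]_x (kern b (t - x) * kern a (x - r))%:E =
     (beta_kern b a * kern (a + b) (t - r))%:E)%E.
    rewrite -(@ge0_integral_shift _ r (fun s => (kern b (t - s) * kern a (s - r))%:E)); last 2 first.
    - apply/measurable_EFinP; apply: measurable_funM; first exact: measurable_subl.
      exact: measurable_subr.
    - by move=> x; rewrite lee_fin mulr_ge0 ?kern_ge0.
    under eq_integral => s _ do rewrite addrK opprD addrA addrAC.
    by rewrite kern_convolution// [a + b]addrC.
  have mk : measurable_fun [set: R] (fun x => kern b (t - x) * kern a (x - r)).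
    by apply: measurable_funM; [exact: measurable_subl|exact: measurable_subr].
  rewrite integralZl//; last first.
    apply/integrableP; split; first exact/measurable_EFinP.
    rewrite (_ : (\int[mu]_x _)%E = (beta_kern b a * kern (a + b) (t - r))%:E).
      by rewrite ltry.
    by rewrite -kfin; apply: eq_integral => x _; rewrite abse_EFin ger0_norm ?mulr_ge0 ?kern_ge0.
  by rewrite kfin -!EFinM; congr (_%:E); ring.
rewrite h2 integralZl// in h1; last exact: integrable_RI.
have h3 : (\int[mu]_s \int[mu]_r F (s, r) =
    \int[mu]_s (kern b (t - s) * RI a v s)%:E)%E.
  apply: ae_eq_integral => //.
  - exact: (measurable_fubini_F iF).
  - by apply/measurable_EFinP; apply: measurable_RI_integrand; exact: measurable_RI.
  - have := ae_integrable1 iF; apply: filterS => s /= + _.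
    rewrite /F/= => iFs.
    (* Fubini yields integrability of the slice multiplied by [kern b (t - s)]. Where this factor
       vanishes both sides are 0; elsewhere it is divided out. *)
    have [k0|k0] := eqVneq (kern b (t - s)) 0.
      by rewrite k0 mul0r integral0_eq// => r _; rewrite mul0r.
    have i2 : mu.-integrable [set: R] (fun r => (kern a (s - r) * v r)%:E).
      have := integrableZl measurableT (kern b (t - s))^-1 iFs.
      apply: eq_integrable => // r _.
      by rewrite /= -EFinM mulKf.
    under eq_integral do rewrite EFinM.
    rewrite integralZl// EFinM; congr (_ * _)%E.
    by rewrite /RI /Rintegral fineK//; exact: integrable_fin_num.
rewrite h3 in h1; rewrite {1}/RI /Rintegral h1.
by rewrite fineM//; apply: integrable_fin_num => //; exact: integrable_RI.
Qed.

Lemma RI_lin a v w (c : R) t : measurable_fun [set: R] v ->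
  measurable_fun [set: R] w -> (EI a v t < +oo)%E -> (EI a w t < +oo)%E ->
  RI a (fun x => v x + c * w x) t = RI a v t + c * RI a w t.
Proof.
move=> mv mw iv iw.
have h1 := integrable_RI mv iv; have h2 := integrable_RI mw iw.
rewrite /RI -RintegralZl// -RintegralD//; last first.
  have := integrableZl measurableT c h2; apply: eq_integrable => // x _.
by apply: eq_Rintegral => s _; ring.
Qed.

End fractional_integral.

(** * Zero extensions of functions in L^p(0,T), and the operators [J] on them *)

Section Lz.
Context {R : realType}.
Notation mu := (@lebesgue_measure R).
Notation "f =ae g" := (ae_eq mu [set: R] f g) (at level 70).
Implicit Types (a b c p q T t : R) (u v w : R -> R).

Lemma aeS (P Q : R -> Prop) : (forall x, P x -> Q x) ->
  {ae mu, forall x, P x} -> {ae mu, forall x, Q x}.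
Proof. by move=> PQ; apply: filterS; [exact: (ae_filter_ringOfSetsType mu)|exact: PQ]. Qed.

Lemma aeS2 (P Q S : R -> Prop) : (forall x, P x -> Q x -> S x) ->
  {ae mu, forall x, P x} -> {ae mu, forall x, Q x} -> {ae mu, forall x, S x}.
Proof. by move=> PQ; apply: filterS2; [exact: (ae_filter_ringOfSetsType mu)|exact: PQ]. Qed.

Lemma integral_cst_restrict T c : 0 < T ->
  (\int[mu]_x ((cst c \_ `]0, T[) x)%:E = (c * T)%:E)%E.
Proof.
move=> T0; rewrite integral_restrict_EFin//.
transitivity (c%:E * mu `]0%R, T[%classic)%E; first exact: (@integral_cst _ _ _ mu `]0, T[%classic (measurable_itv _) c%:E).
by rewrite lebesgue_measure_itv/= lte_fin T0 -EFinD -EFinM subr0.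
Qed.

Lemma normr_powRD p (x y : R) : 1 <= p ->
  `|x + y| `^ p <= 2 `^ p * (`|x| `^ p + `|y| `^ p).
Proof.
move=> p1; have p0 : 0 <= p by exact: le_trans p1.
wlog xy : x y / `|x| <= `|y|.
  move=> h; have [/h//|/ltW/h] := leP `|x| `|y|.
  by rewrite addrC [X in _ * X]addrC.
apply: (@le_trans _ _ ((2 * `|y|) `^ p)).
  apply: ge0_ler_powR; rewrite ?nnegrE ?mulr_ge0//.
  by rewrite (le_trans (ler_normD _ _))//; lra.
by rewrite powRM// ler_wpM2l ?powR_ge0// lerDr powR_ge0.
Qed.

Lemma Lpow_ge0 p v : (0 <= Lpow p v)%E.
Proof. by rewrite /Lpow; apply: integral_ge0 => x _; rewrite lee_fin powR_ge0. Qed.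

Lemma LpowD p v w : 1 <= p -> measurable_fun [set: R] v -> measurable_fun [set: R] w ->
  (Lpow p (fun x => v x + w x)%R <= (2 `^ p)%:E * (Lpow p v + Lpow p w))%E.
Proof.
move=> p1 mv mw.
have mv' := measurable_normr_powR p mv; have mw' := measurable_normr_powR p mw.
rewrite /Lpow -ge0_integral_EFinD//.
rewrite -ge0_integral_EFinZl ?powR_ge0//; last exact: measurable_funD.
apply: ge0_le_integral_EFin => //.
- by apply: measurable_normr_powR; exact: measurable_funD.
- by apply: measurable_funM => //; exact: measurable_funD.
- by move=> x; exact: normr_powRD.
Qed.

Lemma LpowZ p c v : measurable_fun [set: R] v ->
  Lpow p (fun x => c * v x) = ((`|c| `^ p)%:E * Lpow p v)%E.
Proof.
move=> mv; rewrite /Lpow -ge0_integral_EFinZl ?powR_ge0//; last exact: measurable_normr_powR.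
by apply: eq_integral => x _; rewrite normrM powRM.
Qed.

Lemma LpowN p v : Lpow p (fun x => - v x) = Lpow p v.
Proof. by apply: eq_integral => x _; rewrite normrN. Qed.

Lemma ae_eq_Lpow p v w : measurable_fun [set: R] v -> measurable_fun [set: R] w ->
  v =ae w -> Lpow p v = Lpow p w.
Proof.
move=> mv mw vw; apply: ae_eq_integral => //.
- by apply/measurable_EFinP; exact: measurable_normr_powR.
- by apply/measurable_EFinP; exact: measurable_normr_powR.
- by apply: aeS vw => x /= /(_ I) ->.
Qed.

Lemma Lpow_eq0 p v : 0 < p -> measurable_fun [set: R] v -> Lpow p v = 0%E ->
  v =ae cst 0.
Proof.
move=> p0 mv v0.
have : ae_eq mu setT (fun x => (`|v x| `^ p)%:E) (cst 0%E).
  apply/ae_eq_integral_abs => //.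
    by apply/measurable_EFinP; exact: measurable_normr_powR.
  rewrite -[RHS]v0; apply: eq_integral => x _.
  by rewrite abse_EFin ger0_norm ?powR_ge0.
apply: aeS => x /= /(_ I) [] /powR_eq0_eq0 /eqP.
by rewrite normr_eq0 => /eqP -> _.
Qed.

(* The representatives, extended by zero, of the elements of L^p(0,T). *)
Definition Lz T p v : Prop :=
  [/\ measurable_fun [set: R] v, (forall x, ~~ (0 < x < T) -> v x = 0) &
      (Lpow p v < +oo)%E].

Lemma LzD T p v w : 1 <= p -> Lz T p v -> Lz T p w -> Lz T p (fun x => v x + w x).
Proof.
move=> p1 [mv sv fv] [mw sw fw]; split; first exact: measurable_funD.
  by move=> x xT; rewrite sv// sw// addr0.
apply: (le_lt_trans (LpowD p1 mv mw)).
by apply: lte_mul_pinfty; [rewrite lee_fin powR_ge0|by []|exact: lte_add_pinfty fv fw].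
Qed.

Lemma LzZ T p c v : Lz T p v -> Lz T p (fun x => c * v x).
Proof.
move=> [mv sv fv]; split; first exact: measurable_funM.
  by move=> x xT; rewrite sv// mulr0.
by rewrite LpowZ// lte_mul_pinfty ?lee_fin ?powR_ge0.
Qed.

Lemma LzN T p v : Lz T p v -> Lz T p (fun x => - v x).
Proof.
move=> [mv sv fv]; split; last by rewrite LpowN.
  by apply: measurableT_comp => //; exact: oppr_measurable.
by move=> x xT; rewrite sv// oppr0.
Qed.

Lemma LzB T p v w : 1 <= p -> Lz T p v -> Lz T p w -> Lz T p (fun x => v x - w x).
Proof. by move=> p1 hv hw; exact: (LzD p1 hv (LzN hw)). Qed.

Lemma Lz_cst0 T p : 0 < p -> Lz T p (cst 0).
Proof.
move=> p0; split => //; rewrite /Lpow integral0_eq ?ltry// => x _.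
by rewrite normr0 powR0// gt_eqF.
Qed.

Lemma Lz_bounded T p v (M : R) : 0 < T -> 0 < p -> measurable_fun [set: R] v ->
  (forall x, ~~ (0 < x < T) -> v x = 0) -> (forall x, `|v x| <= M) -> Lz T p v.
Proof.
move=> T0 p0 mv sv bv; split => //.
have M0 : 0 <= M by apply: le_trans (bv 0).
apply: (@le_lt_trans _ _ (\int[mu]_x ((cst (M `^ p) \_ `]0, T[) x)%:E)%E).
  apply: ge0_le_integral_EFin => //.
  - exact: measurable_normr_powR.
  - exact: measurable_restrict_itv.
  - move=> x; rewrite patchE; case: ifPn => [_|].
      by rewrite ge0_ler_powR ?nnegrE// ltW.
    rewrite notin_setE/= in_itv/= => /negP/sv ->.
    by rewrite normr0 powR0// gt_eqF.
by rewrite integral_cst_restrict// ltry.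
Qed.

(** On []0, T[] one has |v| <= 1 + |v|^p, and the constant is integrable there. *)
Lemma Lz_Lpow1 T p v : 0 < T -> 1 <= p -> Lz T p v -> Lz T 1 v.
Proof.
move=> T0 p1 [mv sv fv]; split => //.
have p0 : 0 < p by exact: lt_le_trans p1.
have mc : measurable_fun [set: R] (cst (1:R) \_ `]0, T[) by exact: measurable_restrict_itv.
have c0 (x : R) : 0 <= (cst (1:R) \_ `]0, T[) x by exact: restrict_ge0.
apply: (@le_lt_trans _ _ (\int[mu]_x ((cst (1:R) \_ `]0, T[) x + `|v x| `^ p)%:E)%E).
  apply: ge0_le_integral_EFin => //.
  - exact: measurable_normr_powR.
  - by apply: measurable_funD => //; exact: measurable_normr_powR.
  - move=> x; have [xT|xT] := boolP (0 < x < T); last first.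
      by rewrite sv// normr0 powR0 ?oner_eq0// addr_ge0 ?powR_ge0.
    rewrite patchE mem_set ?in_itv//= powRr1//.
    have [v1|v1] := leP `|v x| 1; first by rewrite (le_trans v1)// lerDl powR_ge0.
    by rewrite (le_trans (le1r_powR (ltW v1) p1))// lerDr.
rewrite ge0_integral_EFinD//; last exact: measurable_normr_powR.
by rewrite integral_cst_restrict// lte_add_pinfty// ltry.
Qed.

Lemma Lz_integrable T p v : 0 < T -> 1 <= p -> Lz T p v ->
  mu.-integrable [set: R] (EFin \o v).
Proof.
move=> T0 p1 /(Lz_Lpow1 T0 p1)[mv _ fv]; apply/integrableP; split.
  exact/measurable_EFinP.
apply: le_lt_trans fv; rewrite le_eqVlt; apply/orP; left; apply/eqP.
by apply: eq_integral => x _; rewrite /= powRr1.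
Qed.

Definition cut T v : R -> R := v \_ `]0, T[.

Lemma cutE T v x : cut T v x = if 0 < x < T then v x else 0.
Proof.
rewrite /cut patchE; case: ifPn.
  by rewrite inE/= in_itv/= => ->.
by rewrite notin_setE/= in_itv/= => /negP/negbTE ->.
Qed.

Lemma cut_in T v x : 0 < x < T -> cut T v x = v x.
Proof. by rewrite cutE => ->. Qed.

Lemma cut_out T v x : ~~ (0 < x < T) -> cut T v x = 0.
Proof. by rewrite cutE => /negbTE ->. Qed.

Lemma cut_id T p v : Lz T p v -> cut T v = v.
Proof.
move=> [_ sv _]; apply/funext => x; rewrite cutE.
by case: ifPn => // /sv ->.
Qed.

Lemma measurable_cut T v : measurable_fun [set: R] v -> measurable_fun [set: R] (cut T v).
Proof. by move=> mv; exact: measurable_restrict_itv. Qed.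

(* The Riemann-Liouville integral on (0,T), without the factor [1 / Gamma a]. *)
Definition J T a v : R -> R := cut T (RI a v).

Lemma J_in T a v t : 0 < t < T -> J T a v t = RI a v t.
Proof. exact: cut_in. Qed.

(** For [s] and [t] in []0, T[] only the part of [kern a] on []0, T[] is seen, and its mass is T^a /
    a; Young's inequality applies to the truncated kernel. *)
Lemma EI_young T a p v : 0 < T -> 0 < a -> 1 <= p ->
  measurable_fun [set: R] v -> (forall x, ~~ (0 < x < T) -> v x = 0) ->
  (\int[mu]_(t in `]0%R, T[) (EI a v t `^ p) <=
    (((T `^ a) / a) `^ p)%:E * Lpow p v)%E.
Proof.
move=> T0 a0 p1 mv sv.
have p0 : 0 < p by exact: lt_le_trans p1.
have mk : measurable_fun [set: R] (kern a \_ `]0, T[) by exact: measurable_restrict_itv.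
have k0 (x : R) : 0 <= (kern a \_ `]0, T[) x by apply: restrict_ge0.
have A0 : 0 < T `^ a / a by rewrite divr_gt0// powR_gt0.
have kA : (\int[mu]_x ((kern a \_ `]0, T[) x)%:E <= (T `^ a / a)%:E)%E.
  by rewrite integral_restrict_EFin// integral_kern ?(ltW T0)// powR0 ?gt_eqF// subr0.
apply: (le_trans _ (young_convolution p1 A0 mk mv k0 kA)).
rewrite integral_mkcond.
have mm : measurable_fun [set: R] (fun x => `|v x|) by exact: measurableT_comp.
apply: ge0_le_integral => //.
- by move=> t _; rewrite patchE; case: ifP => // _; exact: poweR_ge0.
- apply/(measurable_restrictT _ _).1 => //; apply: measurable_funTS.
  by apply: (measurableT_comp (measurable_poweR _)); exact: measurable_EI.
- apply: (measurableT_comp (measurable_poweR _)).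
  pose F (z : R * R) : \bar R := ((kern a \_ `]0, T[) (z.1 - z.2) * `|v z.2|)%:E.
  have mF : measurable_fun [set: R * R] F.
    by apply/measurable_EFinP; exact: (measurable_convolution mk mm).
  have F0 z : (0 <= F z)%E by rewrite lee_fin mulr_ge0.
  exact: (@measurable_fun_fubini_tonelli_F _ _ _ _ _ mu F mF F0).
- move=> t _; rewrite patchE; case: ifPn => [|_]; last exact: poweR_ge0.
  rewrite inE/= in_itv/= => /andP[t0 tT].
  rewrite le_eqVlt; apply/orP; left; apply/eqP; congr (_ `^ _)%E.
  apply: eq_integral => s _; congr (_%:E).
  have [sT|sT] := boolP (0 < s < T); last by rewrite sv// normr0 !mulr0.
  rewrite patchE; case: ifPn => //.
  rewrite notin_setE/= in_itv/= => /negP; rewrite negb_and -!leNgt => /orP[h|].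
    by rewrite (kern_le0 a h).
  by move: sT => /andP[s0 _]; lra.
Qed.

Lemma J_Lpow T a p v : 0 < T -> 0 < a -> 1 <= p -> Lz T p v ->
  (Lpow p (J T a v) <= (((T `^ a) / a) `^ p)%:E * Lpow p v)%E.
Proof.
move=> T0 a0 p1 [mv sv fv].
have p0 : 0 < p by exact: lt_le_trans p1.
apply: le_trans (EI_young T0 a0 p1 mv sv).
rewrite [leRHS]integral_mkcond; apply: ge0_le_integral => //.
- apply/measurable_EFinP; apply: measurable_normr_powR.
  by apply: measurable_cut; exact: measurable_RI.
- apply/(measurable_restrictT _ _).1 => //; apply: measurable_funTS.
  by apply: (measurableT_comp (measurable_poweR _)); exact: measurable_EI.
- move=> t _; rewrite /J cutE patchE.
  case: ifPn => tT; last first.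
    rewrite memNset/= ?in_itv/=; last by rewrite (negbTE tT).
    by rewrite normr0 powR0// gt_eqF.
  rewrite mem_set/= ?in_itv//= -poweR_EFin.
  apply: gt0_ler_poweR; rewrite ?(ltW p0) ?in_itv/= ?leey ?andbT ?EI_ge0//.
  exact: normr_RI_le.
Qed.

Lemma J_Lz T a p v : 0 < T -> 0 < a -> 1 <= p -> Lz T p v -> Lz T p (J T a v).
Proof.
move=> T0 a0 p1 hv; split.
- by apply: measurable_cut; apply: measurable_RI; case: hv.
- by move=> x xT; rewrite /J cut_out.
- apply: (le_lt_trans (J_Lpow T0 a0 p1 hv)); case: hv => _ _ fv.
  by rewrite lte_mul_pinfty ?lee_fin ?powR_ge0.
Qed.

(** The case of exponent 1 in [EI_young] shows that [EI a v] is integrable on []0, T[], hence finite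
    almost everywhere. Linearity and composition of [J] are proved on this set. *)
Lemma EI_fin_ae T a p v : 0 < T -> 0 < a -> 1 <= p -> Lz T p v ->
  {ae mu, forall t, 0 < t < T -> (EI a v t < +oo)%E}.
Proof.
move=> T0 a0 p1 /(Lz_Lpow1 T0 p1)[mv sv fv].
have h : (\int[mu]_(t in `]0%R, T[) (EI a v t) < +oo)%E.
  have h := EI_young T0 a0 (lexx 1) mv sv.
  have h2 : (((T `^ a / a) `^ 1)%:E * Lpow 1 v < +oo)%E.
    by rewrite lte_mul_pinfty ?lee_fin ?powR_ge0.
  apply: le_lt_trans h2; apply: le_trans h.
  rewrite le_eqVlt; apply/orP; left; apply/eqP; apply: eq_integral => t _.
  by rewrite poweRe1// EI_ge0.
have : mu.-integrable `]0%R, T[ (EI a v).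
  apply/integrableP; split; first by apply: measurable_funTS; exact: measurable_EI.
  apply: le_lt_trans h; rewrite le_eqVlt; apply/orP; left; apply/eqP.
  by apply: eq_integral => t _; rewrite gee0_abs// EI_ge0.
move=> /integrable_ae => /(_ (measurable_itv _)); apply: aeS => t /= h1 tT.
by have /fin_numPlt/andP[] := h1 (tT : t \in `]0, T[).
Qed.

(** Causality: at time [t] only earlier values of [v] enter, so the truncation at [T] built into [J]
    does not disturb compositions. *)
Lemma RI_cut T a v t : t < T -> (forall x, x <= 0 -> v x = 0) ->
  RI a (cut T v) t = RI a v t.
Proof.
move=> tT v0; apply: eq_Rintegral => s _; rewrite cutE.
have [st|ts] := ltP s t; last by rewrite kern_le0 ?mul0r// subr_le0.
case: ifPn => //; rewrite (lt_trans st tT) andbT -leNgt => s0.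
by rewrite v0.
Qed.

Lemma RI_le0 a v t : t <= 0 -> (forall x, x <= 0 -> v x = 0) -> RI a v t = 0.
Proof.
move=> t0 v0; rewrite /RI /Rintegral integral0_eq// => s _.
have [s0|s0] := leP s 0; first by rewrite v0// mulr0.
by rewrite kern_le0 ?mul0r// subr_le0 (le_trans t0)// ltW.
Qed.

Lemma Lz_le0 T p v x : Lz T p v -> x <= 0 -> v x = 0.
Proof. by move=> [_ sv _] x0; apply: sv; rewrite ltNge x0. Qed.

Lemma J_semigroup T a b p v : 0 < T -> 0 < a -> 0 < b -> 1 <= p -> Lz T p v ->
  J T b (J T a v) =ae (fun t => beta_kern b a * J T (a + b) v t).
Proof.
move=> T0 a0 b0 p1 hv; have [mv sv fv] := hv.
have := EI_fin_ae T0 (addr_gt0 a0 b0) p1 hv.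
apply: aeS => t /= h _.
rewrite /J [LHS]cutE [X in _ * X]cutE; case: ifPn => tT; last by rewrite mulr0.
rewrite RI_cut ?RI_semigroup//; last 2 first.
- by move: tT => /andP[].
- by move=> x x0; apply: RI_le0 => // y y0; exact: (Lz_le0 hv).
exact: h.
Qed.

Lemma J_lin T a p c v w : 0 < T -> 0 < a -> 1 <= p -> Lz T p v -> Lz T p w ->
  J T a (fun x => v x + c * w x) =ae (fun t => J T a v t + c * J T a w t).
Proof.
move=> T0 a0 p1 hv hw.
move: (EI_fin_ae T0 a0 p1 hv) (EI_fin_ae T0 a0 p1 hw).
apply: aeS2 => t /= h1 h2 _.
rewrite /J !cutE; case: ifPn => tT; last by rewrite mulr0 addr0.
by rewrite RI_lin ?h1 ?h2//; [case: hv|case: hw].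
Qed.

(** Equality holds at every point, since a change of [v] on a null set leaves each of the integrals
    unchanged. *)
Lemma ae_eq_J T a v w : measurable_fun [set: R] v -> measurable_fun [set: R] w ->
  v =ae w -> J T a v = J T a w.
Proof. by move=> mv mw vw; rewrite /J (ae_eq_RI a mv mw vw). Qed.

Lemma JZ T a p c v : 0 < T -> 0 < a -> 1 <= p -> Lz T p v ->
  J T a (fun x => c * v x) =ae (fun t => c * J T a v t).
Proof.
move=> T0 a0 p1 hv; have p0 : 0 < p by exact: lt_le_trans p1.
have E1 : (fun x => (cst 0 : R -> R) x + c * v x) = (fun x => c * v x).
  by apply/funext => x; rewrite /cst add0r.
have E2 : J T a (cst 0) = cst 0.
  apply/funext => x; rewrite /J cutE; case: ifP => // _.
  by rewrite /RI /Rintegral integral0_eq// => s _; rewrite mulr0.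
have := J_lin c T0 a0 p1 (Lz_cst0 T p0) hv; rewrite E1 E2.
by apply: aeS => t /(_ I) -> _; rewrite /cst add0r.
Qed.

Lemma JB T a p v w : 0 < T -> 0 < a -> 1 <= p -> Lz T p v -> Lz T p w ->
  J T a (fun x => v x - w x) =ae (fun t => J T a v t - J T a w t).
Proof.
move=> T0 a0 p1 hv hw; have := J_lin (-1) T0 a0 p1 hv hw.
apply: aeS => t /= /(_ I); rewrite mulN1r => <- _; congr (J T a _ t).
by apply/funext => x; rewrite mulN1r.
Qed.

End Lz.

(** * Smooth bump functions approaching the indicator of an interval *)

Section smooth_bump.
Context {R : realType}.
Implicit Types (f g : R -> R) (n k : nat) (x : R).

Fixpoint n_derivable n f : Prop :=
  if n is m.+1 then (forall x, derivable f x 1) /\ n_derivable m (derive1 f) else True.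

Lemma n_derivable_le n f : n_derivable n.+1 f -> n_derivable n f.
Proof. by elim: n f => // n IH f [df nf]; split => //; exact: IH. Qed.

Lemma n_derivable_derive n f : (forall m, n_derivable m f) ->
  forall x, derivable (derive1n n f) x 1.
Proof.
elim: n f => [f nf x|n IH f nf x]; first by rewrite derive1n0; case: (nf 1%N).
by rewrite derive1Sn; apply: IH => m; case: (nf m.+1).
Qed.

Lemma n_derivableD n f g : n_derivable n f -> n_derivable n g ->
  n_derivable n (fun x => f x + g x).
Proof.
elim: n f g => // n IH f g [df nf] [dg ng]; split.
  by move=> x; exact: derivableD.
rewrite (_ : derive1 (fun x => f x + g x) = fun x => (derive1 f) x + (derive1 g) x); first exact: IH.
by apply/funext => x; rewrite !derive1E; exact: deriveD.
Qed.

Lemma n_derivableM n f g : n_derivable n f -> n_derivable n g ->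
  n_derivable n (fun x => f x * g x).
Proof.
elim: n f g => // n IH f g nf ng; have [df nf'] := nf; have [dg ng'] := ng; split.
  by move=> x; exact: derivableM.
rewrite (_ : derive1 (fun x => f x * g x) = fun x => f x * (derive1 g) x + g x * (derive1 f) x).
  by apply: n_derivableD; apply: IH => //; exact: n_derivable_le.
by apply/funext => x; rewrite !derive1E deriveM.
Qed.

Lemma n_derivable_cst n (c : R) : n_derivable n (cst c).
Proof.
elim: n c => // n IH c; split; first by move=> x; exact: derivable_cst.
by rewrite (_ : derive1 (cst c) = cst 0)//; apply/funext => x; rewrite derive1_cst.
Qed.

Lemma n_derivable_affine n f (a b : R) : n_derivable n f ->
  n_derivable n (fun x => f (a * x + b)).
Proof.
elim: n f => // n IH f [df nf].
have d (x : R) : is_derive x 1 (fun x => f (a * x + b)) (a * (derive1 f) (a * x + b)).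
  have h1 : is_derive x (1:R) (fun x : R => a * x + b) a.
    apply: is_derive_eq; rewrite addr0 -[RHS]mulr1; congr (_ * _).
  have h2 : is_derive (a * x + b) (1:R) f ((derive1 f) (a * x + b)).
    by split; [exact: df|rewrite derive1E].
  have := @is_derive1_comp R f (fun x => a * x + b) x _ _ h2 h1.
  by rewrite mulrC.
split; first by move=> x; have [] := d x.
rewrite (_ : derive1 (fun x => f (a * x + b)) = fun x => cst a x * (derive1 f) (a * x + b)).
  by apply: n_derivableM; [exact: n_derivable_cst|exact: IH].
by apply/funext => x; rewrite derive1E; have [_ ->] := d x.
Qed.

(* The class [x^(-k) exp(-1/x)] (extended by 0) is stable under derivation up to
   linear combinations. *)
Definition flat k x : R := if 0 < x then x^-1 ^+ k * expR (- x^-1) else 0.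

(** Keeping the single term y^(k+2) / (k+2)! of the exponential series at y = 1/x leaves a bound
    quadratic in [x], which makes the difference quotient at 0 vanish. *)
Lemma flat_bound k x : `|flat k x| <= (k.+2)`!%:R * `|x| ^+ 2.
Proof.
rewrite /flat; case: ifPn => [x0|_]; last by rewrite normr0 mulr_ge0// exprn_ge0.
have y0 : 0 < x^-1 by rewrite invr_gt0.
rewrite !ger0_norm ?(ltW x0)//; last by rewrite mulr_ge0 ?expR_ge0 ?exprn_ge0// ltW.
rewrite expRN ler_pdivrMr ?expR_gt0//.
have := expR_ge1Dxn k.+1 (ltW y0) => h.
have {h} : x^-1 ^+ k.+2 / (k.+2)`!%:R <= expR x^-1 by rewrite (le_trans _ h)// lerDr.
rewrite ler_pdivrMr ?ltr0n ?fact_gt0// => h.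
rewrite -mulrA [x ^+ 2 * _]mulrC mulrA -ler_pdivrMr ?exprn_gt0//.
by rewrite -exprVn -exprD addn2 [leRHS]mulrC.
Qed.

Lemma is_derive_flat k x : is_derive x 1 (flat k) (flat k.+2 x - k%:R * flat k.+1 x).
Proof.
have [x0|x0|->] := ltgtP x 0.
- rewrite /flat ltNge (ltW x0)/= mulr0 subr0.
  apply: (@near_eq_is_derive _ _ _ (cst 0)).
  near=> y; rewrite ifF//; apply/negbTE; rewrite -leNgt.
  by apply: ltW; near: y; exact: lt_nbhsl.
- rewrite /flat x0.
  apply: (@near_eq_is_derive _ _ _ (fun x : R => x^-1 ^+ k * expR (- x^-1))).
    by near=> y; rewrite ifT//; near: y; exact: lt_nbhsr.
  have xn0 : x != 0 by rewrite gt_eqF.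
  have d1 : is_derive x (1:R) (fun x : R => x^-1) (- x ^- 2).
    have := @is_deriveV R id x 1 1 xn0 (is_derive_id x (1:R)).
    by rewrite /GRing.scale/= mulr1.
  have d2 : is_derive x (1:R) (fun x : R => x^-1 ^+ k) (k%:R * x^-1 ^+ k.-1 * - x ^- 2).
    apply: (@is_derive1_comp R (fun y : R => y ^+ k) (fun x => x^-1) x).
    have := @is_deriveX _ _ id k x^-1 1 1 (is_derive_id _ _).
    by rewrite exprfctE /GRing.scale/= mulr1.
  have d3 : is_derive x (1:R) (fun x : R => expR (- x^-1)) (expR (- x^-1) * x ^- 2).
    apply: (@is_derive1_comp R expR (fun x => - x^-1) x).
    by rewrite -[X in is_derive _ _ _ X]opprK; exact: is_deriveN.
  have [h1 h2] := @is_deriveM _ _ (fun x : R => x^-1 ^+ k)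
    (fun x : R => expR (- x^-1)) x 1 _ _ d2 d3.
  split; first exact: h1.
  rewrite [LHS]h2 /GRing.scale/=; move: d2 h2 h1 => _ _ _.
  case: k => [|k]; first by rewrite !mul0r mulr0 subr0 addr0 expr0 mul1r mulrC exprVn.
  by rewrite /= -!exprVn !exprS; ring.
- rewrite /flat ltxx mulr0 subr0.
  have h : h^-1 *: ((flat k \o shift 0) (h *: (1:R)) - flat k 0) @[h --> (0:R)^'] --> (0 : R).
    have C0 : 0 < (k.+2)`!%:R :> R by rewrite ltr0n fact_gt0.
    apply/cvgrPdist_le => e e0; near=> h.
    have hn0 : h != 0 by near: h; exact: nbhs_dnbhs_neq.
    rewrite sub0r normrN /GRing.scale/= mulr1 addr0 {2}/flat ltxx subr0.
    rewrite normrM normfV ler_pdivrMl ?normr_gt0//.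
    rewrite (le_trans (flat_bound k h))// expr2 mulrA mulrC ler_wpM2l//.
    by rewrite mulrC -ler_pdivlMr//; near: h; apply: dnbhs0_le; rewrite divr_gt0.
  by split; [apply/cvg_ex; exists 0|apply/cvg_lim].
Unshelve. all: by end_near. Qed.

Lemma n_derivable_flat n k : n_derivable n (flat k).
Proof.
elim: n k => // n IH k; split; first by move=> x; have [] := is_derive_flat k x.
rewrite (_ : derive1 (flat k) = fun x => flat k.+2 x + cst (- k%:R) x * flat k.+1 x).
  by apply: n_derivableD => //; apply: n_derivableM => //; exact: n_derivable_cst.
by apply/funext => x; rewrite derive1E; have [_ ->] := is_derive_flat k x; rewrite mulNr.
Qed.

(** The factor [n.+1] steepens both flanks: the bumps are bounded by 1, vanish outside []a, b[] and
    tend to its indicator, ready for dominated convergence. *)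
Definition bump (a b : R) n x : R :=
  flat 0 (n.+1%:R * (x - a)) * flat 0 (n.+1%:R * (b - x)).

Lemma bump_derivable a b n i x : derivable (derive1n i (bump a b n)) x 1.
Proof.
apply: n_derivable_derive => j.
rewrite (_ : bump a b n = fun x => flat 0 (n.+1%:R * x + - (n.+1%:R * a)) *
  flat 0 (- n.+1%:R * x + n.+1%:R * b)).
  by apply: n_derivableM; apply: n_derivable_affine; exact: n_derivable_flat.
by apply/funext => y; congr (flat 0 _ * flat 0 _); ring.
Qed.

Lemma flat0_ge0 x : 0 <= flat 0 x <= 1.
Proof.
rewrite /flat; case: ifPn => [x0|_]; last by rewrite lexx ler01.
by rewrite expr0 mul1r expR_ge0 -expR0 ler_expR oppr_le0 invr_ge0 ltW.
Qed.

Lemma bump_ge0 a b n x : 0 <= bump a b n x <= 1.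
Proof.
have /andP[h1 h2] := flat0_ge0 (n.+1%:R * (x - a)).
have /andP[h3 h4] := flat0_ge0 (n.+1%:R * (b - x)).
by rewrite mulr_ge0//= mulr_ile1.
Qed.

Lemma bump_out a b n x : ~~ (a < x < b) -> bump a b n x = 0.
Proof.
rewrite negb_and -!leNgt => /orP[h|h]; rewrite /bump {1 2}/flat.
  by rewrite ltNge pmulr_rle0// subr_le0 h/= mul0r.
by rewrite [in X in _ * X]ltNge pmulr_rle0// subr_le0 h/= mulr0.
Qed.

Lemma bump_cvg a b x : a < x < b -> bump a b n x @[n --> \oo] --> (1 : R).
Proof.
move=> /andP[ax xb].
have h (c : R) : 0 < c -> flat 0 (n.+1%:R * c) @[n --> \oo] --> (1 : R).
  move=> c0; rewrite (_ : (fun n => _) = (fun n => expR (- (n.+1%:R^-1 * c^-1)))); last first.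
    by apply/funext => n; rewrite /flat pmulr_rgt0// c0 expr0 mul1r invfM.
  rewrite -[X in _ --> X](@expR0 R); apply: continuous_cvg; first exact: continuous_expR.
  rewrite -oppr0; apply: cvgN; rewrite -(mul0r c^-1); apply: cvgM; last exact: cvg_cst.
  exact: cvg_harmonic.
by rewrite -[X in _ --> X]mulr1; apply: cvgM; apply: h; rewrite subr_gt0.
Qed.

End smooth_bump.

(** * Test functions, the weak derivative of [J T 1 g], and the fundamental lemma *)

Section weak_derivatives.
Context {R : realType}.
Notation mu := (@lebesgue_measure R).
Notation "f =ae g" := (ae_eq mu [set: R] f g) (at level 70).
Implicit Types (T p a b : R) (u v g phi : R -> R).

Lemma test_function_out T phi x : test_function T phi -> ~~ (0 < x < T) -> phi x = 0.
Proof.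
move=> [_ [a [b [a0 bT out]]]] xT; apply: out; apply: contra xT.
by rewrite in_itv/= => /andP[ax xb]; rewrite (lt_le_trans a0 ax) (le_lt_trans xb bT).
Qed.

Lemma test_function_continuous T phi x : test_function T phi -> {for x, continuous phi}.
Proof.
by move=> [d _]; apply: differentiable_continuous; apply/derivable1_diffP; exact: (d 0%N).
Qed.

Lemma test_function_measurable T phi : test_function T phi ->
  measurable_fun [set: R] phi.
Proof.
by move=> tf; apply: continuous_measurable_fun => x; exact: test_function_continuous tf.
Qed.

Lemma test_function_bounded T phi : test_function T phi ->
  exists2 M, 0 <= M & forall x, `|phi x| <= M.
Proof.
move=> tf; have [_ [a [b [a0 bT out]]]] := tf.
have [ab|ba] := leP a b; last first.
  exists 0 => // x; rewrite out ?normr0// in_itv/= negb_and -!ltNge.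
  by have [//|ax] := ltP x a; rewrite (lt_le_trans ba).
have cn : {within `[a, b], continuous (fun x => `|phi x|)}.
  apply: continuous_subspaceT => x.
  by apply: cvg_norm; exact: test_function_continuous tf.
have [c cab hc] := EVT_max ab cn.
exists `|phi c| => // x; have [xab|xab] := boolP (x \in `[a, b]); first exact: hc.
by rewrite out// normr0.
Qed.

Lemma test_function_derive T phi : test_function T phi -> test_function T (derive1 phi).
Proof.
move=> [d [a [b [a0 bT out]]]]; split.
  by move=> n x; rewrite -derive1Sn; exact: d.
exists a, b; split => // x; rewrite in_itv/= negb_and -!ltNge => xab.
have nx : \near x, phi x = cst 0 x.
  case/orP: xab => h.
    near=> y; apply: out; rewrite in_itv/= negb_and -!ltNge.
    by apply/orP; left; near: y; exact: lt_nbhsl.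
  near=> y; apply: out; rewrite in_itv/= negb_and -!ltNge.
  by apply/orP; right; near: y; exact: lt_nbhsr.
by rewrite derive1E (near_eq_derive _ nx) derive_cst.
Unshelve. all: by end_near. Qed.

Lemma integral_test_function_derive T phi s : 0 < T -> test_function T phi -> 0 < s < T ->
  \int[mu]_(x in `[s, T]) (derive1 phi x) = - phi s.
Proof.
move=> T0 tf /andP[s0 sT]; have td := test_function_derive tf.
rewrite /Rintegral (@continuous_FTC2 _ (derive1 phi) phi)//.
- by rewrite (test_function_out tf (x := T)) ?ltxx ?andbF//= sub0r.
- by apply: continuous_subspaceT => x; exact: test_function_continuous td.
- split; first by move=> x _; case: tf => d _; exact: (d 0%N).
  + by apply: cvg_at_right_filter; exact: test_function_continuous tf.
  + by apply: cvg_at_left_filter; exact: test_function_continuous tf.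
Qed.

Lemma kern1 (x : R) : kern 1 x = (0 < x)%R%:R.
Proof. by rewrite /kern subrr powRr0; case: ifP. Qed.

Lemma RI1E T p v t : 0 < T -> 1 <= p -> Lz T p v ->
  RI 1 v t = \int[mu]_(s in `]-oo, t]) v s.
Proof.
move=> T0 p1 hv; have iv := Lz_integrable T0 p1 hv.
rewrite -Rintegral_itv_bndo_bndc; last exact: integrableS iv.
rewrite [RHS]Rintegral_mkcond; apply: eq_Rintegral => s _.
rewrite kern1 subr_gt0 patchE; case: ifPn.
  by rewrite inE/= in_itv/= => ->; rewrite mul1r.
by rewrite notin_setE/= in_itv/= => /negP/negbTE ->; rewrite mul0r.
Qed.

(** Lebesgue's differentiation theorem, once [RI 1 v] is recognised as a primitive of [v]. *)
Lemma derive_RI1 T p v : 0 < T -> 1 <= p -> Lz T p v ->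
  {ae mu, forall t, derivable (RI 1 v) t 1 /\ derive1 (RI 1 v) t = v t}.
Proof.
move=> T0 p1 hv; have iv := Lz_integrable T0 p1 hv.
have -> : RI 1 v = fun t => \int[mu]_(s in `]-oo, t]) v s.
  by apply/funext => t; exact: RI1E hv.
apply: FTC1Ny; first by move=> y; exact: integrableS iv.
have := integrable_locally measurableT iv.
by rewrite patch_setT.
Qed.

(** Fubini for phi'(x) 1_{s < x} g(s): integrating in [s] first gives the left-hand side;
    integrating in [x] first gives - g(s) phi(s), because phi vanishes at [T]. *)
Lemma weak_deriv_J1 T p g phi : 0 < T -> 1 <= p -> Lz T p g -> test_function T phi ->
  \int[mu]_(x in `]0, T[) (J T 1 g x * derive1 phi x) =
  - \int[mu]_(x in `]0, T[) (g x * phi x).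
Proof.
move=> T0 p1 hg tf; have td := test_function_derive tf.
have [mg sg _] := hg; have ig := Lz_integrable T0 p1 hg.
have md := test_function_measurable td; have mphi := test_function_measurable tf.
have [M M0 bM] := test_function_bounded td.
pose F (z : R * R) : \bar R := (derive1 phi z.1 * (kern 1 (z.1 - z.2) * g z.2))%:E.
have mF : measurable_fun [set: R * R] F.
  apply/measurable_EFinP; apply: measurable_funM; first exact: measurableT_comp.
  exact: measurable_convolution.
have iF : (mu \x mu)%E.-integrable [set: R * R] F.
  apply/integrable12ltyP => //.
  have [_ _ fg1] := Lz_Lpow1 T0 p1 hg.
  have fg1fin : Lpow 1 g \is a fin_num by rewrite ge0_fin_numE// Lpow_ge0.
  apply: (@le_lt_trans _ _ (\int[mu]_x ((cst (M * fine (Lpow 1 g)) \_ `]0, T[) x)%:E)%E); last first.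
    by rewrite integral_cst_restrict// ltry.
  apply: ge0_le_integral => //.
  - by move=> x _; exact: integral_ge0.
  - apply: (@measurable_fun_fubini_tonelli_F _ _ _ _ _ mu (abse \o F)) => //=.
    exact: measurableT_comp.
  - by apply/measurable_EFinP; exact: measurable_restrict_itv.
  - move=> x _; rewrite -/(cut _ _) cutE; case: ifPn => xT; last first.
      rewrite integral0_eq// => s _; rewrite /F/= (test_function_out td xT).
      by rewrite mul0r normr0.
    rewrite EFinM fineK// /Lpow -ge0_integral_EFinZl//; last exact: measurable_normr_powR.
    apply: ge0_le_integral => //.
    + by do 2 apply: measurableT_comp => //; apply: measurable_funM => //;
        exact: measurable_RI_integrand.
    + by apply/measurable_EFinP; apply: measurable_funM => //; exact: measurable_normr_powR.
    + move=> s _; rewrite /F/= lee_fin !normrM powRr1// ler_pM ?mulr_ge0//.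
      rewrite kern1 ger0_norm// -[leRHS]mul1r ler_wpM2r//.
      by case: (_ < _).
have h1 : (\int[mu]_x \int[mu]_s F (x, s) = \int[mu]_s \int[mu]_x F (x, s))%E.
  exact: (Fubini iF).
have h2 : (\int[mu]_x \int[mu]_s F (x, s) =
    \int[mu]_(x in `]0%R, T[) (J T 1 g x * derive1 phi x)%:E)%E.
  rewrite -integral_restrict_EFin// -/(cut T _); apply: eq_integral => x _.
  rewrite cutE; case: ifPn => xT; last first.
    rewrite integral0_eq// => s _; rewrite /F/= (test_function_out td xT).
    by rewrite mul0r.
  have i1 : mu.-integrable [set: R] (fun s => (kern 1 (x - s) * g s)%:E).
    apply: le_integrable ig => //.
      by apply/measurable_EFinP; exact: measurable_RI_integrand.
    move=> s _; rewrite /= lee_fin normrM kern1 ger0_norm// -[leRHS]mul1r ler_wpM2r//.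
    by case: (_ < _).
  rewrite /F/=; under eq_integral do rewrite EFinM.
  rewrite integralZl// muleC EFinM J_in//; congr (_ * _)%E.
  by rewrite /RI /Rintegral fineK//; exact: integrable_fin_num.
have h3 : (\int[mu]_s \int[mu]_x F (x, s) =
    \int[mu]_(s in `]0%R, T[) (- (g s * phi s))%:E)%E.
  rewrite -integral_restrict_EFin// -/(cut T _); apply: eq_integral => s _.
  rewrite cutE; case: ifPn => sT; last first.
    rewrite integral0_eq// => x _; rewrite /F/= sg//.
    by rewrite !mulr0.
  have id : mu.-integrable `[s, T] (EFin \o derive1 phi).
    apply: measurable_bounded_integrable => //.
    - by rewrite /= lebesgue_measure_itv/=; case: ifP; rewrite ?ltry// -EFinD ltry.
    - exact: measurable_funTS.
    - exists M; split; first exact: num_real.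
      by move=> y My x _; exact: le_trans (bM x) (ltW My).
  have i2 : (\int[mu]_x (derive1 phi x * kern 1 (x - s))%:E = (- phi s)%:E)%E.
    rewrite -(integral_test_function_derive T0 tf sT) /Rintegral fineK; last first.
      exact: integrable_fin_num.
    rewrite -integral_itv_obnd_cbnd; last first.
      by apply/measurable_EFinP; exact: measurable_funTS.
    rewrite -integral_restrict_EFin//; apply: eq_integral => x _.
    rewrite kern1 patchE subr_gt0; case: ifPn.
      by rewrite inE/= in_itv/= => /andP[-> _]; rewrite mulr1.
    rewrite notin_setE/= in_itv/= => /negP; rewrite negb_and -leNgt -ltNge => /orP[h|h].
      by rewrite ltNge h/= mulr0.
    by rewrite (test_function_out td) ?mul0r// [x < T]ltNge (ltW h) andbF.
  have mdk : measurable_fun [set: R] (fun x => derive1 phi x * kern 1 (x - s)).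
    by apply: measurable_funM => //; exact: measurable_subr.
  rewrite /F/=; under eq_integral do rewrite mulrA mulrC EFinM.
  rewrite integralZl ?i2//; last first.
    apply/integrableP; split; first exact/measurable_EFinP.
    apply: (@le_lt_trans _ _ (\int[mu]_x ((cst M \_ `]0, T[) x)%:E)%E); last first.
      by rewrite integral_cst_restrict// ltry.
    apply: ge0_le_integral => //.
    - by do 2 apply: measurableT_comp => //.
    - by apply/measurable_EFinP; exact: measurable_restrict_itv.
    - move=> x _; rewrite -/(cut _ _) cutE lee_fin; case: ifPn => xT; last first.
        by rewrite (test_function_out td xT) mul0r normr0.
      rewrite normrM -[leRHS]mulr1 ler_pM// kern1 ger0_norm//.
      by case: (_ < _).
  by rewrite -EFinM mulrN.
rewrite /Rintegral -h2 h1 h3.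
have igp : mu.-integrable `]0%R, T[ (fun x => (g x * phi x)%:E).
  have [N N0 bN] := test_function_bounded tf.
  apply: (@integrableS _ _ _ _ setT) => //.
  have := integrableZl measurableT N ig; apply: le_integrable => //.
    by apply/measurable_EFinP; exact: measurable_funM.
  move=> x _; rewrite /= lee_fin !normrM mulrC ler_wpM2r//.
  by rewrite (le_trans (bN x))// ler_norm.
rewrite -fineN; congr fine; rewrite -integralN; last exact: integrable_add_def.
by apply: eq_integral => s _; rewrite EFinN.
Qed.

Lemma RI1B T p u a b : 0 < T -> 1 <= p -> Lz T p u ->
  RI 1 u b - RI 1 u a = \int[mu]_s (u s * (kern 1 (b - s) - kern 1 (a - s))).
Proof.
move=> T0 p1 hu; have iu := Lz_integrable T0 p1 hu; have [mu_ _ _] := hu.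
have i1 t : mu.-integrable [set: R] (EFin \o (fun s => kern 1 (t - s) * u s)).
  apply: le_integrable iu => //.
    by apply/measurable_EFinP; exact: measurable_RI_integrand.
  move=> s _; rewrite /= lee_fin normrM kern1 ger0_norm// -[leRHS]mul1r ler_wpM2r//.
  by case: (_ < _).
by rewrite /RI -RintegralB//; apply: eq_Rintegral => s _; ring.
Qed.

(** Testing against bumps and passing to the limit shows that the primitive [RI 1 u] takes equal
    values at any two points of []0, T[]; by [derive_RI1] its derivative is [u] almost
    everywhere. *)
Lemma test_function_ae0 T p u : 0 < T -> 1 <= p -> Lz T p u ->
  (forall phi, test_function T phi -> \int[mu]_(x in `]0, T[) (u x * phi x) = 0) ->
  u =ae cst 0.
Proof.
move=> T0 p1 hu h; have iu := Lz_integrable T0 p1 hu; have [mu_ su _] := hu.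
have const a b : 0 < a -> a < b -> b < T -> RI 1 u b = RI 1 u a.
  move=> a0 ab bT; apply/eqP; rewrite -subr_eq0 (RI1B _ _ T0 p1 hu); apply/eqP.
  have tb n : test_function T (bump a b n).
    split; first by move=> i x; exact: bump_derivable.
    exists a, b; split => // x xab; apply: bump_out; apply: contra xab.
    by rewrite in_itv/= => /andP[ax xb]; rewrite !ltW.
  pose f_ n x : \bar R := (u x * bump a b n x)%:E.
  have fn0 n : (\int[mu]_x f_ n x = 0)%E.
    have := h _ (tb n); rewrite /Rintegral => h0.
    have -> : (\int[mu]_x f_ n x = \int[mu]_(x in `]0%R, T[) (u x * bump a b n x)%:E)%E.
      rewrite -[RHS]integral_restrict_EFin// -/(cut T _); apply: eq_integral => x _.
      by rewrite cutE; case: ifPn => // xT; rewrite /f_ su// mul0r.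
    rewrite -[LHS]fineK ?h0//; apply: integrable_fin_num => //.
    apply: (@integrableS _ _ _ _ setT) => //; apply: le_integrable iu => //.
      apply/measurable_EFinP; apply: measurable_funM => //.
      exact: test_function_measurable (tb n).
    move=> x _; rewrite /= lee_fin normrM ler_piMr//.
    by have /andP[b0 b1] := bump_ge0 a b n x; rewrite ger0_norm.
  pose f x : \bar R := (u x * (kern 1 (b - x) - kern 1 (a - x)))%:E.
  have mf : measurable_fun [set: R] f.
    apply/measurable_EFinP; apply: measurable_funM => //.
    by apply: measurable_funB; exact: measurable_subl.
  have mf_ n : measurable_fun [set: R] (f_ n).
    apply/measurable_EFinP; apply: measurable_funM => //.
    exact: test_function_measurable (tb n).
  have cf : {ae mu, forall x, [set: R] x -> f_ ^~ x @ \oo --> f x}.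
    (* The only exception is [x = a], where the bumps vanish while the difference of the two values
       of [kern 1] is 1. *)
    exists [set a]; split; [exact: measurable_set1|exact: lebesgue_measure_set1|].
    move=> x /=; apply: contra_notP => xa _; apply: cvg_EFin; first exact: nearW.
    apply: cvgM; first exact: cvg_cst.
    rewrite !kern1 !subr_gt0.
    have [xb|bx] := ltP x b; last first.
      rewrite [x < a]ltNge (le_trans (ltW ab) bx) subrr.
      rewrite (_ : (fun n => _) = cst 0); first exact: cvg_cst.
      by apply/funext => n; rewrite bump_out// [x < b]ltNge bx andbF.
    have [ax|xa'|xa'] := ltgtP x a; last by rewrite xa' in xa.
      rewrite subrr (_ : (fun n => _) = cst 0); first exact: cvg_cst.
      by apply/funext => n; rewrite bump_out// [a < x]ltNge (ltW ax).
    by rewrite subr0; apply: bump_cvg; rewrite xa' xb.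
  have fg : {ae mu, forall x n, [set: R] x -> (`|f_ n x| <= `|(u x)%:E|)%E}.
    apply: aeW => x n _; rewrite /= lee_fin normrM ler_piMr//.
    by have /andP[b0 b1] := bump_ge0 a b n x; rewrite ger0_norm.
  have ig := integrable_abse iu.
  have [_ _ hc] := @dominated_convergence _ (measurableTypeR R) R mu setT measurableT
    f_ f (fun x => `|(u x)%:E|%E) mf_ mf cf ig fg.
  rewrite /Rintegral; suff -> : (\int[mu]_x f x = 0)%E by [].
  have hc0 : (fun n => \int[mu]_x f_ n x)%E @ \oo --> (0%E : \bar R).
    rewrite (_ : (fun n => _) = cst 0%E); first exact: cvg_cst.
    by apply/funext => n; exact: fn0.
  exact: (cvg_unique _ hc hc0).
have := derive_RI1 T0 p1 hu; apply: aeS => t [dt ut] _ /=.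
have [tT|] := boolP (0 < t < T); last by move/su.
have /andP[t0 tT'] := tT.
rewrite -ut derive1E.
pose c := RI 1 u t.
have nt : \forall y \near t, RI 1 u y = cst c y.
  near=> y; rewrite /cst /c.
  have y0 : 0 < y by near: y; exact: lt_nbhsr.
  have yT : y < T by near: y; exact: lt_nbhsl.
  have [yt|yt|->//] := ltgtP y t; last by rewrite (const t y).
  by rewrite (const y t).
rewrite (near_eq_derive _ nt); exact: derive_cst.
Unshelve. all: by end_near. Qed.

End weak_derivatives.

(** * Injectivity of fractional integration *)

Section injectivity.
Context {R : realType}.
Notation mu := (@lebesgue_measure R).
Notation "f =ae g" := (ae_eq mu [set: R] f g) (at level 70).
Implicit Types (T p a b : R) (u v g phi : R -> R).

(** By [weak_deriv_J1], testing [v] against phi amounts to testing [J T 1 v] against - phi'. *)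
Lemma J_T1_injective T p v : 0 < T -> 1 <= p -> Lz T p v ->
  J T 1 v =ae cst 0 -> v =ae cst 0.
Proof.
move=> T0 p1 hv hJ; apply: (test_function_ae0 T0 p1 hv) => phi tf.
have := weak_deriv_J1 T0 p1 hv tf.
have -> : \int[mu]_(x in `]0, T[) (J T 1 v x * derive1 phi x) = 0.
  have [mv _ _] := hv; have md := test_function_measurable (test_function_derive tf).
  rewrite /Rintegral (_ : (\int[mu]_(x in _) _)%E = \int[mu]_(x in `]0%R, T[) (cst 0%E x))%E.
    by rewrite integral0.
  apply: ae_eq_integral => //.
    apply: measurable_funTS; apply/measurable_EFinP; apply: measurable_funM => //.
    by apply: measurable_cut; exact: measurable_RI.
  by apply: aeS hJ => x /= /(_ I) ->; rewrite mul0r.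
by move/eqP; rewrite eq_sym oppr_eq0 => /eqP.
Qed.

(** Composition with J^(n+1-a) raises the order to the integer n + 1 > a; the factors J^1 are then
    removed one at a time by [J_T1_injective]. *)
Lemma J_injective T a p v : 0 < T -> 0 < a -> 1 <= p -> Lz T p v ->
  J T a v =ae cst 0 -> v =ae cst 0.
Proof.
move=> T0 a0 p1 hv hJ; have [mv _ _] := hv.
have J0 b : J T b (cst 0) = cst 0.
  apply/funext => x; rewrite /J cutE; case: ifP => // _.
  by rewrite /RI /Rintegral integral0_eq// => s _; rewrite mulr0.
have mJ b w : measurable_fun [set: R] w -> measurable_fun [set: R] (J T b w).
  by move=> mw; apply: measurable_cut; exact: measurable_RI.
have scale (c : R) (f : R -> R) : c != 0 -> (fun t => c * f t) =ae cst 0 -> f =ae cst 0.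
  move=> c0; apply: aeS => t /(_ I) h _.
  have /eqP : c * f t = 0 by exact: h.
  by rewrite mulf_eq0 (negbTE c0)/= => /eqP.
pose n := Num.truncn a.
have /andP[na an] : n%:R <= a < n.+1%:R := truncn_itv (ltW a0).
have hn : J T n.+1%:R v =ae cst 0.
  have b0 : 0 < n.+1%:R - a by rewrite subr_gt0.
  have := J_semigroup T0 a0 b0 p1 hv.
  have -> : a + (n.+1%:R - a) = n.+1%:R by rewrite addrC subrK.
  have m0 : measurable_fun [set: R] (cst (0 : R)) by [].
  have e := @ae_eq_J R T (n.+1%:R - a) (J T a v) (cst 0) (mJ _ _ mv) m0 hJ.
  rewrite e J0 => /ae_eq_sym; apply: scale.
  by rewrite gt_eqF// beta_kern_gt0.
elim: n {na an} hn => [|n IH]; first by move=> hn; exact: (J_T1_injective T0 p1 hv hn).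
move=> hn; apply: IH; have := J_semigroup T0 (ltr0Sn R n) ltr01 p1 hv.
rewrite natr1.
have hL := J_Lz T0 (ltr0Sn R n) p1 hv.
move=> h; apply: (J_T1_injective T0 p1 hL).
apply: (ae_eq_trans h).
by apply: aeS hn => t /= /(_ I) ->; rewrite mulr0.
Qed.

End injectivity.

(** * Translation estimates and the Slobodecki seminorm of [J T b v] *)

Section slobodecki_estimate.
Context {R : realType}.
Notation mu := (@lebesgue_measure R).
Implicit Types (T p a b theta : R) (u v g w : R -> R).

Lemma ae_shift (h : R) (P : R -> Prop) :
  {ae mu, forall x, P x} -> {ae mu, forall x, P (x + h)}.
Proof.
move=> [N [mN N0 sN]].
pose phi (x : measurableTypeR R) : measurableTypeR R := x + h.
have mphi : measurable_fun [set: R] phi by exact: measurable_funD.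
have mN' : measurable (phi @^-1` N) by rewrite -[X in measurable X]setTI; exact: mphi.
exists (phi @^-1` N); split => //; last by move=> x /= Px; apply: sN.
have mi : measurable_fun [set: R] (fun x => (\1_N x)%:E : \bar R).
  by apply/measurable_EFinP; exact: measurable_indic.
have i0 (x : R) : (0 <= (\1_N x : R)%:E)%E by rewrite lee_fin.
have e1 : (\int[mu]_x (\1_N x)%:E = 0)%E.
  by rewrite integral_indic// setIT; exact: N0.
have e2 : (\int[mu]_x (\1_(phi @^-1` N) x)%:E = mu (phi @^-1` N))%E.
  by rewrite integral_indic// setIT.
rewrite -e2 -e1 -(ge0_integral_shift h mi i0).
by apply: eq_integral => x _; rewrite !indicE.
Qed.

Lemma measurable_kern_diff b (h : R) :
  measurable_fun [set: R] (fun x => `|kern b (x + h) - kern b x|).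
Proof.
have m1 : measurable_fun [set: R] (fun x => kern b (x + h)).
  rewrite (_ : (fun x => _) = (fun x => kern b (x - - h))); last first.
    by apply/funext => x; rewrite opprK.
  exact: (measurable_subr (- h) (measurable_kern b)).
have m2 : measurable_fun [set: R] (fun x => kern b (x + h) - kern b x).
  exact: (measurable_funB m1 (measurable_kern b)).
exact: measurableT_comp.
Qed.

(** For negative [h] a translation turns the increment into the one for |h|, at the price of
    enlarging the window from [T] to [2 * T]; the bound of [kern_shift_bound] does not depend on the
    window. *)
Lemma kern_shift_bound_sym T b (h : R) : 0 < T -> 0 < b < 1 -> h != 0 -> `|h| < T ->
  (\int[mu]_(x in `](- T)%R, T[) (`|kern b (x + h) - kern b x|)%:E
    <= (2 * `|h| `^ b / b)%:E)%E.
Proof.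
move=> T0 b01 h0 hT; have [hp|hn|/eqP] := ltgtP h 0; last by rewrite (negbTE h0).
  have h0' : 0 < `|h| by rewrite normr_gt0.
  have T2 : 0 < 2 * T by rewrite mulr_gt0.
  apply: le_trans (kern_shift_bound T2 b01 h0').
  have E (U l : R) := @integral_restrict_EFin R `](- U)%R, U[%classic
    (fun x => `|kern b (x + l) - kern b x|) (measurable_itv _).
  rewrite -(E T h) -(E (2 * T) `|h|).
  pose F x := ((fun x => `|kern b (x + `|h|) - kern b x|) \_ `](- (2 * T))%R, (2 * T)[) x.
  have mF : measurable_fun [set: R] F.
    by apply: measurable_restrict_itv => //; exact: measurable_kern_diff.
  have F0 x : 0 <= F x by exact: restrict_ge0.
  rewrite -[leRHS](@ge0_integral_shift _ h (EFin \o F)); last 2 first.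
  - exact/measurable_EFinP.
  - by move=> x; rewrite lee_fin.
  apply: ge0_le_integral_EFin.
  - by apply: measurable_restrict_itv => //; exact: measurable_kern_diff.
  - by move=> x; apply: restrict_ge0.
  - by apply: measurableT_comp => //; exact: measurable_funD.
  - move=> x; rewrite patchE; case: ifPn => [|_]; last exact: F0.
    rewrite inE/= in_itv/= => /andP[Tx xT].
    rewrite ltr0_norm// in hT *.
    rewrite /F patchE mem_set/=; last by rewrite in_itv/=; lra.
    by rewrite (ltr0_norm hp) addrK distrC.
rewrite ger0_norm ?(ltW hn)//; exact: kern_shift_bound.
Qed.

(** The integrand of [Slobodecki] extended by zero to the plane, so that Tonelli applies without
    tracking domains; the quotient has become a negative power. *)
Definition slob_fun T p theta w (z : R * R) : R :=
  cut T (cst 1) z.1 * cut T (cst 1) z.2 *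
  (`|w z.2 - w z.1| `^ p * `|z.2 - z.1| `^ (- (1 + theta * p))).

Lemma cut1_ge0 T x : 0 <= cut T (cst (1 : R)) x.
Proof. by rewrite cutE; case: ifP. Qed.

Lemma measurable_cut1 T : measurable_fun [set: R] (cut T (cst (1 : R))).
Proof. exact: measurable_cut. Qed.

Lemma slob_fun_ge0 T p theta w z : 0 <= slob_fun T p theta w z.
Proof. by rewrite !mulr_ge0 ?powR_ge0 ?cut1_ge0. Qed.

Lemma measurable_slob_fun T p theta w : measurable_fun [set: R] w ->
  measurable_fun [set: R * R] (slob_fun T p theta w).
Proof.
move=> mw; have mind := measurable_cut1 T.
apply: measurable_funM.
  by apply: measurable_funM; apply: measurableT_comp.
apply: measurable_funM.
  apply: (measurableT_comp (measurable_powR _)); apply: measurableT_comp => //.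
  by apply: measurable_funB; apply: measurableT_comp.
apply: (measurableT_comp (measurable_powR _)); apply: measurableT_comp => //.
exact: measurable_funB.
Qed.

Lemma SlobodeckiE T p theta w : 0 < T -> measurable_fun [set: R] w ->
  (Slobodecki T p theta w = \int[mu]_x \int[mu]_t (slob_fun T p theta w (x, t))%:E)%E.
Proof.
move=> T0 mw; rewrite /Slobodecki [LHS]integral_mkcond; apply: eq_integral => x _.
rewrite patchE; case: ifPn => xT; last first.
  rewrite integral0_eq// => t _; rewrite /slob_fun/= cut_out ?mul0r//.
  by move: xT; rewrite notin_setE/= in_itv/= => /negP.
rewrite inE/= in_itv/= in xT.
rewrite -[LHS]integral_restrict_EFin// -/(cut T _); apply: eq_integral => t _.
rewrite /slob_fun/= !cutE xT /cst mul1r; case: ifPn => tT; last by rewrite mul0r.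
by rewrite mul1r -powRN.
Qed.

(** With h = t - x and the order of integration exchanged, the inner integral is the p-th power of
    an L^p modulus of continuity, weighted by |h|^(-(1 + theta p)). *)
Lemma Slobodecki_shift T p theta w : 0 < T -> measurable_fun [set: R] w ->
  (Slobodecki T p theta w = \int[mu]_h \int[mu]_x (cut T (cst 1) x * cut T (cst 1) (x + h) *
    (`|w (x + h) - w x| `^ p * `|h| `^ (- (1 + theta * p))))%:E)%E.
Proof.
move=> T0 mw; rewrite (SlobodeckiE _ _ T0 mw).
have mG := measurable_slob_fun T p theta mw.
pose G := slob_fun T p theta w.
have e2 : (\int[mu]_x \int[mu]_t (G (x, t))%:E =
    \int[mu]_x \int[mu]_h (G (x, x + h))%:E)%E.
  apply: eq_integral => x _.
  rewrite -(@ge0_integral_shift _ x (fun t => (G (x, t))%:E)); last 2 first.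
  - by apply/measurable_EFinP; exact: (measurable_fun_pair2 x mG).
  - by move=> t; rewrite lee_fin slob_fun_ge0.
  by apply: eq_integral => h _; rewrite addrC.
rewrite [LHS]e2 {e2}.
pose H (z : R * R) : \bar R := (G (z.1, z.1 + z.2))%:E.
have mH : measurable_fun [set: R * R] H.
  have m2 : measurable_fun [set: R * R] (fun z : R * R => z.1 + z.2).
    by apply: measurable_funD.
  have m12 := measurable_fun_pair measurable_fst m2.
  by apply/measurable_EFinP; exact: (measurableT_comp mG m12).
have H0 z : (0 <= H z)%E by rewrite lee_fin slob_fun_ge0.
rewrite (tonelli mH H0) {H0}; apply: eq_integral => h _; apply: eq_integral => x _.
by rewrite /H /G /slob_fun/= [x + h - x]addrAC subrr add0r.
Qed.

(** The increment is the convolution of [v] with the increment of [kern b]. Between points of []0,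
    T[] only the window []- T, T[] is seen, where [kern_shift_bound_sym] bounds the L^1 norm;
    Young's inequality concludes. *)
Lemma Lpow_J_shift T p b v (h : R) : 0 < T -> 1 <= p -> 0 < b < 1 -> Lz T p v ->
  h != 0 -> `|h| < T ->
  (\int[mu]_x (cut T (cst 1) x * cut T (cst 1) (x + h) *
      `|J T b v (x + h) - J T b v x| `^ p)%:E <=
    ((2 * `|h| `^ b / b) `^ p)%:E * Lpow p v)%E.
Proof.
move=> T0 p1 b01 hv h0 hT; have [mv sv fv] := hv.
have p0 : 0 < p by exact: lt_le_trans p1.
have b0 : 0 < b by case/andP: b01.
set w := J T b v; have mw : measurable_fun [set: R] w.
  by apply: measurable_cut; exact: measurable_RI.
have mind : measurable_fun [set: R] (cut T (cst (1 : R))) by exact: measurable_cut.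
have hn0 : 0 < `|h| by rewrite normr_gt0.
pose k : R -> R := (fun x => `|kern b (x + h) - kern b x|) \_ `](- T)%R, T[.
have mk : measurable_fun [set: R] k.
  by apply: measurable_restrict_itv => //; exact: measurable_kern_diff.
have kA : (\int[mu]_x (k x)%:E <= (2 * `|h| `^ b / b)%:E)%E.
  by rewrite integral_restrict_EFin//; exact: kern_shift_bound_sym.
have A0 : 0 < 2 * `|h| `^ b / b by rewrite divr_gt0 ?mulr_gt0 ?powR_gt0.
have k0 x : 0 <= k x by exact: restrict_ge0.
have Y := young_convolution p1 A0 mk mv k0 kA.
apply: le_trans Y.
have mnv : measurable_fun [set: R] (fun x => `|v x|) by exact: measurableT_comp.
pose K t := (\int[mu]_s (k (t - s) * `|v s|)%:E)%E.
have mK : measurable_fun [set: R] K.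
  pose F (z : R * R) : \bar R := (k (z.1 - z.2) * `|v z.2|)%:E.
  have mF : measurable_fun [set: R * R] F.
    by apply/measurable_EFinP; exact: (measurable_convolution mk mnv).
  have F0 z : (0 <= F z)%E by rewrite lee_fin mulr_ge0.
  exact: (@measurable_fun_fubini_tonelli_F _ _ _ _ _ mu F mF F0).
clear k0.
have mshift (f : R -> R) : measurable_fun [set: R] f -> measurable_fun [set: R] (fun x => f (x + h)).
  by move=> mf; apply: measurableT_comp => //; exact: measurable_funD.
apply: ae_ge0_le_integral => //.
- by move=> x _; rewrite lee_fin !mulr_ge0 ?powR_ge0// cutE; case: ifP.
- apply/measurable_EFinP; apply: measurable_funM.
    exact: (measurable_funM mind (mshift _ mind)).
  exact: (measurable_normr_powR p (measurable_funB (mshift _ mw) mw)).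
- by move=> x _; rewrite poweR_ge0.
- exact: (measurableT_comp (measurable_poweR _) mK).
(* The integrals at [x] and at [x + h] must both converge absolutely to be subtracted; [ae_shift]
   transports the exceptional null set. *)
have f1 := EI_fin_ae T0 b0 p1 hv; have f2 := ae_shift h f1.
move: f1 f2; apply: aeS2 => x f1 f2 _; rewrite [cut T (cst 1) x]cutE cutE /cst -/(K x).
have K0 t : (0 <= K t)%E.
  by rewrite /K; apply: integral_ge0 => s _; rewrite lee_fin mulr_ge0// restrict_ge0.
case: ifPn => xT; last by rewrite !mul0r poweR_ge0.
case: ifPn => xhT; last by rewrite mulr0 mul0r poweR_ge0.
rewrite !mul1r -poweR_EFin.
apply: gt0_ler_poweR; rewrite ?(ltW p0) ?in_itv/= ?leey ?andbT ?K0//.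
rewrite /w !J_in//.
have i1 := integrable_RI mv (f2 xhT); have i2 := integrable_RI mv (f1 xT).
rewrite /RI -RintegralB//.
apply: (le_trans (normr_fine_le (\int[mu]_s (kern b (x + h - s) * v s - kern b (x - s) * v s)%:E)%E)).
have md : measurable_fun [set: R] (fun s => kern b (x + h - s) * v s - kern b (x - s) * v s).
  by apply: measurable_funB; exact: measurable_RI_integrand.
apply: (le_trans (le_abse_integral mu _ _)) => //; first exact/measurable_EFinP.
apply: ge0_le_integral_EFin.
- exact: (measurableT_comp _ md).
- by [].
- by apply: measurable_funM => //; exact: measurable_subl.
- move=> s; rewrite -mulrBl normrM.
  have [sT|sT] := boolP (0 < s < T); last by rewrite sv// normr0 !mulr0.
  rewrite ler_wpM2r// /k patchE mem_set/=; last by rewrite in_itv/=; lra.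
  by rewrite addrAC.
Qed.

(** The modulus of continuity contributes |h|^(bp), so |h|^((b - theta) p - 1) remains, integrable
    on []- T, T[] because [theta < b]. The factor 2 before T^((b - theta) p) counts the two signs of
    [h]. *)
Lemma Slobodecki_J T p theta b v : 0 < T -> 1 <= p -> 0 < theta < b -> b < 1 ->
  Lz T p v ->
  (Slobodecki T p theta (J T b v) <=
    ((2 / b) `^ p * (2 * (T `^ ((b - theta) * p) / ((b - theta) * p))))%:E * Lpow p v)%E.
Proof.
move=> T0 p1 /andP[th0 thb] b1 hv.
have p0 : 0 < p by exact: lt_le_trans p1.
have b0 : 0 < b by exact: lt_trans thb.
have [mv sv fv] := hv.
have Lfin : Lpow p v \is a fin_num by rewrite ge0_fin_numE// Lpow_ge0.
pose L := fine (Lpow p v); have L0 : 0 <= L by rewrite fine_ge0// Lpow_ge0.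
have LE : Lpow p v = L%:E by rewrite fineK.
set c := (b - theta) * p; have c0 : 0 < c by rewrite mulr_gt0// subr_gt0.
have mw : measurable_fun [set: R] (J T b v).
  by apply: measurable_cut; exact: measurable_RI.
rewrite (Slobodecki_shift _ _ T0 mw).
pose kc : R -> R := cut T (kern c).
have mkc : measurable_fun [set: R] kc by exact: measurable_cut.
have ikc : (\int[mu]_x (kc x)%:E = (T `^ c / c)%:E)%E.
  rewrite /kc /cut integral_restrict_EFin// integral_kern ?(ltW T0)//.
  by rewrite powR0 ?gt_eqF// subr0.
have kc0 x : 0 <= kc x by rewrite /kc cutE; case: ifP.
have mkcN : measurable_fun [set: R] (fun h => kc (- h)).
  by apply: measurableT_comp => //; exact: oppr_measurable.
have C0 : 0 <= (2 / b) `^ p * L by rewrite mulr_ge0 ?powR_ge0.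
have mind : measurable_fun [set: R] (cut T (cst (1 : R))) by exact: measurable_cut.
have mshift (h : R) (f : R -> R) : measurable_fun [set: R] f -> measurable_fun [set: R] (fun x => f (x + h)).
  by move=> mf; apply: measurableT_comp => //; exact: measurable_funD.
apply: (@le_trans _ _ (\int[mu]_h ((2 / b) `^ p * L * (kc h + kc (- h)))%:E)%E); last first.
  rewrite ge0_integral_EFinZl//; last 2 first.
  - exact: measurable_funD.
  - by move=> x; rewrite addr_ge0.
  rewrite ge0_integral_EFinD// ikc.
  have -> : (\int[mu]_x (kc (- x))%:E = (T `^ c / c)%:E)%E.
    rewrite -ikc -(@ge0_integral_subr _ 0 (fun x => (kc x)%:E)); last 2 first.
    - exact/measurable_EFinP.
    - by move=> t; rewrite lee_fin.
    by apply: eq_integral => x _; rewrite sub0r.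
  by rewrite LE -EFinD -!EFinM lee_fin le_eqVlt; apply/orP; left; apply/eqP; ring.
have ptw (h : R) : (\int[mu]_x (cut T (cst 1) x * cut T (cst 1) (x + h) *
    (`|J T b v (x + h) - J T b v x| `^ p * `|h| `^ (- (1 + theta * p))))%:E <=
    ((2 / b) `^ p * L * (kc h + kc (- h)))%:E)%E.
  have rhs0 : 0 <= (2 / b) `^ p * L * (kc h + kc (- h)).
    by rewrite mulr_ge0 ?addr_ge0.
  have [->|h0] := eqVneq h 0.
    rewrite integral0_eq; first by rewrite lee_fin mulr_ge0 ?addr_ge0.
    by move=> x _; rewrite addr0 subrr normr0 powR0 ?gt_eqF// mul0r mulr0.
  have [Th|hT] := leP T `|h|.
    rewrite integral0_eq ?lee_fin// => x _; rewrite [cut T (cst 1) x]cutE cutE.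
    case: ifPn => xT; last by rewrite !mul0r.
    case: ifPn => xhT; last by rewrite mulr0 mul0r.
    by exfalso; move: Th; apply/negP; rewrite -ltNge ltr_norml; lra.
  have hn0 : 0 < `|h| by rewrite normr_gt0.
  have b01 : 0 < b < 1 by rewrite b0.
  have := Lpow_J_shift T0 p1 b01 hv h0 hT.
  under [X in _ -> (X <= _)%E]eq_integral do rewrite mulrA mulrC.
  rewrite ge0_integral_EFinZl ?powR_ge0//; last 2 first.
  - apply: measurable_funM.
      exact: (measurable_funM mind (mshift h _ mind)).
    exact: (measurable_normr_powR p (measurable_funB (mshift h _ mw) mw)).
  - by move=> x; rewrite !mulr_ge0 ?powR_ge0// cutE; case: ifP.
  move=> hh; have le0 : (0 <= (`|h| `^ (- (1 + theta * p)))%:E)%E by rewrite lee_fin powR_ge0.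
  apply: (le_trans (lee_wpmul2l le0 hh)).
  rewrite LE -!EFinM lee_fin.
  have -> : (2 * `|h| `^ b / b) `^ p = (2 / b) `^ p * `|h| `^ (b * p).
    rewrite powRrM -powRM ?powR_ge0//; last by rewrite divr_ge0// ltW.
    by congr (_ `^ p); ring.
  have -> : `|h| `^ (- (1 + theta * p)) * ((2 / b) `^ p * `|h| `^ (b * p) * L) =
      (2 / b) `^ p * L * (`|h| `^ (- (1 + theta * p)) * `|h| `^ (b * p)) by ring.
  rewrite ler_wpM2l// -gt0_powRD//.
  have -> : - (1 + theta * p) + b * p = c - 1 by rewrite /c; ring.
  rewrite /kc !cutE /kern.
  have [hp|hn|/eqP] := ltgtP h 0; last by rewrite (negbTE h0).
    by rewrite ltr0_norm// in hT *; rewrite hT oppr_gt0 hp/= add0r.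
  by rewrite gtr0_norm// in hT *; rewrite hT/= oppr_gt0 [h < 0]ltNge (ltW hn)/= addr0.
apply: ge0_le_integral => //.
- move=> h _; apply: integral_ge0 => x _.
  by rewrite lee_fin !mulr_ge0 ?powR_ge0// cutE; case: ifP.
- pose F (z : R * R) : \bar R := (cut T (cst 1) z.2 * cut T (cst 1) (z.2 + z.1) *
    (`|J T b v (z.2 + z.1) - J T b v z.2| `^ p * `|z.1| `^ (- (1 + theta * p))))%:E.
  have m21 : measurable_fun [set: R * R] (fun z : R * R => z.2 + z.1).
    by apply: measurable_funD.
  have mF : measurable_fun [set: R * R] F.
    apply/measurable_EFinP; apply: measurable_funM.
      exact: (measurable_funM (measurableT_comp mind measurable_snd) (measurableT_comp mind m21)).
    apply: measurable_funM.
      apply: (measurableT_comp (measurable_powR _)); apply: measurableT_comp => //.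
      exact: (measurable_funB (measurableT_comp mw m21) (measurableT_comp mw measurable_snd)).
    by apply: (measurableT_comp (measurable_powR _)); apply: measurableT_comp.
  have F0 z : (0 <= F z)%E.
    by rewrite lee_fin !mulr_ge0 ?powR_ge0// cutE; case: ifP.
  exact: (@measurable_fun_fubini_tonelli_F _ _ _ _ _ mu F mF F0).
- by apply/measurable_EFinP; apply: measurable_funM => //; exact: measurable_funD.
Qed.

End slobodecki_estimate.

(** * Density of the range of [J T 1] *)

Section density.
Context {R : realType}.
Notation mu := (@lebesgue_measure R).
Notation "f =ae g" := (ae_eq mu [set: R] f g) (at level 70).
Implicit Types (T p a b : R) (u v g w : R -> R).

Lemma Rintegral_shift (h : R) (f : R -> R) : measurable_fun [set: R] f ->
  \int[mu]_x f (x + h) = \int[mu]_x f x.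
Proof.
move=> mf; rewrite /Rintegral; congr fine.
have mF : measurable_fun [set: R] (EFin \o f) by exact/measurable_EFinP.
rewrite integralE [RHS]integralE.
rewrite -[X in _ = (X - _)%E](@ge0_integral_shift _ h); last 2 first.
- exact: measurable_funepos.
- by [].
rewrite -[X in _ = (_ - X)%E](@ge0_integral_shift _ h); last 2 first.
- exact: measurable_funeneg.
- by [].
rewrite (_ : (fun x => (f (x + h))%:E) = (EFin \o f) \o (fun x => x + h))//.
by rewrite funepos_comp funeneg_comp.
Qed.

Lemma RI_shift a v h t : measurable_fun [set: R] v ->
  RI a (fun s => v (s - h)) t = RI a v (t - h).
Proof.
move=> mv; have m := measurable_RI_integrand a (t - h) mv.
rewrite /RI -[RHS](Rintegral_shift (- h) m); apply: eq_Rintegral => s _.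
by congr (kern a _ * _); ring.
Qed.

Lemma RI1_lipschitz T p v (M a b : R) : 0 < T -> 1 <= p -> Lz T p v ->
  (forall x, `|v x| <= M) -> a <= b -> `|RI 1 v b - RI 1 v a| <= M * (b - a).
Proof.
move=> T0 p1 hv bM ab; have [mv _ _] := hv.
have M0 : 0 <= M by apply: le_trans (bM 0).
rewrite (RI1B _ _ T0 p1 hv) -lee_fin.
apply: (le_trans (normr_fine_le (\int[mu]_s (v s * (kern 1 (b - s) - kern 1 (a - s)))%:E)%E)).
have md : measurable_fun [set: R] (fun s => v s * (kern 1 (b - s) - kern 1 (a - s))).
  by apply: measurable_funM => //; apply: measurable_funB; exact: measurable_subl.
apply: (le_trans (le_abse_integral mu _ _)) => //; first exact/measurable_EFinP.
apply: (@le_trans _ _ (\int[mu]_s ((cst M \_ `[a, b[) s)%:E)%E).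
  apply: ge0_le_integral_EFin => //.
  - exact: measurableT_comp.
  - exact: measurable_restrict_itv.
  - move=> s; rewrite normrM !kern1 !subr_gt0 patchE.
    have -> : (s \in `[a, b[%classic) = (a <= s < b).
      by apply/idP/idP; rewrite inE/= in_itv.
    have [sb|bs] := ltP s b; last first.
      by rewrite [s < a]ltNge (le_trans ab bs) andbF subrr normr0 mulr0.
    have [sa|as'] := ltP s a; first by rewrite subrr normr0 mulr0.
    by rewrite subr0 normr1 mulr1.
rewrite integral_restrict_EFin//.
rewrite (_ : (\int[mu]_(x in _) _)%E = M%:E * mu `[a, b[%classic)%E; last first.
  exact: (@integral_cst _ _ _ mu `[a, b[%classic (measurable_itv _) M%:E).
rewrite lebesgue_measure_itv/= lte_fin; case: ifPn => h; first by rewrite -EFinD -EFinM.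
by rewrite mule0 lee_fin mulr_ge0// subr_ge0.
Qed.

Lemma Lpow_dominated p v (f_ : (R -> R)^nat) (g : R -> R) : 0 < p ->
  measurable_fun [set: R] v -> (forall n, measurable_fun [set: R] (f_ n)) ->
  {ae mu, forall x, f_ ^~ x @ \oo --> v x} ->
  mu.-integrable [set: R] (EFin \o g) ->
  (forall n x, `|v x - f_ n x| `^ p <= g x) ->
  forall e : R, 0 < e -> exists n, (Lpow p (fun x => v x - f_ n x)%R < e%:E)%E.
Proof.
move=> p0 mv mf cf ig fg e e0.
pose h_ n x : \bar R := (`|v x - f_ n x| `^ p)%:E.
have mh n : measurable_fun [set: R] (h_ n).
  by apply/measurable_EFinP; apply: measurable_normr_powR; exact: measurable_funB.
have m0 : measurable_fun [set: R] (cst 0%E : R -> \bar R) by [].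
have ch : {ae mu, forall x, [set: R] x -> h_ ^~ x @ \oo --> (cst 0%E : R -> \bar R) x}.
  apply: aeS cf => x cf _; apply: cvg_EFin; first exact: nearW.
  have c1 : (fun n => `|v x - f_ n x|) @ \oo --> (0 : R).
    rewrite -(normr0 R) -(subrr (v x)); apply: cvg_norm; apply: cvgB => //.
    exact: cvg_cst.
  apply/cvgrPdist_lt => d d0; have dp : 0 < d `^ p^-1 by rewrite powR_gt0.
  move/cvgrPdist_lt : c1 => /(_ _ dp); apply: filterS => n /=.
  rewrite !sub0r !normrN normr_id (ger0_norm (powR_ge0 _ _)) => hh.
  rewrite -[ltRHS](powRr1 (ltW d0)) -(@mulVf _ p) ?gt_eqF// powRrM.
  by rewrite gt0_ltr_powR ?nnegrE ?powR_ge0.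
have hg : {ae mu, forall x n, [set: R] x -> (`|h_ n x| <= (EFin \o g) x)%E}.
  by apply: aeW => x n _; rewrite /h_/= lee_fin ger0_norm ?powR_ge0.
have [_ _ hc] := @dominated_convergence _ (measurableTypeR R) R mu setT measurableT
    h_ (cst 0%E) (EFin \o g) mh m0 ch ig hg.
rewrite integral0 in hc.
have nb : nbhs (0%E : \bar R) [set y : \bar R | (y < e%:E)%E].
  by apply: open_nbhs_nbhs; split; [exact: open_ereal_lt_ereal|rewrite /= lte_fin].
have [N _ HN] := hc _ nb.
by exists N; exact: (HN N (leqnn N)).
Qed.

(** [w] is a backward difference quotient of [v], so J^1 w is the mean of [v] over the preceding
    interval of length 1 / (n + 1). These means stay below [M] and converge to [v] almost
    everywhere. *)
Lemma density_bounded T p v (M e : R) : 0 < T -> 1 <= p -> Lz T p v ->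
  (forall x, `|v x| <= M) -> 0 < e ->
  exists2 w, Lz T p w & (Lpow p (fun x => v x - J T 1 w x)%R < e%:E)%E.
Proof.
move=> T0 p1 hv bM e0; have [mv sv fv] := hv.
have p0 : 0 < p by exact: lt_le_trans p1.
have M0 : 0 <= M by apply: le_trans (bM 0).
pose h n : R := n.+1%:R^-1.
have h0 n : 0 < h n by rewrite invr_gt0.
pose u n x := n.+1%:R * (v x - v (x - h n)).
have mvh n : measurable_fun [set: R] (fun x => v (x - h n)) by exact: measurable_subr.
have mu_ n : measurable_fun [set: R] (u n).
  by apply: measurable_funM => //; exact: measurable_funB.
have hcut n : Lz T p (cut T (u n)).
  apply: (@Lz_bounded R T p _ (n.+1%:R * (M + M))) => //.
  - exact: measurable_cut.
  - by move=> x xT; rewrite cut_out.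
  - move=> x; rewrite cutE; case: ifP => _; last by rewrite normr0 mulr_ge0 ?addr_ge0.
    rewrite normrM ger0_norm// ler_wpM2l// (le_trans (ler_normB _ _))// lerD//.
have vle0 x : x <= 0 -> v x = 0 by exact: Lz_le0 hv.
have iv := Lz_integrable T0 p1 hv.
(* Backward differences respect the zero extension: [u n] vanishes for x <= 0 because [v] does, and
   the cut at [T] is harmless by causality. *)
have J1u n x : 0 < x < T -> J T 1 (cut T (u n)) x = n.+1%:R * (RI 1 v x - RI 1 v (x - h n)).
  move=> xT; rewrite J_in// RI_cut; last 2 first.
  - by case/andP: xT.
  - move=> y y0; rewrite /u vle0// vle0 ?subrr ?mulr0//.
    by rewrite (le_trans _ y0)// lerBlDr lerDl ltW.
  have fv1 : (Lpow 1 v < +oo)%E by have [] := Lz_Lpow1 T0 p1 hv.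
  have i1 : mu.-integrable [set: R] (EFin \o (fun s => kern 1 (x - s) * v s)).
    apply: integrable_RI => //; apply: le_lt_trans fv1.
    rewrite /EI; apply: ge0_le_integral_EFin => //.
    + by apply: measurable_RI_integrand; exact: measurableT_comp.
    + by move=> s; rewrite mulr_ge0 ?kern_ge0.
    + exact: measurable_normr_powR.
    + by move=> s; rewrite powRr1// kern1 -[leRHS]mul1r ler_wpM2r//; case: (_ < _).
  have i2 : mu.-integrable [set: R] (EFin \o (fun s => kern 1 (x - s) * v (s - h n))).
    apply: (integrable_RI (mvh n)); apply: le_lt_trans fv1.
    have mh : measurable_fun [set: R] (fun x => (`|v x| `^ 1)%:E : \bar R).
      by apply/measurable_EFinP; exact: measurable_normr_powR.
    have mh0 (y : R) : (0 <= (`|v y| `^ 1)%:E)%E by rewrite lee_fin powR_ge0.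
    rewrite /Lpow -(ge0_integral_shift (- h n) mh mh0) {mh0}.
    rewrite /EI; apply: ge0_le_integral_EFin => //.
    + by apply: measurable_RI_integrand; apply: measurableT_comp => //; exact: mvh.
    + by move=> s; rewrite mulr_ge0 ?kern_ge0.
    + by apply: (measurable_normr_powR 1); exact: mvh.
    + by move=> s; rewrite powRr1// kern1 -[leRHS]mul1r ler_wpM2r//; case: (_ < _).
  rewrite -RI_shift// /RI -RintegralB// -RintegralZl//; last first.
    by have := integrableB measurableT i1 i2; apply: eq_integrable.
  by apply: eq_Rintegral => s _; rewrite /u; ring.
pose f_ n := J T 1 (cut T (u n)).
have mf n : measurable_fun [set: R] (f_ n).
  by apply: measurable_cut; apply: measurable_RI; exact: measurable_cut.
have cf : {ae mu, forall x, f_ ^~ x @ \oo --> v x}.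
  have := derive_RI1 T0 p1 hv; apply: aeS => x [dx vx].
  have [xT|xT] := boolP (0 < x < T); last first.
    rewrite sv// (_ : (fun n => _) = cst 0); first exact: cvg_cst.
    by apply/funext => n; rewrite /f_ /J cut_out.
  rewrite (_ : (fun n => _) = (fun n => n.+1%:R * (RI 1 v x - RI 1 v (x - h n)))); last first.
    by apply/funext => n; exact: J1u.
  rewrite -vx derive1E.
  have /cvgr_dnbhsP/(_ (fun n => - h n)) := dx.
  move=> /(_ _)/wrap[].
    split; first by move=> n; rewrite oppr_eq0 gt_eqF.
    by rewrite -oppr0; apply: cvgN; exact: cvg_harmonic.
  apply: cvg_trans; apply: near_eq_cvg; near=> n => /=.
  by rewrite /GRing.scale/= mulr1 invrN invrK mulNr -mulrN opprB [- h n + x]addrC.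
pose g := cut T (cst ((M + M) `^ p)) : R -> R.
have hg : Lz T 1 g.
  apply: (@Lz_bounded R T 1 _ ((M + M) `^ p)) => //.
  - exact: measurable_cut.
  - by move=> x xT; rewrite /g cut_out.
  - by move=> x; rewrite /g cutE; case: ifP => _; rewrite ?normr0 ?ger0_norm ?powR_ge0.
have fg n x : `|v x - f_ n x| `^ p <= g x.
  rewrite /g cutE; case: ifPn => xT; last first.
    by rewrite sv// /f_ /J cut_out// subrr normr0 powR0// gt_eqF.
  rewrite /cst ge0_ler_powR ?nnegrE ?addr_ge0 ?(ltW p0)//.
  rewrite (le_trans (ler_normB _ _))// lerD// /f_ J1u// normrM ger0_norm//.
  have xh : x - h n <= x by rewrite lerBlDr lerDl ltW.
  have := RI1_lipschitz T0 p1 hv bM xh; rewrite (_ : x - (x - h n) = h n); last by ring.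
  by move=> hL; rewrite -ler_pdivlMl// mulrC.
have [n hn] := Lpow_dominated p0 mv mf cf (Lz_integrable T0 (lexx 1) hg) fg e0.
exists (cut T (u n)); [exact: hcut|exact: hn].
Unshelve. all: by end_near. Qed.

(** Truncating [v] where |v| exceeds [n] reduces to bounded functions. Each of the two errors gets
    the tolerance e / (2 2^p), which compensates the constant of [LpowD]. *)
Lemma density_J1 T p v (e : R) : 0 < T -> 1 <= p -> Lz T p v -> 0 < e ->
  exists2 w, Lz T p w & (Lpow p (fun x => v x - J T 1 w x)%R < e%:E)%E.
Proof.
move=> T0 p1 hv e0; have [mv sv fv] := hv.
have p0 : 0 < p by exact: lt_le_trans p1.
pose f_ n x := if `|v x| <= n%:R then v x else 0.
have mf n : measurable_fun [set: R] (f_ n).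
  apply: measurable_fun_ifT => //; apply: measurable_fun_ler => //.
  exact: measurableT_comp.
have cf : {ae mu, forall x, f_ ^~ x @ \oo --> v x}.
  apply: aeW => x; apply: cvg_near_cst.
  near=> n; rewrite /f_ ifT//.
  by near: n; exact: nbhs_infty_ger.
have hfn n : Lz T p (f_ n).
  apply: (@Lz_bounded R T p _ n%:R) => //.
  - by move=> x xT; rewrite /f_ sv// if_same.
  - by move=> x; rewrite /f_; case: ifP => //; rewrite normr0.
have ig : mu.-integrable [set: R] (EFin \o (fun x => `|v x| `^ p)).
  apply/integrableP; split; first by apply/measurable_EFinP; exact: measurable_normr_powR.
  apply: le_lt_trans fv; rewrite le_eqVlt; apply/orP; left; apply/eqP.
  by apply: eq_integral => x _; rewrite /= ger0_norm ?powR_ge0.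
have fg n x : `|v x - f_ n x| `^ p <= `|v x| `^ p.
  rewrite /f_; case: ifP => _; last by rewrite subr0.
  by rewrite subrr normr0 powR0 ?gt_eqF// powR_ge0.
have C0 : 0 < 2 `^ p :> R by rewrite powR_gt0.
have e1 : 0 < e / (2 `^ p * 2) by rewrite divr_gt0 ?mulr_gt0.
have [n hn] := Lpow_dominated p0 mv mf cf ig fg e1.
have bn x : `|f_ n x| <= n%:R by rewrite /f_; case: ifP => //; rewrite normr0.
have [w hw wn] := density_bounded T0 p1 (hfn n) bn e1.
exists w => //.
have [mJ _ _] := J_Lz T0 ltr01 p1 hw.
rewrite (_ : (fun x => v x - J T 1 w x) =
  (fun x => (v x - f_ n x) + (f_ n x - J T 1 w x))); last first.
  by apply/funext => x; ring.
apply: (le_lt_trans (LpowD p1 (measurable_funB mv (mf n)) (measurable_funB (mf n) mJ))).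
rewrite (_ : e%:E = (2 `^ p)%:E * ((e / (2 `^ p * 2))%:E + (e / (2 `^ p * 2))%:E))%E; last first.
  by rewrite -EFinD -EFinM; congr (_%:E); field; rewrite gt_eqF.
by rewrite lte_pmul2l ?lte_fin// lteD.
Unshelve. all: by end_near. Qed.

End density.

(** * Marchaud's formula *)

Section marchaud.
Context {R : realType}.
Notation mu := (@lebesgue_measure R).
Implicit Types (T p a b theta : R) (u v g w : R -> R).

Lemma measurable_kern_tail b r t : measurable_fun [set: R]
  (fun s => kern 1 s * (kern (- b) (t - s) * (1 - kern 1 (s - r)))).
Proof.
have m1 : measurable_fun [set: R] (cst (1 : R)) by [].
exact: (measurable_funM (measurable_kern 1)
  (measurable_funM (measurable_subl t (measurable_kern (- b)))
  (measurable_funB m1 (measurable_subr r (measurable_kern 1))))).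
Qed.

Lemma measurable_kern1_diff s t :
  measurable_fun [set: R] (fun r => kern 1 (t - r) - kern 1 (s - r)).
Proof.
exact: (measurable_funB (measurable_subl t (measurable_kern 1))
  (measurable_subl s (measurable_kern 1))).
Qed.

Lemma integral_kern1_diff (s t : R) : s <= t ->
  (\int[mu]_r (kern 1 (t - r) - kern 1 (s - r))%:E = (t - s)%:E)%E.
Proof.
move=> st.
transitivity (\int[mu]_r ((cst (1 : R) \_ `[s, t[) r)%:E)%E.
  apply: eq_integral => r _; congr (_%:E); rewrite patchE !kern1 !subr_gt0.
  have -> : (r \in `[s, t[%classic) = (s <= r < t).
    by apply/idP/idP; rewrite inE/= in_itv.
  have [rt|tr] := ltP r t; last first.
    by rewrite [r < s]ltNge (le_trans st tr) andbF subrr.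
  by have [rs|sr] := ltP r s; [rewrite subrr|rewrite subr0].
rewrite integral_restrict_EFin//.
rewrite (_ : (\int[mu]_(x in _) _)%E = 1%:E * mu `[s, t[%classic)%E; last first.
  exact: (@integral_cst _ _ _ mu `[s, t[%classic (measurable_itv _) 1%:E).
rewrite lebesgue_measure_itv/= lte_fin mul1e; case: ifPn => h; first by rewrite -EFinD.
by rewrite (le_anti (_ : s <= t <= s)) ?subrr// st leNgt h.
Qed.

(** [1 - kern 1 (s - r)] is the indicator of [s <= r], so this is the integral of (t - s)^(-b-1)
    over []0, r]]: the total weight with which g(r) enters the increments of its primitive in
    Marchaud's formula. *)
Lemma integral_kern_tail b r t : 0 < b -> 0 < r < t ->
  (\int[mu]_s (kern 1 s * (kern (- b) (t - s) * (1 - kern 1 (s - r))))%:E =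
   (((t - r) `^ (- b) - t `^ (- b)) / b)%:E)%E.
Proof.
move=> b0 /andP[r0 rt]; have tr0 : 0 < t - r by rewrite subr_gt0.
have nb0 : - b != 0 by rewrite oppr_eq0 gt_eqF.
pose F s := (kern (- b) \_ `](t - r), t[) s.
have mF : measurable_fun [set: R] (fun s => (F s)%:E).
  by apply/measurable_EFinP; exact: measurable_restrict_itv.
have F0 s : (0 <= (F s)%:E)%E by rewrite lee_fin; apply: restrict_ge0.
have iF : (\int[mu]_s (F (t - s))%:E = (((t - r) `^ (- b) - t `^ (- b)) / b)%:E)%E.
  rewrite (ge0_integral_subr t mF F0) integral_restrict_EFin//.
  transitivity (\int[mu]_(z in `](t - r)%R, t[) (z `^ (- b - 1))%:E)%E.
    apply: eq_integral => z; rewrite inE/= in_itv/= => /andP[z1 _].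
    by rewrite /kern (lt_trans tr0 z1).
  rewrite integral_powR_pos//; last by rewrite lerBlDr lerDl ltW.
  by congr (_%:E); field; rewrite gt_eqF.
rewrite -iF; apply: ae_eq_integral => //.
- by apply/measurable_EFinP; exact: measurable_kern_tail.
- by apply: (measurableT_comp mF); exact: measurable_funB.
(* The half-open interval []0, r]] and the open one produced by the reflection differ only at
   [s = r]. *)
exists [set r]; split; [exact: measurable_set1|exact: lebesgue_measure_set1|].
move=> s /=; apply: contra_notP => /eqP sr _; congr (_%:E); rewrite /F patchE.
have -> : (t - s \in `](t - r)%R, t[%classic) = (0 < s < r).
  by apply/idP/idP; rewrite inE/= in_itv/=; lra.
rewrite !kern1 subr_gt0; have [s0|s0] := ltP 0 s; last by rewrite mul0r.
have [rs|sr'] := ltP r s; first by rewrite subrr mulr0 mulr0 [s < r]ltNge (ltW rs).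
by rewrite subr0 mul1r mulr1 lt_neqAle sr sr'.
Qed.

(* The Marchaud form of the fractional derivative of order [b] of [RI 1 g]. *)
Lemma marchaud T p b g (M t : R) : 0 < T -> 1 <= p -> 0 < b < 1 -> Lz T p g ->
  (forall x, `|g x| <= M) -> 0 < t ->
  (`|RI (1 - b) g t|%:E <= (t `^ (- b) * `|RI 1 g t|)%:E +
    b%:E * \int[mu]_s (kern 1 s * (kern (- b) (t - s) * `|RI 1 g s - RI 1 g t|))%:E)%E.
Proof.
move=> T0 p1 /andP[b0 b1] hg bM t0; have [mg sg _] := hg.
have ig := Lz_integrable T0 p1 hg.
have gle0 x : x <= 0 -> g x = 0 by exact: Lz_le0 hg.
have M0 : 0 <= M by apply: le_trans (bM 0).
have mRI : measurable_fun [set: R] (RI 1 g) by exact: measurable_RI.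
(* For [s < t], [D s r] is the indicator of s <= r < t, so g times [D] integrates in [r] to f(t) -
   f(s), where f = [RI 1 g]. The formula results from comparing the two orders of integration of
   [F]. *)
pose D s r := kern 1 (t - r) - kern 1 (s - r).
pose F (z : R * R) : \bar R :=
  (kern 1 z.1 * kern (- b) (t - z.1) * (g z.2 * D z.1 z.2))%:E.
have mF : measurable_fun [set: R * R] F.
  apply/measurable_EFinP; apply: measurable_funM.
    apply: measurable_funM; first exact: (measurableT_comp (measurable_kern 1) measurable_fst).
    exact: (measurableT_comp (measurable_subl t (measurable_kern (- b))) measurable_fst).
  apply: measurable_funM; first exact: (measurableT_comp mg measurable_snd).
  apply: measurable_funB.
    exact: (measurableT_comp (measurable_subl t (measurable_kern 1)) measurable_snd).
  by apply: (measurableT_comp (measurable_kern 1)); exact: measurable_funB.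
have D01 s r : 0 <= s < t -> 0 <= D s r.
  move=> /andP[_ st]; rewrite /D !kern1 !subr_gt0.
  by have [rs|] := ltP r s; [rewrite (lt_trans rs st) subrr|rewrite subr0].
have iD s : 0 <= s < t -> (\int[mu]_r (D s r)%:E = (t - s)%:E)%E.
  by move=> /andP[_ st]; apply: integral_kern1_diff; exact: ltW.
have mD s : measurable_fun [set: R] (D s) by exact: measurable_kern1_diff.
have inner s : (\int[mu]_r F (s, r) =
   (kern 1 s * kern (- b) (t - s) * (RI 1 g t - RI 1 g s))%:E)%E.
  rewrite (RI1B _ _ T0 p1 hg) /F/=; under eq_integral do rewrite EFinM.
  have iDg : mu.-integrable [set: R] (EFin \o (fun r => g r * D s r)).
    apply: le_integrable ig => //.
      by apply/measurable_EFinP; exact: (measurable_funM mg (mD s)).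
    move=> r _; rewrite /= lee_fin normrM ler_piMr// /D !kern1.
    by case: (_ < _); case: (_ < _); rewrite ?subrr ?subr0 ?sub0r ?normrN ?normr0 ?normr1.
  rewrite integralZl// [RHS]EFinM; congr (_ * _)%E.
  by rewrite /Rintegral fineK//; exact: integrable_fin_num.
(* Boundedness of [g] acts here: integrating |g| times [D] over [r] gives at most M (t - s), which
   cancels one power of (t - s)^(-b-1), and (t - s)^(-b) is integrable up to [t] since [b < 1]. *)
have iF : (mu \x mu)%E.-integrable [set: R * R] F.
  apply/integrable12ltyP => //.
  apply: (@le_lt_trans _ _ (\int[mu]_s ((M * (kern (1 - b) \_ `]0, t[) (t - s)))%:E)%E); last first.
    have mk : measurable_fun [set: R] (fun s => (kern (1 - b) \_ `]0, t[) (t - s)).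
      by apply: measurable_subl; exact: measurable_restrict_itv.
    rewrite ge0_integral_EFinZl//; last by move=> s; apply: restrict_ge0.
    rewrite (@ge0_integral_subr _ t (fun s => ((kern (1 - b) \_ `]0, t[) s)%:E)); last 2 first.
    - by apply/measurable_EFinP; exact: measurable_restrict_itv.
    - by move=> s; rewrite lee_fin; apply: restrict_ge0.
    rewrite integral_restrict_EFin// integral_kern ?subr_gt0 ?(ltW t0)//.
    by rewrite -EFinM ltry.
  apply: ge0_le_integral => //.
  - by move=> s _; exact: integral_ge0.
  - have mFa : measurable_fun [set: R * R] (abse \o F) by exact: measurableT_comp.
    have mFa0 z : (0 <= (abse \o F) z)%E by exact: abse_ge0.
    exact: (@measurable_fun_fubini_tonelli_F _ _ _ _ _ mu (abse \o F) mFa mFa0).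
  - apply/measurable_EFinP; apply: measurable_funM => //.
    by apply: measurable_subl; exact: measurable_restrict_itv.
  - move=> s _; rewrite patchE.
    have -> : (t - s \in `]0, t[%classic) = (0 < s < t).
      by apply/idP/idP; rewrite inE/= in_itv/=; lra.
    case: ifPn => st; last first.
      rewrite mulr0 integral0_eq// => r _; rewrite /F/=.
      have [s0|s0] := ltP 0 s; last by rewrite (kern_le0 1 s0) !mul0r normr0.
      rewrite (kern_le0 (- b)) ?mulr0 ?mul0r ?normr0// subr_le0 leNgt.
      by apply: contra st => ->; rewrite s0.
    have /andP[s0 st'] := st.
    have st0 : 0 <= s < t by rewrite (ltW s0).
    apply: (@le_trans _ _ (\int[mu]_r ((kern (- b) (t - s) * M) * D s r)%:E)%E).
      apply: ge0_le_integral_EFin => //.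
      + have m3 : measurable_fun [set: R] (fun r => kern 1 s * kern (- b) (t - s) * (g r * D s r)).
          by have mgD := measurable_funM mg (mD s); exact: measurable_funM.
        exact: measurableT_comp.
      + by apply: measurable_funM => //; exact: mD.
      + move=> r; rewrite /= kern1 s0 mul1r !normrM (ger0_norm (kern_ge0 _ _)).
        rewrite (ger0_norm (D01 _ r st0)) mulrA ler_wpM2r ?D01// ler_wpM2l ?kern_ge0//.
    rewrite ge0_integral_EFinZl ?mulr_ge0 ?kern_ge0//; last by move=> r; exact: D01.
    rewrite iD// -EFinM lee_fin (_ : _ * M * _ = M * (kern (- b) (t - s) * (t - s))); last by ring.
    have ts0 : 0 < t - s by rewrite subr_gt0.
    rewrite ler_wpM2l// /kern ts0 -[X in _ * X <= _](powRr1 (ltW ts0)) -gt0_powRD//.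
    by rewrite (_ : - b - 1 + 1 = 1 - b - 1)//; ring.
have h1 : (\int[mu]_s \int[mu]_r F (s, r) = \int[mu]_r \int[mu]_s F (s, r))%E.
  exact: (Fubini iF).
(* Integrating in [s] first gives g(r) ((t - r)^(-b) - t^(-b)) / b for 0 < r < t by
   [integral_kern_tail]: the integrands of [RI (1 - b) g t] and of t^(-b) [RI 1 g t]. *)
have h2 : (\int[mu]_r \int[mu]_s F (s, r) =
    \int[mu]_r (b^-1 * (kern (1 - b) (t - r) * g r - t `^ (- b) * (kern 1 (t - r) * g r)))%:E)%E.
  apply: eq_integral => r _; rewrite /F/=.
  have [r0|r0] := leP r 0.
    rewrite (gle0 r r0) !mulr0 subrr mulr0.
    by apply: integral0_eq => s _; rewrite mul0r mulr0.
  have [tr|rt] := leP t r.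
    have tr' : t - r <= 0 by rewrite subr_le0.
    rewrite (kern_le0 (1 - b) tr') (kern_le0 1 tr') !mul0r mulr0 subrr mulr0.
    apply: integral0_eq => s _.
    have [st|ts] := ltP s t.
      by rewrite /D !kern1 !subr_gt0 [r < t]ltNge tr [r < s]ltNge (ltW (lt_le_trans st tr)) subrr !mulr0.
    have ts' : t - s <= 0 by rewrite subr_le0.
    by rewrite (kern_le0 (- b) ts') mulr0 mul0r.
  have e1 : kern 1 (t - r) = 1 by rewrite kern1 subr_gt0 rt.
  have eFr s : kern 1 s * kern (- b) (t - s) * (g r * D s r) =
      g r * (kern 1 s * (kern (- b) (t - s) * (1 - kern 1 (s - r)))).
    by rewrite /D e1; ring.
  transitivity (\int[mu]_s ((g r)%:E *
      (kern 1 s * (kern (- b) (t - s) * (1 - kern 1 (s - r))))%:E))%E.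
    by apply: eq_integral => s _; rewrite eFr EFinM.
  have rt0 : 0 < r < t by rewrite r0.
  have kt0 s : 0 <= kern 1 s * (kern (- b) (t - s) * (1 - kern 1 (s - r))).
    apply: mulr_ge0; first exact: kern_ge0.
    apply: mulr_ge0; first exact: kern_ge0.
    by rewrite kern1 subr_ge0 lern1 leq_b1.
  have itail : mu.-integrable [set: R]
      (EFin \o (fun s => kern 1 s * (kern (- b) (t - s) * (1 - kern 1 (s - r))))).
    apply/integrableP; split.
      by apply/measurable_EFinP; exact: measurable_kern_tail.
    apply: (@le_lt_trans _ _ (((t - r) `^ (- b) - t `^ (- b)) / b)%:E); last exact: ltry.
    rewrite -(integral_kern_tail b0 rt0) le_eqVlt; apply/orP; left; apply/eqP.
    by apply: eq_integral => s _; rewrite abse_EFin ger0_norm.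
  rewrite (integralZl measurableT itail).
  rewrite (integral_kern_tail b0 rt0) -EFinM; congr (_%:E).
  rewrite /kern subr_gt0 rt (_ : 1 - b - 1 = - b); last by ring.
  by rewrite subrr powRr0; field; rewrite gt_eqF.
have fin a : 0 < a -> mu.-integrable [set: R] (EFin \o (fun r => kern a (t - r) * g r)).
  clear h1 h2 inner iD D01 iF mD; move=> a0; apply: (integrable_RI mg).
  have mk : measurable_fun [set: R] (fun s => (kern a \_ `]0, t[) (t - s)).
    by apply: measurable_subl; exact: measurable_restrict_itv.
  have mka : measurable_fun [set: R] (fun s => ((kern a \_ `]0, t[) s)%:E : \bar R).
    by apply/measurable_EFinP; exact: measurable_restrict_itv.
  have ka0 (s : R) : (0 <= ((kern a \_ `]0, t[) s)%:E)%E by rewrite lee_fin; apply: restrict_ge0.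
  apply: (@le_lt_trans _ _ (\int[mu]_s (M * (kern a \_ `]0, t[) (t - s))%:E)%E); last first.
    rewrite ge0_integral_EFinZl//; last by move=> s; apply: restrict_ge0.
    rewrite (ge0_integral_subr t mka ka0).
    by rewrite integral_restrict_EFin// integral_kern ?(ltW t0)// -EFinM ltry.
  clear mka ka0; rewrite /EI; apply: ge0_le_integral_EFin => //.
  - by apply: measurable_RI_integrand; exact: measurableT_comp.
  - by move=> s; rewrite mulr_ge0 ?kern_ge0.
  - by apply: measurable_funM.
  - move=> s; have [s0|s0] := leP s 0.
      by rewrite gle0// normr0 mulr0 mulr_ge0//; apply: restrict_ge0.
    have [ts|st] := leP t s.
      by rewrite (kern_le0 a) ?mul0r ?mulr_ge0//; [apply: restrict_ge0|rewrite subr_le0].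
    rewrite patchE mem_set/=; last by rewrite in_itv/=; lra.
    by rewrite mulrC ler_wpM2r ?kern_ge0.
have i1 := fin _ ltr01.
have b1' : 0 < 1 - b by rewrite subr_gt0.
have i2 := fin _ b1'.
have [L eLd hL] : exists2 L, L = b^-1 * (RI (1 - b) g t - t `^ (- b) * RI 1 g t) & (\int[mu]_s (kern 1 s * kern (- b) (t - s) * (RI 1 g t - RI 1 g s))%:E = L%:E)%E.
  eexists; first by [].
  transitivity (\int[mu]_s \int[mu]_r F (s, r))%E.
    by apply: eq_integral => s _; rewrite inner.
  rewrite h1 h2.
  have i3 : mu.-integrable [set: R] (EFin \o (fun r => t `^ (- b) * (kern 1 (t - r) * g r))).
    by have := integrableZl measurableT (t `^ (- b)) i1; apply: eq_integrable.
  have i4 : mu.-integrable [set: R] (EFin \o (fun r => kern (1 - b) (t - r) * g r -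
      t `^ (- b) * (kern 1 (t - r) * g r))).
    by have := integrableB measurableT i2 i3; apply: eq_integrable.
  have i5 : mu.-integrable [set: R] (EFin \o (fun r => b^-1 * (kern (1 - b) (t - r) * g r -
      t `^ (- b) * (kern 1 (t - r) * g r)))).
    by have := integrableZl measurableT b^-1 i4; apply: eq_integrable.
  rewrite -[LHS]fineK; last exact: integrable_fin_num.
  congr (_%:E); rewrite /RI -(RintegralZl _ measurableT i1).
  rewrite -(RintegralB measurableT i2 i3) -(RintegralZl _ measurableT i4).
  by [].
(* Marchaud's identity, with [L] the integral of (t - s)^(-b-1) (f(t) - f(s)) over []0, t[]; only
   absolute values remain to be taken. *)
have eL : RI (1 - b) g t = t `^ (- b) * RI 1 g t + b * L.
  by rewrite eLd mulrA (mulfV (lt0r_neq0 b0)) mul1r [RHS]addrC subrK.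
clear D01 iD inner h1 h2 fin; move: (RI (1 - b) g t) eL {eLd} => X ->.
apply: (@le_trans _ _ (t `^ (- b) * `|RI 1 g t| + b * `|L|)%:E).
  rewrite lee_fin (le_trans (ler_normD _ _))// !normrM (ger0_norm (powR_ge0 _ _)).
  by rewrite (ger0_norm (ltW b0)).
rewrite EFinD leeD2l// EFinM lee_wpmul2l ?lee_fin ?(ltW b0)//.
have mI : measurable_fun [set: R] (fun s => kern 1 s * kern (- b) (t - s) * (RI 1 g t - RI 1 g s)).
  have m1 := measurable_funM (measurable_kern 1) (measurable_subl t (measurable_kern (- b))).
  exact: (measurable_funM m1 (measurable_funB (measurable_cst (RI 1 g t)) mRI)).
rewrite -abse_EFin -hL.
apply: (le_trans (le_abse_integral mu measurableT _)); first exact/measurable_EFinP.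
rewrite le_eqVlt; apply/orP; left; apply/eqP; apply: eq_integral => s _.
by rewrite abse_EFin !normrM !(ger0_norm (kern_ge0 _ _)) mulrA distrC.
Qed.

End marchaud.

(** * Hardy's inequality: the absorption argument *)

Section hardy.
Context {R : realType}.
Notation mu := (@lebesgue_measure R).
Implicit Types (T p q a b theta : R) (u v g w f : R -> R).

Definition hardy_fun T p q f x : R := cut T (fun x => x `^ (- q) * `|f x| `^ p) x.

Lemma hardy_fun_ge0 T p q f x : 0 <= hardy_fun T p q f x.
Proof. by rewrite /hardy_fun cutE; case: ifP => // _; rewrite mulr_ge0 ?powR_ge0. Qed.

Lemma measurable_hardy_fun T p q f : measurable_fun [set: R] f ->
  measurable_fun [set: R] (hardy_fun T p q f).
Proof.
move=> mf; apply: measurable_cut.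
exact: (measurable_funM (measurable_powR _) (measurable_normr_powR p mf)).
Qed.

Lemma measurable_fst_slice (G : R * R -> R) s : measurable_fun [set: R * R] G ->
  measurable_fun [set: R] (fun x => G (x, s)).
Proof. by move=> mG; apply: (measurableT_comp mG); exact: measurable_pair2. Qed.

(* Averaging [f x = (f x - f s) + f s] against a weight [W x s ds] of mass at
   least 1 reproduces a small multiple of the left-hand side, which is absorbed. *)
Lemma hardy_absorb T p b (W : R * R -> R) (C1 C2 eta : R) f : 0 < T -> 1 <= p -> 0 < b ->
  measurable_fun [set: R] f -> (forall x, ~~ (0 < x < T) -> f x = 0) ->
  measurable_fun [set: R * R] W -> (forall z, 0 <= W z) -> 0 <= C1 -> 0 <= C2 -> 0 <= eta ->
  (forall x s, 0 < x < T -> ~~ (0 < s < T) -> W (x, s) = 0) ->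
  (forall x, 0 < x < T -> x `^ (- (b * p)) <= C2 \/ (1 <= \int[mu]_s (W (x, s))%:E)%E) ->
  (forall x s, 0 < x < T -> 0 < s < T ->
     x `^ (- (b * p)) * W (x, s) <= C1 * `|s - x| `^ (- (1 + b * p))) ->
  (forall s, 0 < s < T -> (\int[mu]_x (cut T (fun x => x `^ (- (b * p)) * W (x, s))%R x)%:E
     <= (eta * s `^ (- (b * p)))%:E)%E) ->
  2 `^ p * eta <= 2^-1 ->
  (\int[mu]_x (hardy_fun T p (b * p) f x)%:E < +oo)%E ->
  (\int[mu]_x (hardy_fun T p (b * p) f x)%:E <=
    2%:E * (C2%:E * Lpow p f + (2 `^ p * C1)%:E * Slobodecki T p b f))%E.
Proof.
move=> T0 p1 b0 mf sf mW W0 C10 C20 eta0 Wout hD hC1 hC2 heta Ifin.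
have p0 : 0 < p by exact: lt_le_trans p1.
set q := b * p in hD hC1 hC2 Ifin *.
have q0 : 0 < q by rewrite mulr_gt0.
have c20 : 0 <= 2 `^ p :> R by rewrite powR_ge0.
set I := (\int[mu]_x _)%E in Ifin *.
have mfp := measurable_normr_powR p mf.
have mh := measurable_hardy_fun T p q mf.
pose A (z : R * R) := cut T (fun x => x `^ (- q)) z.1 * W z.
have A0 z : 0 <= A z by rewrite mulr_ge0// cutE; case: ifP => // _; rewrite powR_ge0.
have mA : measurable_fun [set: R * R] A.
  have mc : measurable_fun [set: R] (cut T (fun x => x `^ (- q))).
    by apply: measurable_cut; exact: measurable_powR.
  exact: (measurable_funM (measurableT_comp mc measurable_fst) mW).
pose F1 (z : R * R) := A z * `|f z.2 - f z.1| `^ p.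
pose F2 (z : R * R) := A z * `|f z.2| `^ p.
have mF1 : measurable_fun [set: R * R] F1.
  apply: (measurable_funM mA); apply: (measurableT_comp (measurable_powR _)).
  apply: measurableT_comp => //.
  exact: (measurable_funB (measurableT_comp mf measurable_snd) (measurableT_comp mf measurable_fst)).
have mF2 : measurable_fun [set: R * R] F2.
  exact: (measurable_funM mA (measurableT_comp mfp measurable_snd)).
have F10 z : 0 <= F1 z by rewrite mulr_ge0 ?powR_ge0.
have F20 z : 0 <= F2 z by rewrite mulr_ge0 ?powR_ge0.
have mEF1 : measurable_fun [set: R * R] (EFin \o F1) by exact/measurable_EFinP.
have mEF2 : measurable_fun [set: R * R] (EFin \o F2) by exact/measurable_EFinP.
have EF10 z : (0 <= (EFin \o F1) z)%E by rewrite /= lee_fin.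
have EF20 z : (0 <= (EFin \o F2) z)%E by rewrite /= lee_fin.
have mi1 : measurable_fun [set: R] (fun x => \int[mu]_s (F1 (x, s))%:E)%E.
  exact: (@measurable_fun_fubini_tonelli_F _ _ _ _ _ mu (EFin \o F1) mEF1 EF10).
have mi2 : measurable_fun [set: R] (fun x => \int[mu]_s (F2 (x, s))%:E)%E.
  exact: (@measurable_fun_fubini_tonelli_F _ _ _ _ _ mu (EFin \o F2) mEF2 EF20).
have i10 x : (0 <= \int[mu]_s (F1 (x, s))%:E)%E by apply: integral_ge0 => s _; rewrite lee_fin F10.
have i20 x : (0 <= \int[mu]_s (F2 (x, s))%:E)%E by apply: integral_ge0 => s _; rewrite lee_fin F20.
have fp0 x : 0 <= `|f x| `^ p by rewrite powR_ge0.
have fp0' s x : 0 <= `|f s - f x| `^ p by rewrite powR_ge0.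
(* If [W (x, .)] has mass at least 1, then x^(-q) |f x|^p is at most its integral against [W], and
   |f x|^p splits into an increment and the value at [s]. In the other alternative of [hD] the
   weight x^(-q) is at most [C2]. *)
have ptw x : ((hardy_fun T p q f x)%:E <= (C2 * `|f x| `^ p)%:E +
    (2 `^ p)%:E * (\int[mu]_s (F1 (x, s))%:E + \int[mu]_s (F2 (x, s))%:E))%E.
  have rhs : (0 <= (2 `^ p)%:E * (\int[mu]_s (F1 (x, s))%:E + \int[mu]_s (F2 (x, s))%:E))%E.
    by rewrite mule_ge0 ?lee_fin// adde_ge0 ?i10 ?i20.
  rewrite /hardy_fun cutE; case: ifPn => xT; last first.
    by rewrite adde_ge0// lee_fin mulr_ge0.
  have [hx|hx] := hD x xT.
    by rewrite -[leLHS]adde0 leeD// lee_fin ler_wpM2r.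
  rewrite -[leLHS]add0e leeD ?lee_fin ?mulr_ge0//.
  have mWx : measurable_fun [set: R] (fun s => W (x, s)) by exact: (measurable_fun_pair2 x mW).
  have m1x : measurable_fun [set: R] (fun s => F1 (x, s)) by exact: (measurable_fun_pair2 x mF1).
  have m2x : measurable_fun [set: R] (fun s => F2 (x, s)) by exact: (measurable_fun_pair2 x mF2).
  have cx0 : 0 <= x `^ (- q) * `|f x| `^ p by rewrite mulr_ge0 ?powR_ge0.
  apply: (@le_trans _ _ ((x `^ (- q) * `|f x| `^ p)%:E * \int[mu]_s (W (x, s))%:E)%E).
    by rewrite -[leLHS]mule1 lee_wpmul2l.
  have W0x s : 0 <= W (x, s) by exact: W0.
  rewrite -ge0_integral_EFinZl//.
  have e12 : (\int[mu]_s (F1 (x, s))%:E + \int[mu]_s (F2 (x, s))%:E =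
     \int[mu]_s (F1 (x, s) + F2 (x, s))%:E)%E.
    by rewrite ge0_integral_EFinD.
  have m12x : measurable_fun [set: R] (fun s => F1 (x, s) + F2 (x, s)).
    exact: (measurable_funD m1x m2x).
  rewrite e12 -ge0_integral_EFinZl//; last by move=> s; rewrite addr_ge0 ?F10 ?F20.
  apply: ge0_le_integral_EFin.
  - by apply: (measurable_funM _ mWx).
  - by move=> s; rewrite mulr_ge0 ?W0.
  - by apply: (measurable_funM _ m12x).
  - move=> s; rewrite /F1 /F2 /A/= cut_in// -!mulrDr.
    have h : `|f x| `^ p <= 2 `^ p * (`|f s - f x| `^ p + `|f s| `^ p).
      by have := normr_powRD (f x - f s) (f s) p1; rewrite subrK distrC.
    have := ler_wpM2l (mulr_ge0 (powR_ge0 x (- q)) (W0 (x, s))) h.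
    by congr (_ <= _); ring.
(* [F1] carries the increments: by [hC1] their weight is at most [C1] times that of the Slobodecki
   seminorm of order [b]. *)
have P1 : (\int[mu]_x \int[mu]_s (F1 (x, s))%:E <= C1%:E * Slobodecki T p b f)%E.
  have ms := measurable_slob_fun T p b mf.
  have mEs : measurable_fun [set: R * R] (EFin \o slob_fun T p b f) by exact/measurable_EFinP.
  have Es0 z : (0 <= (EFin \o slob_fun T p b f) z)%E by rewrite /= lee_fin slob_fun_ge0.
  have mis : measurable_fun [set: R] (fun x => \int[mu]_s (slob_fun T p b f (x, s))%:E)%E.
    exact: (@measurable_fun_fubini_tonelli_F _ _ _ _ _ mu (EFin \o slob_fun T p b f) mEs Es0).
  rewrite (SlobodeckiE _ _ T0 mf) -ge0_integralZl//; last first.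
    by move=> x _; apply: integral_ge0 => s _; rewrite lee_fin slob_fun_ge0.
  apply: ge0_le_integral.
  - exact: measurableT.
  - by move=> x _; exact: i10.
  - exact: mi1.
  - exact: measurable_funeM.
  move=> x _; rewrite -ge0_integral_EFinZl//; last 2 first.
  - exact: (measurable_fun_pair2 x ms).
  - by move=> s; rewrite slob_fun_ge0.
  apply: ge0_le_integral_EFin.
  - exact: (measurable_fun_pair2 x mF1).
  - by move=> s; exact: F10.
  - by apply: measurable_funM => //; exact: (measurable_fun_pair2 x ms).
  - move=> s; have [xT|xT] := boolP (0 < x < T); last first.
      by rewrite /F1 /A/= cut_out// !mul0r mulr_ge0// slob_fun_ge0.
    have [sT|sT] := boolP (0 < s < T); last first.
      by rewrite /F1 /A/= Wout// mulr0 mul0r mulr_ge0// slob_fun_ge0.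
    rewrite /F1 /A /slob_fun/= !cutE xT sT /cst !mul1r (mulrC (`|f s - f x| `^ p) (`|s - x| `^ _)) mulrA.
    by apply: (ler_wpM2r (fp0' s x)); exact: hC1.
(* [F2] carries the values at [s]: integrating the weight in [x] first reproduces s^(-q), with the
   small factor [eta]. *)
have P2 : (\int[mu]_x \int[mu]_s (F2 (x, s))%:E <= eta%:E * I)%E.
  rewrite (tonelli mEF2 EF20) /I -ge0_integral_EFinZl//; last first.
    by move=> x; exact: hardy_fun_ge0.
  clear fp0'; apply: ge0_le_integral; first exact: measurableT.
  - by move=> s _; apply: integral_ge0 => x _; exact: EF20.
  - exact: (@measurable_fun_fubini_tonelli_G _ _ _ _ _ mu (EFin \o F2) mEF2 EF20).
  - by apply/measurable_EFinP; exact: measurable_funM.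
  move=> s _; rewrite /hardy_fun cutE; case: ifPn => sT; last first.
    rewrite mulr0 integral0_eq// => x _; rewrite /F2/= sf//.
    by rewrite normr0 (powR0 (lt0r_neq0 p0)) mulr0.
  have mAs : measurable_fun [set: R] (fun x => A (x, s)) by exact: measurable_fst_slice mA.
  rewrite /F2/=; under eq_integral do rewrite mulrC.
  rewrite (ge0_integral_EFinZl (fp0 s) mAs (fun x => A0 (x, s))).
  rewrite mulrA [X in (_ <= X%:E)%E]mulrC EFinM lee_wpmul2l ?lee_fin//.
  apply: le_trans (hC2 s sT); rewrite le_eqVlt; apply/orP; left; apply/eqP.
  apply: eq_integral => x _; rewrite /A/= !cutE; case: ifP => //.
  by rewrite mul0r.
have I0 : (0 <= I)%E by apply: integral_ge0 => x _; rewrite lee_fin hardy_fun_ge0.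
have Ifn : I \is a fin_num by rewrite ge0_fin_numE.
set S := Slobodecki T p b f in P1 *; set L := Lpow p f.
have mS : measurable_fun [set: R] (fun x => \int[mu]_s (F1 (x, s))%:E + \int[mu]_s (F2 (x, s))%:E)%E.
  exact: (emeasurable_funD mi1 mi2).
have mS2 : measurable_fun [set: R] (fun x => (2 `^ p)%:E *
    (\int[mu]_s (F1 (x, s))%:E + \int[mu]_s (F2 (x, s))%:E))%E.
  exact: (measurable_funeM _ mS).
have mCf : measurable_fun [set: R] (fun x => C2 * `|f x| `^ p).
  exact: (measurable_funM (measurable_cst _) mfp).
have mCfE : measurable_fun [set: R] (fun x => (C2 * `|f x| `^ p)%:E).
  exact/measurable_EFinP.
have Cf0 x : (0 <= (C2 * `|f x| `^ p)%:E)%E by rewrite lee_fin mulr_ge0.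
have S0 x : (0 <= \int[mu]_s (F1 (x, s))%:E + \int[mu]_s (F2 (x, s))%:E)%E.
  exact: (adde_ge0 (i10 x) (i20 x)).
have S20 x : (0 <= (2 `^ p)%:E * (\int[mu]_s (F1 (x, s))%:E + \int[mu]_s (F2 (x, s))%:E))%E.
  by apply: mule_ge0; [rewrite lee_fin|exact: S0].
have tot : (I <= C2%:E * L + (2 `^ p)%:E * (C1%:E * S + eta%:E * I))%E.
  apply: (@le_trans _ _ (\int[mu]_x ((C2 * `|f x| `^ p)%:E +
    (2 `^ p)%:E * (\int[mu]_s (F1 (x, s))%:E + \int[mu]_s (F2 (x, s))%:E)))%E).
    apply: ge0_le_integral.
    - exact: measurableT.
    - by move=> x _; rewrite lee_fin hardy_fun_ge0.
    - exact/measurable_EFinP.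
    - exact: (emeasurable_funD mCfE mS2).
    - by move=> x _; exact: ptw.
  rewrite (ge0_integralD mu measurableT (fun x _ => Cf0 x) mCfE (fun x _ => S20 x) mS2).
  apply: leeD.
    by rewrite (ge0_integral_EFinZl C20 mfp fp0).
  rewrite (ge0_integralZl mu measurableT mS (fun x _ => S0 x)); last by rewrite lee_fin.
  apply: lee_wpmul2l; first by rewrite lee_fin.
  rewrite (ge0_integralD mu measurableT (fun x _ => i10 x) mi1 (fun x _ => i20 x) mi2).
  exact: leeD P1 P2.
clear S0 S20 Cf0 i10 i20 ptw P1 P2.
have L0 : (0 <= L)%E by exact: Lpow_ge0.
have S0 : (0 <= S)%E.
  by apply: integral_ge0 => x _; apply: integral_ge0 => s _; rewrite lee_fin divr_ge0 ?powR_ge0.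
have D0 : (0 <= C2%:E * L + (2 `^ p * C1)%:E * S)%E.
  by rewrite adde_ge0// mule_ge0// lee_fin ?mulr_ge0.
have tot2 : (I <= C2%:E * L + (2 `^ p * C1)%:E * S + 2^-1%:E * I)%E.
  have h1 : (0 <= C1%:E * S)%E by apply: mule_ge0; rewrite ?lee_fin.
  have h2 : (0 <= eta%:E * I)%E by apply: mule_ge0; rewrite ?lee_fin.
  have e1 : ((2 `^ p)%:E * (C1%:E * S + eta%:E * I) = (2 `^ p * C1)%:E * S + (2 `^ p * eta)%:E * I)%E.
    by rewrite (ge0_muleDr _ h1 h2) !muleA -!EFinM.
  apply: (le_trans tot); rewrite e1 addeA; apply: leeD; first exact: lexx.
  by apply: lee_wpmul2r; rewrite ?lee_fin.
(* Finiteness of [I] is what allows the subtraction: I <= D + I / 2 gives I <= 2 D. *)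
move: D0 tot2; set D := (C2%:E * L + _)%E.
rewrite -(fineK Ifn); case: D => [d| |]//; last by rewrite gt0_muley ?lte_fin// leey.
by rewrite -EFinM -EFinD -EFinM !lee_fin => _; lra.
Qed.

End hardy.

(** * Hardy's inequality above the critical exponent *)

Section hardy_cases.
Context {R : realType}.
Notation mu := (@lebesgue_measure R).
Implicit Types (T p q b theta x y s : R) (f g : R -> R).

(** Provides the finiteness required for absorption: the linear bound at 0 leaves x^(p - q), which
    is bounded because [q <= p]. *)
Lemma hardy_fun_fin T p q f (M : R) : 0 < T -> 0 <= q <= p -> 0 < p ->
  measurable_fun [set: R] f -> (forall x, 0 < x -> `|f x| <= M * x) ->
  (\int[mu]_x (hardy_fun T p q f x)%:E < +oo)%E.
Proof.
move=> T0 /andP[q0 qp] p0 mf bf.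
have M0 : 0 <= M by have := le_trans (normr_ge0 _) (bf 1 ltr01); rewrite mulr1.
pose c := M `^ p * T `^ (p - q).
have c0 : 0 <= c by rewrite mulr_ge0 ?powR_ge0.
apply: (@le_lt_trans _ _ (\int[mu]_x ((cst c \_ `]0, T[) x)%:E)%E); last first.
  by rewrite integral_cst_restrict// ltry.
apply: ge0_le_integral_EFin.
- exact: measurable_hardy_fun.
- exact: hardy_fun_ge0.
- by apply: measurable_restrict_itv => //; exact: measurable_cst.
- move=> x; rewrite -/(cut T (cst c)) /hardy_fun !cutE; case: ifP => // /andP[x0 xT].
  have h1 : `|f x| `^ p <= (M * x) `^ p.
    apply: ge0_ler_powR (ltW p0) _ _ _ _ (bf x x0); rewrite nnegrE ?normr_ge0//.
    exact: mulr_ge0 M0 (ltW x0).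
  apply: (le_trans (ler_wpM2l (powR_ge0 _ _) h1)).
  rewrite powRM ?(ltW x0)// mulrCA ler_wpM2l ?powR_ge0// -gt0_powRD// addrC.
  by apply: ge0_ler_powR; rewrite ?nnegrE ?subr_ge0// ltW.
Qed.

Lemma integral_kern1_window x y : x <= y ->
  (\int[mu]_s (kern 1 (s - x) * kern 1 (y - s))%:E = (y - x)%:E)%E.
Proof.
move=> xy; transitivity (\int[mu]_s ((cst (1 : R) \_ `]x, y[) s)%:E)%E.
  apply: eq_integral => s _; rewrite patchE !kern1 !subr_gt0.
  rewrite (_ : (s \in _) = ((x < s) && (s < y))); last first.
    by apply/idP/idP; rewrite inE/= in_itv.
  by case: ltP => _; case: ltP => _ /=; rewrite ?mulr0 ?mul0r ?mulr1.
rewrite integral_restrict_EFin//= integral_cst//= mul1e lebesgue_measure_itv/= lte_fin.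
by case: ltgtP xy => // -> _; rewrite subrr.
Qed.

Lemma integral_powRN_le q x y : 0 < q -> 0 < x -> x <= y ->
  (\int[mu]_z (((fun z => z `^ (- q - 1)) \_ `]x, y[) z)%:E <= (x `^ (- q) / q)%:E)%E.
Proof.
move=> q0 x0 xy; rewrite integral_restrict_EFin// integral_powR_pos//; last first.
  by rewrite oppr_eq0 gt_eqF.
have -> : (y `^ (- q) - x `^ (- q)) / - q = (x `^ (- q) - y `^ (- q)) / q.
  by field; rewrite gt_eqF.
by rewrite lee_fin ler_wpM2r ?invr_ge0 ?(ltW q0)// lerBlDr lerDl powR_ge0.
Qed.

Lemma measurable_kern_aff a (c d e : R) :
  measurable_fun [set: R * R] (fun z => kern a (c * z.1 + d * z.2 + e)).
Proof.
apply: (measurableT_comp (measurable_kern a)).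
apply: (measurable_funD _ (measurable_cst e)).
apply: measurable_funD.
  exact: (measurable_funM (measurable_cst c) measurable_fst).
exact: (measurable_funM (measurable_cst d) measurable_snd).
Qed.

(** Here [f x] is compared with its mean over []0, l x[]. Integrating the weight over [x > s / l]
    gives eta = l^(q - 1) / q, which becomes small with [l] because q = bp > 1. *)
Lemma hardy_gt1 T p b : 0 < T -> 1 <= p -> 0 < b < 1 -> 1 < b * p ->
  exists2 C, 0 <= C & forall f (M : R), measurable_fun [set: R] f ->
    (forall x, ~~ (0 < x < T) -> f x = 0) -> (forall x, 0 < x -> `|f x| <= M * x) ->
  (\int[mu]_x (hardy_fun T p (b * p) f x)%:E <=
    C%:E * (Lpow p f + Slobodecki T p b f))%E.
Proof.
move=> T0 p1 /andP[b0 b1] q1; have p0 : 0 < p by exact: lt_le_trans p1.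
set q := b * p in q1 *.
have q0 : 0 < q by exact: lt_trans q1.
have c20 : 0 < 2 `^ p :> R by rewrite powR_gt0.
have c21 : 1 <= 2 `^ p :> R.
  have h2 : 1 <= 2 :> R by lra.
  by have := ler_powR h2 (ltW p0); rewrite powRr0.
(* [l] will satisfy l^(q - 1) = c, and then 2^p eta = 2^p c / q = 1 / (2 (1 + q)) <= 1/2. *)
pose c := q / (2 * 2 `^ p * (1 + q)).
have d0 : 0 < 2 * 2 `^ p * (1 + q) by rewrite !mulr_gt0// addr_gt0.
have c0 : 0 < c by rewrite divr_gt0.
have c1 : c < 1.
  rewrite ltr_pdivrMr// mul1r; apply: (@lt_le_trans _ _ (1 + q)); first by rewrite ltrDr.
  by rewrite ler_peMl ?addr_ge0 ?(ltW q0)// -[leLHS]mulr1 ler_pM// ler1n.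
pose l := c `^ (q - 1)^-1.
have l0 : 0 < l by rewrite powR_gt0.
have q10 : 0 < q - 1 by rewrite subr_gt0.
have l1 : l < 1.
  have qi0 : 0 < (q - 1)^-1 by rewrite invr_gt0.
  have := gt0_ltr_powR qi0 _ _ c1; rewrite powR1 => h.
  by apply: h; rewrite nnegrE ?ltW.
have lq : l `^ (q - 1) = c by rewrite -powRrM mulVf ?gt_eqF// powRr1// ltW.
(* The uniform density 1 / (l x) on []0, l x[]. As [l < 1] this interval stays inside []0, T[], so
   the mass is always 1 and the constant [C2] can be 0. *)
pose W (z : R * R) : R := kern 1 z.2 * kern 1 (l * z.1 - z.2) * kern 0 (l * z.1).
exists (2 * (2 `^ p * l^-1)).
  by rewrite !mulr_ge0 ?invr_ge0 ?ltW.
move=> f M mf sf bf.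
have mW : measurable_fun [set: R * R] W.
  have m1 := measurable_kern_aff 1 0 1 0; have m2 := measurable_kern_aff 1 l (-1) 0.
  have m3 := measurable_kern_aff 0 l 0 0.
  have := measurable_funM (measurable_funM m1 m2) m3; apply: eq_measurable_fun => z _.
  by rewrite /W /= !mul0r !mul1r !addr0 mulN1r add0r.
have hab := @hardy_absorb R T p b W l^-1 0 (l `^ (q - 1) / q) f T0 p1 b0 mf sf mW.
have -> : (2 * (2 `^ p * l^-1))%:E = (2%:E * (2 `^ p * l^-1)%:E)%E :> \bar R by rewrite EFinM.
rewrite -muleA; apply: (@le_trans _ _ (2%:E * (0%:E * Lpow p f + (2 `^ p * l^-1)%:E * Slobodecki T p b f))%E); last first.
  apply: lee_wpmul2l; first by rewrite lee_fin.
  rewrite mul0e add0e; apply: lee_wpmul2l; first by rewrite lee_fin mulr_ge0 ?invr_ge0 ?ltW.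
  by rewrite leeDr// Lpow_ge0.
apply: hab.
- by move=> z; rewrite !mulr_ge0 ?kern_ge0.
- by rewrite invr_ge0 ltW.
- by [].
- by rewrite divr_ge0 ?powR_ge0 ?ltW.
- move=> x s /andP[x0 xT] sT; rewrite /W/= !kern1.
  have [s0|s0] := ltP 0 s; last by rewrite !mul0r.
  rewrite subr_gt0; have [sl|sl] := ltP s (l * x); last by rewrite mulr0 mul0r.
  move: sT; rewrite s0/= => /negP[]; apply: (lt_trans sl).
  by apply: lt_trans xT; rewrite gtr_pMl.
- move=> x /andP[x0 xT]; right; rewrite /W/=.
  have lx0 : 0 < l * x by rewrite mulr_gt0.
  under eq_integral do rewrite mulrC.
  rewrite ge0_integral_EFinZl ?kern_ge0//; last 2 first.
  + exact: (measurable_funM (measurable_kern 1) (measurable_subl (l * x) (measurable_kern 1))).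
  + by move=> s; rewrite mulr_ge0 ?kern_ge0.
  have := integral_kern1_window (ltW lx0); under eq_integral do rewrite subr0.
  move=> ->; rewrite subr0 /kern lx0 sub0r powRN powRr1 ?(ltW lx0)//.
  by rewrite -EFinM mulVf// gt_eqF.
- move=> x s /andP[x0 xT] /andP[s0 sT]; rewrite /W/= !kern1 s0 mul1r subr_gt0.
  have [sl|sl] := ltP s (l * x); last by rewrite mul0r mulr0 mulr_ge0 ?invr_ge0 ?(ltW l0)// powR_ge0.
  have lx0 : 0 < l * x by rewrite mulr_gt0.
  have sx : s < x by apply: (lt_trans sl); rewrite gtr_pMl.
  rewrite mul1r /kern lx0 sub0r (powRM _ (ltW l0) (ltW x0)) powR_inv1 ?(ltW l0)//.
  rewrite mulrCA ler_wpM2l ?invr_ge0 ?(ltW l0)// -gt0_powRD// -opprD [q + 1]addrC.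
  rewrite distrC gtr0_norm ?subr_gt0// -/q !powRN lef_pV2 ?posrE ?powR_gt0 ?subr_gt0//.
  have xsx : x - s <= x by rewrite lerBlDr lerDl ltW.
  have q1' : 0 <= 1 + q by rewrite addr_ge0 ?(ltW q0).
  by apply: (ge0_ler_powR q1' _ _ xsx); rewrite nnegrE ?subr_ge0 ?ltW.
- move=> s /andP[s0 sT]; have sl0 : 0 < s / l by rewrite divr_gt0.
  (* [s / l + T] is a finite stand-in for the upper limit +oo: it lies beyond every [x] in []0,
     T[]. *)
  have sl1 : s / l <= s / l + T by rewrite lerDl ltW.
  have li0 : 0 <= l^-1 by rewrite invr_ge0 ltW.
  have mp : measurable_fun [set: R] ((fun z : R => z `^ (- q - 1)) \_ `](s / l), (s / l + T)[).
    by apply: measurable_restrict_itv => //; exact: measurable_powR.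
  have rp z : 0 <= ((fun z : R => z `^ (- q - 1)) \_ `](s / l), (s / l + T)[) z.
    by apply: restrict_ge0 => y; rewrite powR_ge0.
  apply: (@le_trans _ _ (l^-1%:E * (((s / l) `^ (- q)) / q)%:E)%E); last first.
    rewrite -EFinM lee_fin powRM ?invr_ge0 ?(ltW l0) ?(ltW s0)//.
    rewrite (_ : l^-1 `^ (- q) = l `^ q); last by rewrite -(powR_inv1 (ltW l0)) -powRrM mulN1r opprK.
    rewrite (_ : l `^ (q - 1) = l `^ q * l^-1); last by rewrite gt0_powRD// powR_inv1 ?(ltW l0).
    by rewrite le_eqVlt; apply/orP; left; apply/eqP; ring.
  apply: le_trans (lee_wpmul2l _ (integral_powRN_le q0 sl0 sl1)); last by rewrite lee_fin.
  rewrite -ge0_integral_EFinZl//.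
  apply: ge0_le_integral_EFin.
  + apply: measurable_cut; apply: (measurable_funM (measurable_powR _)).
    exact: (measurable_fst_slice s mW).
  + by move=> x; rewrite cutE; case: ifP => // _; rewrite !mulr_ge0 ?kern_ge0 ?powR_ge0.
  + exact: (measurable_funM (measurable_cst _) mp).
  + move=> x; rewrite cutE; case: ifPn => [/andP[x0 xT]|_]; last by rewrite mulr_ge0.
    rewrite /W/= !kern1 s0 mul1r subr_gt0.
    have lx0 : 0 < l * x by rewrite mulr_gt0.
    have [sl|sl] := ltP s (l * x); last by rewrite mul0r mulr0 mulr_ge0.
    rewrite mul1r patchE mem_set/=; last first.
      rewrite in_itv/= ltr_pdivrMr// mulrC sl/=.
      by apply: (lt_trans xT); rewrite ltrDr.
    rewrite /kern lx0 sub0r (powRM _ (ltW l0) (ltW x0)) powR_inv1 ?(ltW l0)//.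
    by rewrite mulrCA ler_wpM2l// -gt0_powRD.
- rewrite lq /c (_ : _ * _ = 2^-1 * (1 + q)^-1); last first.
    by field; rewrite !gt_eqF// addr_gt0.
  by rewrite ler_piMr ?invr_ge0 ?invf_le1 ?addr_gt0// lerDl ltW.
- apply: (hardy_fun_fin (M := M)) => //; rewrite (ltW q0)/=.
  by rewrite /q ler_piMl ?(ltW b1)// ltW.
Qed.

End hardy_cases.

(** * Hardy's inequality below the critical exponent *)

Section hardy_lt.
Context {R : realType}.
Notation mu := (@lebesgue_measure R).
Implicit Types (T p q b theta x y s : R) (f g : R -> R).

(** Now the mean is taken over []x, l x[] with [l] large, and eta = l^q / (q (l - 1)) becomes small
    because q = bp < 1. The interval may leave []0, T[] once l x >= T, but then x^(-q) is at most
    [C2]. *)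
Lemma hardy_lt1 T p b : 0 < T -> 1 <= p -> 0 < b < 1 -> b * p < 1 ->
  exists2 C, 0 <= C & forall f (M : R), measurable_fun [set: R] f ->
    (forall x, ~~ (0 < x < T) -> f x = 0) -> (forall x, 0 < x -> `|f x| <= M * x) ->
  (\int[mu]_x (hardy_fun T p (b * p) f x)%:E <=
    C%:E * (Lpow p f + Slobodecki T p b f))%E.
Proof.
move=> T0 p1 /andP[b0 b1] q1; have p0 : 0 < p by exact: lt_le_trans p1.
set q := b * p in q1 *.
have q0 : 0 < q by rewrite mulr_gt0.
have c20 : 0 < 2 `^ p :> R by rewrite powR_gt0.
have q10 : 0 < 1 - q by rewrite subr_gt0.
(* With l^(1 - q) = D one has l^q (4 2^p / q) <= l, hence 2^p eta <= l / (4 (l - 1)) <= 1/2. The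
   last inequality uses l >= 2, which the summand 2 ensures. *)
pose D := 4 * 2 `^ p / q + 2.
have D2 : 2 <= D by rewrite lerDr divr_ge0 ?mulr_ge0 ?ltW.
have D1 : 1 <= D by apply: le_trans D2; lra.
have D0 : 0 < D by apply: lt_le_trans D1.
pose l := D `^ (1 - q)^-1.
have l2 : 2 <= l.
  apply: (le_trans D2); rewrite -[leLHS](powRr1 (ltW D0)).
  by apply: ler_powR => //; rewrite invf_ge1// lerBlDr lerDl ltW.
have l0 : 0 < l by exact: lt_le_trans l2.
have l1 : 1 < l by apply: lt_le_trans l2; lra.
have l10 : 0 < l - 1 by rewrite subr_gt0.
have lq : l `^ (1 - q) = D by rewrite -powRrM mulVf ?gt_eqF// powRr1// ltW.
pose W (z : R * R) : R := kern 1 (z.2 - z.1) * kern 1 (l * z.1 - z.2) *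
  kern 0 ((l - 1) * z.1) * kern 1 (T - z.2).
(* (l - 1)^-1 comes from the density 1 / ((l - 1) x). On its support s - x <= (l - 1) x, so x^(-(1 +
   q)) is at most (l - 1)^(1 + q) |s - x|^(-(1 + q)). *)
pose C1 := (l - 1)^-1 * (l - 1) `^ (1 + q).
have C10 : 0 <= C1 by rewrite mulr_ge0 ?invr_ge0 ?powR_ge0// ltW.
pose C2 := (T / l) `^ (- q).
have C20 : 0 <= C2 by rewrite powR_ge0.
exists (2 * (C2 + 2 `^ p * C1)).
  by rewrite mulr_ge0// addr_ge0// mulr_ge0// ltW.
move=> f M mf sf bf.
have mW : measurable_fun [set: R * R] W.
  have m1 := @measurable_kern_aff R 1 (-1) 1 0; have m2 := measurable_kern_aff 1 l (-1) 0.
  have m3 := measurable_kern_aff 0 (l - 1) 0 0; have m4 := measurable_kern_aff 1 0 (-1) T.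
  have m12 := measurable_funM m1 m2; have m34 := measurable_funM m3 m4.
  have := measurable_funM m12 m34.
  apply: eq_measurable_fun => z _.
  by rewrite /W /= !mul0r !mul1r !addr0 !mulN1r add0r [- z.1 + _]addrC [- z.2 + T]addrC mulrA.
have hab := @hardy_absorb R T p b W C1 C2 (l `^ q / (q * (l - 1))) f T0 p1 b0 mf sf mW.
have S0 : (0 <= Slobodecki T p b f)%E.
  by apply: integral_ge0 => x _; apply: integral_ge0 => s _; rewrite lee_fin divr_ge0 ?powR_ge0.
rewrite EFinM -muleA.
apply: (@le_trans _ _ (2%:E * (C2%:E * Lpow p f + (2 `^ p * C1)%:E * Slobodecki T p b f))%E); last first.
  apply: lee_wpmul2l; first by rewrite lee_fin.
  have h1 : 0 <= 2 `^ p * C1 by rewrite mulr_ge0// ltW.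
  rewrite (ge0_muleDr _ (Lpow_ge0 _ _) S0); apply: leeD.
    by apply: lee_wpmul2r; [exact: Lpow_ge0|rewrite lee_fin lerDl].
  by apply: lee_wpmul2r; rewrite ?lee_fin ?lerDr.
apply: hab.
- by move=> z; rewrite !mulr_ge0 ?kern_ge0.
- exact: C10.
- exact: C20.
- exact: divr_ge0 (powR_ge0 _ _) (mulr_ge0 (ltW q0) (ltW l10)).
- move=> x s /andP[x0 xT] sT; rewrite /W/= !kern1 !subr_gt0.
  have [xs|xs] := ltP x s; last by rewrite !mul0r.
  have [sT'|sT'] := ltP s T; last by rewrite mulr0.
  by move: sT; rewrite (lt_trans x0 xs) sT'.
- move=> x /andP[x0 xT].
  have [xl|xl] := leP T (l * x).
    left; rewrite /C2 -/q !powRN lef_pV2 ?posrE ?powR_gt0 ?divr_gt0//.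
    apply: (ge0_ler_powR (ltW q0)); rewrite ?nnegrE ?divr_ge0 ?(ltW T0) ?(ltW l0) ?(ltW x0)//.
    by rewrite ler_pdivrMr// mulrC.
  right; rewrite /W/=.
  have lx0 : 0 < (l - 1) * x by rewrite mulr_gt0.
  have xlx : x <= l * x by rewrite ler_peMl// ltW.
  under eq_integral => s _.
    rewrite (_ : _ * _ = kern 0 ((l - 1) * x) * (kern 1 (s - x) * kern 1 (l * x - s))); first over.
    rewrite !kern1 !subr_gt0; have [sl|sl] := ltP s (l * x); last by rewrite !mulr0 !mul0r.
    by rewrite (lt_trans sl xl) mulr1 mulrC.
  rewrite ge0_integral_EFinZl ?kern_ge0//; last 2 first.
  + exact: (measurable_funM (measurable_subr x (measurable_kern 1)) (measurable_subl (l * x) (measurable_kern 1))).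
  + by move=> s; rewrite mulr_ge0 ?kern_ge0.
  rewrite (integral_kern1_window xlx) /kern lx0 sub0r powRN powRr1 ?(ltW lx0)//.
  by rewrite -EFinM (_ : l * x - x = (l - 1) * x) ?mulVf ?gt_eqF//; ring.
- move=> x s /andP[x0 xT] /andP[s0 sT]; rewrite /W/= !kern1 !subr_gt0 sT mulr1.
  have rhs0 : 0 <= C1 * `|s - x| `^ (- (1 + q)) by rewrite mulr_ge0 ?powR_ge0.
  have [xs|xs] := ltP x s; last by rewrite !mul0r mulr0.
  have [sl|sl] := ltP s (l * x); last by rewrite mulr0 mul0r mulr0.
  have lx0 : 0 < (l - 1) * x by rewrite mulr_gt0.
  rewrite !mul1r /kern lx0 sub0r (powRM _ (ltW l10) (ltW x0)) powR_inv1 ?(ltW l10)//.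
  rewrite mulrCA /C1 -mulrA ler_wpM2l ?invr_ge0 ?(ltW l10)// -gt0_powRD// -opprD [q + 1]addrC.
  rewrite gtr0_norm ?subr_gt0// -/q.
  have -> : x `^ (- (1 + q)) = (l - 1) `^ (1 + q) * ((l - 1) * x) `^ (- (1 + q)).
    by rewrite powRM ?(ltW l10) ?(ltW x0)// mulrA -gt0_powRD// subrr powRr0 mul1r.
  apply: ler_wpM2l; first exact: powR_ge0.
  rewrite !powRN lef_pV2 ?posrE ?powR_gt0 ?subr_gt0//.
  have sxl : s - x <= (l - 1) * x by rewrite mulrBl mul1r lerB// ltW.
  have q1' : 0 <= 1 + q by rewrite addr_ge0 ?(ltW q0).
  by apply: (ge0_ler_powR q1' _ _ sxl); rewrite nnegrE ?subr_ge0 ltW.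
- move=> s /andP[s0 sT]; have sl0 : 0 < s / l by rewrite divr_gt0.
  have sl1 : s / l <= s by rewrite ler_pdivrMr// ler_peMr ?(ltW s0)// ltW.
  have li0 : 0 <= (l - 1)^-1 by rewrite invr_ge0 ltW.
  have mp : measurable_fun [set: R] ((fun z : R => z `^ (- q - 1)) \_ `](s / l), s[).
    by apply: measurable_restrict_itv => //; exact: measurable_powR.
  have rp z : 0 <= ((fun z : R => z `^ (- q - 1)) \_ `](s / l), s[) z.
    by apply: restrict_ge0 => y; rewrite powR_ge0.
  apply: (@le_trans _ _ ((l - 1)^-1%:E * (((s / l) `^ (- q)) / q)%:E)%E); last first.
    rewrite -EFinM lee_fin powRM ?invr_ge0 ?(ltW l0) ?(ltW s0)//.
    rewrite (_ : l^-1 `^ (- q) = l `^ q); last by rewrite -(powR_inv1 (ltW l0)) -powRrM mulN1r opprK.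
    rewrite -/q (invfM q (l - 1)); move: (l - 1)^-1 (l `^ q) (s `^ (- q)) (q^-1) => a1 a2 a3 a4.
    by rewrite le_eqVlt; apply/orP; left; apply/eqP; ring.
  apply: le_trans (lee_wpmul2l _ (integral_powRN_le q0 sl0 sl1)); last by rewrite lee_fin.
  rewrite -ge0_integral_EFinZl//.
  apply: ge0_le_integral_EFin.
  + apply: measurable_cut; apply: (measurable_funM (measurable_powR _)).
    exact: (measurable_fst_slice s mW).
  + by move=> x; rewrite cutE; case: ifP => // _; rewrite !mulr_ge0 ?kern_ge0 ?powR_ge0.
  + exact: (measurable_funM (measurable_cst _) mp).
  + move=> x; rewrite cutE; case: ifPn => [/andP[x0 xT]|_]; last by rewrite mulr_ge0.
    rewrite /W/= !kern1 !subr_gt0 sT mulr1.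
    have lx0 : 0 < (l - 1) * x by rewrite mulr_gt0.
    have [xs|xs] := ltP x s; last by rewrite !mul0r mulr0 mulr_ge0.
    have [sl|sl] := ltP s (l * x); last by rewrite mulr0 mul0r mulr0 mulr_ge0.
    rewrite !mul1r patchE mem_set/=; last by rewrite in_itv/= ltr_pdivrMr// mulrC sl.
    rewrite /kern lx0 sub0r (powRM _ (ltW l10) (ltW x0)) powR_inv1 ?(ltW l10)//.
    by rewrite mulrCA ler_wpM2l// -gt0_powRD.
- have h : l `^ q * (4 * 2 `^ p / q) <= l.
    apply: (@le_trans _ _ (l `^ q * l `^ (1 - q))).
      by rewrite ler_wpM2l ?powR_ge0// lq lerDl.
    by rewrite -gt0_powRD// addrC subrK powRr1// ltW.
  rewrite mulrA ler_pdivrMr ?mulr_gt0//.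
  have h2 : l `^ q * (4 * 2 `^ p) <= l * q by rewrite -ler_pdivrMr// -mulrA.
  have h3 : 0 <= q * (l - 2) by rewrite mulr_ge0 ?subr_ge0 ?(ltW q0).
  have : 4 * (2 `^ p * l `^ q) <= l * q by apply: le_trans h2; rewrite le_eqVlt; apply/orP; left; apply/eqP; ring.
  nra.
- apply: (hardy_fun_fin (M := M)) => //; rewrite (ltW q0)/=.
  by rewrite /q ler_piMl ?(ltW b1)// ltW.
Qed.

End hardy_lt.

(** * Hardy's inequality with a loss of order *)

Section marchaud_bound.
Context {R : realType}.
Notation mu := (@lebesgue_measure R).
Implicit Types (T p q b theta x y s t : R) (f g : R -> R).

Lemma Slobodecki_ge0 T p theta f : (0 <= Slobodecki T p theta f)%E.
Proof.
by apply: integral_ge0 => x _; apply: integral_ge0 => s _; rewrite lee_fin divr_ge0 ?powR_ge0.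
Qed.

Lemma measurable_slob_inner T p theta f : measurable_fun [set: R] f ->
  measurable_fun [set: R] (fun x => \int[mu]_s (slob_fun T p theta f (x, s))%:E)%E.
Proof.
move=> mf; have ms := measurable_slob_fun T p theta mf.
have mEs : measurable_fun [set: R * R] (EFin \o slob_fun T p theta f) by exact/measurable_EFinP.
have Es0 z : (0 <= (EFin \o slob_fun T p theta f) z)%E by rewrite /= lee_fin slob_fun_ge0.
exact: (@measurable_fun_fubini_tonelli_F _ _ _ _ _ mu (EFin \o slob_fun T p theta f) mEs Es0).
Qed.

Lemma slob_inner_ge0 T p theta f x : (0 <= \int[mu]_s (slob_fun T p theta f (x, s))%:E)%E.
Proof. by apply: integral_ge0 => s _; rewrite lee_fin slob_fun_ge0. Qed.

(** Distances within []0, T[] are below [T], so lowering the exponent of the denominator costs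
    T^((theta - b) p). *)
Lemma Slobodecki_le T p b theta f : 0 < T -> 1 <= p -> b <= theta ->
  measurable_fun [set: R] f ->
  (Slobodecki T p b f <= (T `^ ((theta - b) * p))%:E * Slobodecki T p theta f)%E.
Proof.
move=> T0 p1 bt mf; have p0 : 0 < p by exact: lt_le_trans p1.
rewrite !SlobodeckiE//.
rewrite -(ge0_integralZl mu measurableT (measurable_slob_inner T p theta mf)
  (fun x _ => slob_inner_ge0 T p theta f x)); last by rewrite lee_fin powR_ge0.
apply: ge0_le_integral.
- exact: measurableT.
- by move=> x _; exact: slob_inner_ge0.
- exact: measurable_slob_inner.
- by apply: measurable_funeM; exact: measurable_slob_inner.
move=> x _; have ms a := measurable_fun_pair2 x (measurable_slob_fun T p a mf).
have s0 a s := slob_fun_ge0 T p a f (x, s).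
rewrite -(ge0_integral_EFinZl (powR_ge0 _ _) (ms theta) (s0 theta)).
apply: ge0_le_integral_EFin.
- exact: ms.
- exact: s0.
- exact: (measurable_funM (measurable_cst _) (ms theta)).
- move=> s; rewrite /slob_fun/= !cutE; case: ifPn => xT; last by rewrite !mul0r mulr0.
  case: ifPn => sT; last by rewrite mulr0 !mul0r mulr0.
  rewrite /cst !mul1r mulrCA.
  have [->|sx] := eqVneq s x.
    by rewrite !subrr !normr0 (powR0 (lt0r_neq0 p0)) !mul0r.
  apply: ler_wpM2l; first exact: powR_ge0.
  have d0 : 0 < `|s - x| by rewrite normr_gt0 subr_eq0.
  rewrite [- (1 + b * p)](_ : _ = (theta - b) * p + - (1 + theta * p)); last by ring.
  rewrite gt0_powRD// ler_wpM2r ?powR_ge0//.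
  apply: ge0_ler_powR; rewrite ?nnegrE ?mulr_ge0 ?subr_ge0 ?(ltW p0) ?(ltW T0)//.
  by rewrite ler_norml; apply/andP; split; move/andP: xT; move/andP: sT; lra.
Qed.

(** If [b * p] is critical, the midpoint [a] of [b] and [theta] is not, and x^(-bp) <= T^((a - b) p)
    x^(-ap). The strict gap between [b] and [theta] makes room for [a]. *)
Lemma hardy T p b theta : 0 < T -> 1 <= p -> 0 < b < theta -> theta < 1 ->
  exists2 C, 0 <= C & forall f (M : R), measurable_fun [set: R] f ->
    (forall x, ~~ (0 < x < T) -> f x = 0) -> (forall x, 0 < x -> `|f x| <= M * x) ->
  (\int[mu]_x (hardy_fun T p (b * p) f x)%:E <=
    C%:E * (Lpow p f + Slobodecki T p theta f))%E.
Proof.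
move=> T0 p1 /andP[b0 bt] t1; have p0 : 0 < p by exact: lt_le_trans p1.
have key a : b <= a -> a < theta -> a * p != 1 ->
  exists2 C, 0 <= C & forall f (M : R), measurable_fun [set: R] f ->
    (forall x, ~~ (0 < x < T) -> f x = 0) -> (forall x, 0 < x -> `|f x| <= M * x) ->
  (\int[mu]_x (hardy_fun T p (a * p) f x)%:E <=
    C%:E * (Lpow p f + Slobodecki T p theta f))%E.
  move=> ba at' ap1.
  have a01 : 0 < a < 1 by rewrite (lt_le_trans b0 ba) (lt_trans at' t1).
  have [C C0 hC] : exists2 C, 0 <= C & forall f (M : R), measurable_fun [set: R] f ->
      (forall x, ~~ (0 < x < T) -> f x = 0) -> (forall x, 0 < x -> `|f x| <= M * x) ->
      (\int[mu]_x (hardy_fun T p (a * p) f x)%:E <= C%:E * (Lpow p f + Slobodecki T p a f))%E.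
    by move: ap1; rewrite neq_lt => /orP[h|h]; [exact: hardy_lt1|exact: hardy_gt1].
  pose K := T `^ ((theta - a) * p); have K0 : 0 <= K by exact: powR_ge0.
  exists (C * (1 + K)); first by rewrite mulr_ge0// addr_ge0.
  move=> f M mf sf bf; apply: (le_trans (hC f M mf sf bf)).
  rewrite EFinM -muleA; apply: lee_wpmul2l; first by rewrite lee_fin.
  have L0 := Lpow_ge0 p f; have S0 := Slobodecki_ge0 T p theta f.
  rewrite (ge0_muleDr _ L0 S0); apply: leeD.
    by rewrite -[leLHS]mul1e; apply: lee_wpmul2r => //; rewrite lee_fin lerDl.
  apply: (le_trans (Slobodecki_le T0 p1 (ltW at') mf)).
  by apply: lee_wpmul2r => //; rewrite lee_fin lerDr.
have [bp1|bp1] := eqVneq (b * p) 1; last exact: key.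
pose a := (b + theta) / 2; have ba : b < a by rewrite /a; lra.
have [|||C C0 hC] := key a; [exact: ltW|by rewrite /a; lra|by rewrite -bp1 gt_eqF// ltr_pM2r|].
pose K := T `^ ((a - b) * p); have K0 : 0 <= K by exact: powR_ge0.
exists (K * C); first exact: mulr_ge0.
move=> f M mf sf bf; rewrite EFinM -muleA.
apply: (le_trans _ (lee_wpmul2l _ (hC f M mf sf bf))); last by rewrite lee_fin.
have mh a' := measurable_hardy_fun T p a' mf.
rewrite -(ge0_integral_EFinZl K0 (mh _) (hardy_fun_ge0 T p (a * p) f)).
apply: ge0_le_integral_EFin (mh _) (hardy_fun_ge0 T p (b * p) f) _ _.
  exact: (measurable_funM (measurable_cst _) (mh _)).
move=> x; rewrite /hardy_fun !cutE; case: ifPn => [/andP[x0 xT]|_]; last by rewrite mulr0.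
rewrite mulrA ler_wpM2r ?powR_ge0//.
rewrite [- (b * p)](_ : _ = (a - b) * p + - (a * p)); last by ring.
rewrite gt0_powRD// ler_wpM2r ?powR_ge0//.
apply: ge0_ler_powR; rewrite ?nnegrE ?(ltW x0) ?(ltW T0) ?(ltW xT)//.
by rewrite mulr_ge0 ?(ltW p0)// subr_ge0 ltW.
Qed.

End marchaud_bound.

(** * The a priori estimate for a fractional derivative *)

Section lower_bound.
Context {R : realType}.
Notation mu := (@lebesgue_measure R).
Implicit Types (T p q b theta x y s t : R) (f g : R -> R).

(** Marchaud's kernel is factored as (t - s)^(d - 1) (t - s)^(- theta) with d = theta - b. The first
    factor, of mass at most T^d / d, is the weight for [weighted_jensen]; the second is raised to
    the power [p] together with the increment. *)
Lemma marchaud_powR T p b theta g (M t : R) : 0 < T -> 1 <= p -> 0 < b < theta -> theta < 1 ->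
  Lz T p g -> (forall x, `|g x| <= M) -> 0 < t < T ->
  ((`|J T (1 - b) g t| `^ p)%:E <=
    (2 `^ p)%:E * ((hardy_fun T p (b * p) (J T 1 g) t)%:E +
      (b `^ p * ((T `^ (theta - b) / (theta - b)) `^ (p - 1) * T `^ (theta - b)))%:E *
      \int[mu]_s (slob_fun T p theta (J T 1 g) (t, s))%:E))%E.
Proof.
move=> T0 p1 /andP[b0 bt] t1 hg bM tT; have p0 : 0 < p by exact: lt_le_trans p1.
have /andP[t0 tT'] := tT; have [mg sg _] := hg.
pose d := theta - b; have d0 : 0 < d by rewrite subr_gt0.
rewrite -/d (J_in _ _ tT).
have b01 : 0 < b < 1 by rewrite b0 (lt_trans bt t1).
have hm := marchaud T0 p1 b01 hg bM t0.
set f := J T 1 g.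
have ft : RI 1 g t = f t by rewrite /f J_in.
have mf : measurable_fun [set: R] f by apply: measurable_cut; exact: measurable_RI.
pose k s := kern 1 s * kern d (t - s).
pose G s := `|t - s| `^ (- theta) * `|f s - f t|.
have mk : measurable_fun [set: R] k.
  exact: (measurable_funM (measurable_kern 1) (measurable_subl t (measurable_kern d))).
have mD : measurable_fun [set: R] (fun s => f s - f t).
  exact: (measurable_funB mf (measurable_cst (f t))).
have mts : measurable_fun [set: R] (fun s : R => t - s).
  exact: (measurable_subl t (@measurable_id _ R _)).
have mG : measurable_fun [set: R] G.
  exact: (measurable_funM (measurable_normr_powR (- theta) mts)
     (measurableT_comp (@normr_measurable R _) mD)).
have k0 s : 0 <= k s by rewrite mulr_ge0 ?kern_ge0.
have G0 s : 0 <= G s by rewrite mulr_ge0 ?powR_ge0.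
have eI : (\int[mu]_s (kern 1 s * (kern (- b) (t - s) * `|RI 1 g s - RI 1 g t|))%:E =
    \int[mu]_s (k s * G s)%:E)%E.
  apply: eq_integral => s _; congr (_%:E); rewrite /k /G ft.
  have [s0|s0] := leP s 0; first by rewrite (kern_le0 1 s0) !mul0r.
  have [st|st] := leP t s.
    by rewrite (kern_le0 (- b)) ?(kern_le0 d) ?subr_le0// !mulr0 !mul0r mulr0.
  have ts0 : 0 < t - s by rewrite subr_gt0.
  rewrite /f (J_in 1 g (_ : 0 < s < T)) ?s0 ?(lt_trans st)//.
  rewrite /kern ts0 (gtr0_norm ts0) -mulrA [_ `^ (d - 1) * _]mulrA -gt0_powRD//.
  by rewrite (_ : d - 1 + - theta = - b - 1)// /d; ring.
rewrite {}eI ft in hm.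
pose A := T `^ d / d; have A0 : 0 < A by rewrite divr_gt0 ?powR_gt0.
have hA : (\int[mu]_s (k s)%:E <= A%:E)%E.
  have := kern_convolution t d0 (@ltr01 R).
  have -> : (\int[mu]_s (kern d (t - s) * kern 1 s)%:E = \int[mu]_s (k s)%:E)%E.
    by apply: eq_integral => s _; rewrite /k mulrC.
  have hb : (\int[mu]_s (k s)%:E <= \int[mu]_s ((fun s => (kern d \_ `]0, T[) s) (t - s))%:E)%E.
    apply: ge0_le_integral_EFin => //.
    - by apply: measurable_subl; apply: measurable_restrict_itv => //; exact: measurable_kern.
    - move=> s; rewrite /k kern1 patchE; have [s0|s0] := ltP 0 s; last first.
        by rewrite mul0r; case: ifP => // _; exact: kern_ge0.
      have [st|st] := leP t s.
        by rewrite (kern_le0 d) ?subr_le0// mulr0; case: ifP => // _; exact: kern_ge0.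
      rewrite mem_set/=; first by rewrite mul1r.
      by rewrite in_itv/= subr_gt0 st/=; lra.
  move=> _; apply: (le_trans hb).
  rewrite (@ge0_integral_subr _ t (fun s => ((kern d \_ `]0, T[) s)%:E)); last 2 first.
  - apply/measurable_EFinP; apply: measurable_restrict_itv => //; exact: measurable_kern.
  - by move=> s; rewrite lee_fin; apply: restrict_ge0 => y; exact: kern_ge0.
  rewrite integral_restrict_EFin// integral_kern ?(ltW T0)//.
  by rewrite powR0 ?gt_eqF// subr0.
have hj : ((\int[mu]_s (k s * G s)%:E) `^ p <=
    (A `^ (p - 1))%:E * \int[mu]_s (k s * G s `^ p)%:E)%E.
  by apply: weighted_jensen.
have hS : (\int[mu]_s (k s * G s `^ p)%:E <=
    (T `^ d)%:E * \int[mu]_s (slob_fun T p theta f (t, s))%:E)%E.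
  have ms := measurable_fun_pair2 t (measurable_slob_fun T p theta mf).
  have s0 s := slob_fun_ge0 T p theta f (t, s).
  rewrite -(ge0_integral_EFinZl (powR_ge0 _ _) ms s0).
  apply: ge0_le_integral_EFin.
  - have mGp : measurable_fun [set: R] (fun s => G s `^ p).
      by apply: (measurableT_comp (measurable_powR p)).
    exact: (measurable_funM mk mGp).
  - by move=> s; rewrite mulr_ge0 ?powR_ge0.
  - exact: (measurable_funM (measurable_cst _) ms).
  - move=> s; have rhs0 : 0 <= T `^ d * slob_fun T p theta f (t, s).
      by rewrite mulr_ge0 ?powR_ge0.
    rewrite /k kern1; have [sp|sp] := ltP 0 s; last by rewrite !mul0r.
    have [st|st] := leP t s; first by rewrite (kern_le0 d) ?subr_le0// mulr0 mul0r.
    have ts0 : 0 < t - s by rewrite subr_gt0.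
    have sT : 0 < s < T by rewrite sp (lt_trans st).
    rewrite /slob_fun/= (cut_in _ tT) (cut_in _ sT) /cst !mul1r.
    rewrite /G powRM ?powR_ge0// -powRrM [`|s - t|]distrC (gtr0_norm ts0) /kern ts0.
    (* The exponent of [slob_fun] is split off; the surplus (t - s)^d is at most T^d. *)
    have e1 : (t - s) `^ (d - 1) * (t - s) `^ (- theta * p) =
       (t - s) `^ d * (t - s) `^ (- (1 + theta * p)).
      by rewrite -!gt0_powRD//; congr (_ `^ _); ring.
    rewrite mulrA e1 -mulrA [_ * `|_| `^ p]mulrC ler_wpM2r ?mulr_ge0 ?powR_ge0//.
    by apply: ge0_ler_powR; rewrite ?nnegrE ?(ltW d0) ?(ltW ts0) ?(ltW T0)//; lra.
set X := (\int[mu]_s (k s * G s)%:E)%E in hm hj.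
have X0 : (0 <= X)%E by apply: integral_ge0 => s _; rewrite lee_fin mulr_ge0.
set S := (\int[mu]_s (slob_fun T p theta f (t, s))%:E)%E in hS *.
have hX : (X `^ p <= (A `^ (p - 1) * T `^ d)%:E * S)%E.
  apply: (le_trans hj); rewrite EFinM -muleA; apply: lee_wpmul2l hS.
  by rewrite lee_fin powR_ge0.
have hf : hardy_fun T p (b * p) f t = (t `^ (- b) * `|f t|) `^ p.
  by rewrite /hardy_fun (cut_in _ tT) powRM ?powR_ge0// -powRrM mulNr.
have c20 : 0 < 2 `^ p :> R by rewrite powR_gt0.
apply: (@le_trans _ _ ((2 `^ p)%:E * (((t `^ (- b) * `|f t|) `^ p)%:E + (b `^ p)%:E * X `^ p))%E); last first.
  apply: lee_wpmul2l; first by rewrite lee_fin ltW.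
  rewrite hf; apply: leeD => //; rewrite EFinM -muleA.
  by apply: lee_wpmul2l => //; rewrite lee_fin powR_ge0.
have bp0 : 0 < b `^ p by rewrite powR_gt0.
clear hX hS hj hA S; case: X X0 hm => [x||] //.
  move=> x0; rewrite lee_fin in x0; rewrite -EFinM -EFinD lee_fin => hm.
  rewrite poweR_EFin -(EFinM (b `^ p)) -EFinD -EFinM lee_fin -powRM ?(ltW b0)//.
  have h1 : `|RI (1 - b) g t| `^ p <= (t `^ (- b) * `|f t| + b * x) `^ p.
    apply: (ge0_ler_powR (ltW p0) _ _ hm); rewrite nnegrE//.
    by rewrite addr_ge0// mulr_ge0 ?powR_ge0// ltW.
  apply: (le_trans h1).
  have := normr_powRD (t `^ (- b) * `|f t|) (b * x) p1.
  have n1 : 0 <= t `^ (- b) * `|f t| by rewrite mulr_ge0 ?powR_ge0.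
  have n2 : 0 <= b * x by rewrite mulr_ge0// ltW.
  by rewrite (ger0_norm n1) (ger0_norm n2) ger0_norm// addr_ge0.
by move=> _ _; rewrite poweRyr ?gt_eqF// gt0_muley ?lte_fin// addey// gt0_muley ?lte_fin// leey.
Qed.

(* [J T (1 - b) g] is a derivative of order [b] of [J T 1 g]. *)
Lemma Lpow_frac_le T p b theta : 0 < T -> 1 <= p -> 0 < b < theta -> theta < 1 ->
  exists2 C, 0 <= C & forall g (M : R), Lz T p g -> (forall x, `|g x| <= M) ->
    (Lpow p (J T (1 - b) g) <= C%:E * (Lpow p (J T 1 g) + Slobodecki T p theta (J T 1 g)))%E.
Proof.
move=> T0 p1 bt t1; have p0 : 0 < p by exact: lt_le_trans p1.
have [C C0 hC] := hardy T0 p1 bt t1.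
set K := b `^ p * ((T `^ (theta - b) / (theta - b)) `^ (p - 1) * T `^ (theta - b)).
have K0 : 0 <= K.
  by apply: mulr_ge0; [exact: powR_ge0|apply: mulr_ge0; exact: powR_ge0].
have c20 : 0 <= 2 `^ p :> R by rewrite powR_ge0.
exists (2 `^ p * (C + K)); first by rewrite mulr_ge0// addr_ge0.
move=> g M hg bM; set f := J T 1 g.
have mf : measurable_fun [set: R] f.
  by apply: measurable_cut; apply: measurable_RI; have [] := hg.
have M0 : 0 <= M by apply: le_trans (bM 0).
(* Since f(0) = 0, the Lipschitz bound gives |f x| <= M x, which justifies the absorption; the
   constant [C] of [hardy] does not depend on [M]. *)
have hH : (\int[mu]_x (hardy_fun T p (b * p) f x)%:E <= C%:E * (Lpow p f + Slobodecki T p theta f))%E.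
  apply: (hC f M mf).
  - by move=> x xT; rewrite /f /J cut_out.
  - move=> x x0; rewrite /f /J cutE; case: ifP => [xT|_]; last by rewrite normr0 mulr_ge0// ltW.
    have := RI1_lipschitz T0 p1 hg bM (ltW x0).
    by rewrite subr0 [RI 1 g 0]RI_le0 ?subr0// => y; exact: Lz_le0 hg.
pose Ht t := (hardy_fun T p (b * p) f t)%:E.
pose St t := (\int[mu]_s (slob_fun T p theta f (t, s))%:E)%E.
have mH : measurable_fun [set: R] Ht by apply/measurable_EFinP; exact: measurable_hardy_fun.
have mS : measurable_fun [set: R] St by exact: measurable_slob_inner.
have H0 t : (0 <= Ht t)%E by rewrite lee_fin hardy_fun_ge0.
have S0 t : (0 <= St t)%E by exact: slob_inner_ge0.
have KS0 t : (0 <= K%:E * St t)%E by apply: mule_ge0; rewrite ?lee_fin.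
have mKS : measurable_fun [set: R] (fun t => K%:E * St t)%E by exact: measurable_funeM.
have HS0 t : (0 <= Ht t + K%:E * St t)%E by exact: adde_ge0.
have mHS : measurable_fun [set: R] (fun t => Ht t + K%:E * St t)%E by exact: emeasurable_funD.
apply: (@le_trans _ _ (\int[mu]_t ((2 `^ p)%:E * (Ht t + K%:E * St t)))%E).
  apply: ge0_le_integral.
  - exact: measurableT.
  - by move=> t _; rewrite lee_fin powR_ge0.
  - apply/measurable_EFinP; apply: measurable_normr_powR.
    by apply: measurable_cut; apply: measurable_RI; have [] := hg.
  - exact: measurable_funeM.
  - move=> t _; have [tT|tT] := boolP (0 < t < T).
      exact: (marchaud_powR T0 p1 bt t1 hg bM tT).
    rewrite {1}/J cut_out// normr0 powR0 ?gt_eqF//.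
    by apply: mule_ge0 (HS0 t); rewrite lee_fin.
rewrite (ge0_integralZl mu measurableT mHS (fun t _ => HS0 t)); last by rewrite lee_fin.
rewrite (EFinM (2 `^ p)) -muleA; apply: lee_wpmul2l; first by rewrite lee_fin.
rewrite (ge0_integralD mu measurableT (fun t _ => H0 t) mH (fun t _ => KS0 t) mKS).
rewrite (ge0_integralZl mu measurableT mS (fun t _ => S0 t)); last by rewrite lee_fin.
have L0 := Lpow_ge0 p f; have Sl0 := Slobodecki_ge0 T p theta f.
rewrite EFinD ge0_muleDl ?lee_fin//; apply: leeD; first exact: hH.
apply: lee_wpmul2l; first by rewrite lee_fin.
by rewrite -SlobodeckiE// leeDr.
Qed.

End lower_bound.

(** * Completeness of L^p along rapidly convergent sequences *)

Section completeness.
Context {R : realType}.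
Notation mu := (@lebesgue_measure R).
Implicit Types (T p : R).

Let r (i : nat) : R := 2^-1 ^+ i.

(** The sequences u n - 2 M 2^(-n) and u n + 2 M 2^(-n) are monotone and enclose the limit; 2 M
    2^(-n) is the sum of all increments allowed from [n] on. *)
Lemma geometric_limit (u : R^nat) (M : R) :
  (forall i, `|u i.+1 - u i| <= M * 2^-1 ^+ i) ->
  exists l, u @ \oo --> l /\ forall n, `|l - u n| <= 2 * M * 2^-1 ^+ n.
Proof.
move=> hu; rewrite -/(r _) in hu.
have rS i : r i.+1 = 2^-1 * r i by rewrite /r exprS.
have r0 i : 0 < r i by rewrite exprn_gt0.
have M0 : 0 <= M by have := le_trans (normr_ge0 _) (hu 0); rewrite mulr1.
pose a n := u n - 2 * M * r n; pose b n := u n + 2 * M * r n.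
have aS n : a n <= a n.+1.
  by have := hu n; rewrite ler_norml -/(r n) /a rS => /andP[h _]; lra.
have bS n : b n.+1 <= b n.
  by have := hu n; rewrite ler_norml -/(r n) /b rS => /andP[_ h]; lra.
have ma : nondecreasing_seq a by apply/nondecreasing_seqP.
have mb : nonincreasing_seq b by apply/nonincreasing_seqP.
have ab n : a n <= b n.
  have : 0 <= M * r n by rewrite mulr_ge0// ltW.
  by rewrite /a /b; lra.
have ca : cvgn a.
  apply: nondecreasing_is_cvgn => //; exists (b 0%N) => _ [n _ <-].
  by apply: (le_trans (ab n)); apply: mb.
exists (limn a); split.
  have -> : u = a \+ (fun n => 2 * M * r n) by apply/funext => n; rewrite /a/= subrK.
  rewrite -[X in _ --> X]addr0; apply: cvgD => //.
  rewrite -(mulr0 (2 * M)); apply: cvgM; first exact: cvg_cst.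
  by apply: cvg_expr; rewrite ger0_norm ?invr_ge0// invf_lt1 ?ltr1n.
move=> n; rewrite ler_norml -/(r n).
have h1 : a n <= limn a by exact: nondecreasing_cvgn_le.
have h2 : limn a <= b n.
  apply: limr_le => //; near=> m; apply: (le_trans (ab m)); apply: mb.
  by near: m; exact: nbhs_infty_ge.
by move: h1 h2; rewrite /a /b; lra.
Unshelve. all: by end_near. Qed.

(* Along such a sequence the increments satisfy [|v_(i+1) - v_i| <= 2^-i * S^(1/p)]
   pointwise, where [S] is the integrable function
   [\sum_i (2^i)^p * |v_(i+1) - v_i|^p]. *)
Lemma Lpow_complete T p (v_ : nat -> R -> R) : 1 <= p -> (forall i, Lz T p (v_ i)) ->
  (forall i, (Lpow p (fun x => v_ i.+1 x - v_ i x)%R <=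
    ((2^-1 ^+ i) `^ p * 2^-1 ^+ i.+1)%R%:E)%E) ->
  exists2 v, Lz T p v & forall n,
    (Lpow p (fun x => v x - v_ n x)%R <= ((2 * 2^-1 ^+ n) `^ p)%:E)%E.
Proof.
move=> p1 hv hd; have p0 : 0 < p by exact: lt_le_trans p1.
have r0 i : 0 < r i by rewrite exprn_gt0.
have mv i : measurable_fun [set: R] (v_ i) by have [] := hv i.
pose d i x := `|v_ i.+1 x - v_ i x| `^ p.
have md i : measurable_fun [set: R] (d i).
  by apply: measurable_normr_powR; exact: (measurable_funB (mv _) (mv _)).
(* The weight is matched to the hypothesis: the integral of [F i] is at most 2^(-(i+1)), so that of
   [S] is at most 1. *)
pose F i x : \bar R := (((r i) `^ p)^-1 * d i x)%:E.
have mF i : measurable_fun [set: R] (F i).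
  by apply/measurable_EFinP; exact: (measurable_funM (measurable_cst _) (md i)).
have F0 i x : (0 <= F i x)%E by rewrite lee_fin mulr_ge0 ?invr_ge0 ?powR_ge0.
pose S x : \bar R := (\sum_(0 <= i <oo) F i x)%E.
have mS : measurable_fun [set: R] S by apply: ge0_emeasurable_sum => // k x _ _; exact: F0.
have S0 x : (0 <= S x)%E by apply: nneseries_ge0.
have iS : (\int[mu]_x S x <= 1)%E.
  rewrite (integral_nneseries mu measurableT mF (fun n x _ => F0 n x)).
  apply: (le_trans _ (@epsilon_trick0 R 1 xpredT ler01)); apply: lee_nneseries.
    by move=> i _ _; apply: integral_ge0 => x _; exact: F0.
  move=> i _; rewrite ge0_integral_EFinZl ?invr_ge0 ?powR_ge0//; last first.
    by move=> x; exact: powR_ge0.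
  apply: le_trans (lee_wpmul2l _ (hd i)) _; first by rewrite lee_fin invr_ge0 powR_ge0.
  rewrite -EFinM lee_fin mulrA mulVf ?gt_eqF ?powR_gt0//.
  by rewrite mul1r natrX exprVn mul1r.
(* An upper limit is measurable without knowing convergence; where [S] is finite it is the limit. *)
pose v x := fine (limn_esup (fun n => (v_ n x)%:E)).
have mvv : measurable_fun [set: R] v.
  apply: (measurableT_comp (fine_measurable measurableT)).
  by apply: measurable_fun_limn_esup => n; exact/measurable_EFinP.
have key x n : S x \is a fin_num ->
    (((`|v x - v_ n x|) `^ p)%:E <= ((2 * r n) `^ p)%:E * S x)%E.
  move=> Sfin; set s := fine (S x).
  have Ss : S x = s%:E by rewrite fineK.
  have s0 : 0 <= s by rewrite -lee_fin -Ss.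
  have hi i : `|v_ i.+1 x - v_ i x| <= s `^ p^-1 * r i.
    have h1 : (F i x <= S x)%E.
      have := nneseries_lim_ge i.+1 (P := xpredT) (m := 0) (u_ := F ^~ x) (fun n _ _ => F0 n x).
      apply: le_trans; rewrite big_nat_recr//= leeDr//.
      by apply: sume_ge0.
    rewrite Ss lee_fin ler_pdivrMl ?powR_gt0// in h1.
    have h2 : `|v_ i.+1 x - v_ i x| = (d i x) `^ p^-1.
      by rewrite /d -powRrM mulfV ?gt_eqF// powRr1.
    rewrite h2.
    have pi0 : 0 <= p^-1 by rewrite invr_ge0 ltW.
    apply: (le_trans (ge0_ler_powR pi0 _ _ h1)); rewrite ?nnegrE ?powR_ge0//.
      by rewrite mulr_ge0 ?powR_ge0.
    by rewrite powRM ?powR_ge0// -powRrM mulfV ?gt_eqF// powRr1 ?(ltW (r0 i))// mulrC.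
  have [l [cl hl]] := geometric_limit hi.
  have -> : v x = l.
    have cE : (fun n => (v_ n x)%:E) @ \oo --> l%:E by apply: cvg_EFin => //; exact: nearW.
    by rewrite /v (cvg_limn_einf_sup cE).2.
  rewrite Ss -EFinM lee_fin.
  apply: (le_trans (ge0_ler_powR (ltW p0) _ _ (hl n))); rewrite ?nnegrE//.
    by rewrite -mulrA mulr_ge0// mulr_ge0 ?powR_ge0// ltW.
  have -> : 2 * s `^ p^-1 * 2^-1 ^+ n = (2 * r n) * s `^ p^-1 by rewrite /r; ring.
  rewrite powRM ?powR_ge0 ?mulr_ge0 ?(ltW (r0 n))// -powRrM mulVf ?gt_eqF// powRr1//.
have Sae : {ae mu, forall x, S x \is a fin_num}.
  have iSS : mu.-integrable [set: R] S.
    apply/integrableP; split=> //; under eq_integral do rewrite gee0_abs//.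
    by apply: le_lt_trans iS _; rewrite ltry.
  by apply: aeS (integrable_ae measurableT iSS) => x; apply.
have hn n : (Lpow p (fun x => v x - v_ n x)%R <= ((2 * r n) `^ p)%:E)%E.
  apply: (@le_trans _ _ (\int[mu]_x (((2 * r n) `^ p)%:E * S x))%E).
    apply: ae_ge0_le_integral.
    - exact: measurableT.
    - by move=> x _; rewrite lee_fin powR_ge0.
    - apply/measurable_EFinP; apply: measurable_normr_powR.
      exact: (measurable_funB mvv (mv n)).
    - by move=> x _; apply: mule_ge0 => //; rewrite lee_fin powR_ge0.
    - exact: measurable_funeM.
    - by apply: aeS Sae => x hx _; exact: key.
  rewrite (ge0_integralZl mu measurableT mS (fun x _ => S0 x)); last by rewrite lee_fin powR_ge0.
  by rewrite -[leRHS]mule1; apply: lee_wpmul2l => //; rewrite lee_fin powR_ge0.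
exists v => //; split=> //.
- move=> x xT; rewrite /v (_ : (fun n => _) = cst 0%:E); last first.
    by apply/funext => n; have [_ -> //] := hv n.
  by rewrite (cvg_limn_einf_sup (@cvg_cst _ _ _ _ _)).2.
- have [_ _ f0] := hv 0%N.
  have := LpowD p1 (measurable_funB mvv (mv 0%N)) (mv 0%N).
  have -> : (fun x => (v \- v_ 0%N) x + v_ 0%N x) = v by apply/funext => x/=; rewrite subrK.
  move/le_lt_trans; apply; apply: lte_mul_pinfty; rewrite ?lee_fin ?powR_ge0//.
  by apply: lte_add_pinfty => //; apply: le_lt_trans (hn 0%N) _; rewrite ltry.
Qed.

End completeness.

(** * Smooth functions vanishing at 0 as iterated integrals *)

Section zero_C.
Context {R : realType}.
Notation mu := (@lebesgue_measure R).
Implicit Types (T p : R) (v h g : R -> R).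

(** The fundamental theorem of calculus with w j 0 = 0, applied [k] times. [h] is the [k]-th
    derivative cut to []0, T[], bounded by continuity on the compact [[0, T]]. *)
Lemma zero_C_J1 T k v : 0 < T -> zero_C T k v ->
  exists h (M : R), [/\ measurable_fun [set: R] h, (forall x, ~~ (0 < x < T) -> h x = 0),
    (forall x, `|h x| <= M) & cut T v = iter k (J T 1) h].
Proof.
move=> T0 [w [w0 wc wd wz]].
have mw j : (j <= k)%N -> measurable_fun [set: R] (cut T (w j)).
  move=> jk; apply/(measurable_restrictT _ _).1 => //.
  apply: (@measurable_funS _ _ _ _ `[0, T]) => //.
    by apply: subset_itv_oo_cc.
  apply: subspace_continuous_measurable_fun => //; exact: wc.
have wJ j : (j < k)%N -> cut T (w j) = J T 1 (cut T (w j.+1)).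
  move=> jk; apply/funext => t; rewrite /J !(cutE T _ t); case: ifPn => // /andP[t0 tT].
  have sub : `[0, t]%classic `<=` `[0, T]%classic.
    by apply: subset_itvl; rewrite bnd_simp ltW.
  have cj1 : {within `[0, t], continuous (w j.+1)}.
    exact: continuous_subspaceW sub (wc _ jk).
  have cj : {within `[0, t], continuous (w j)}.
    exact: continuous_subspaceW sub (wc _ (ltnW jk)).
  have [_ cl cr] := (continuous_within_itvP (w j) t0).1 cj.
  have inT s : s \in `]0, t[ -> s \in `]0, T[.
    by rewrite !in_itv/= => /andP[-> /lt_trans]; apply.
  have dd : derivable_oo_LRcontinuous (w j) 0 t.
    by split=> // s /inT st; have [] := wd j jk s st.
  have df : {in `]0, t[%R, (w j)^`()%classic =1 w j.+1}.
    by move=> s /inT st; rewrite derive1E; have hs := wd j jk s st; rewrite derive_val.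
  have h := continuous_FTC2 t0 cj1 dd df.
  rewrite (wz j jk) sube0 in h.
  have mo : measurable_fun `]0, t[ (EFin \o w j.+1).
    apply/measurable_EFinP; apply: (@measurable_funS _ _ _ _ `[0, t]) => //.
      exact: subset_itv_oo_cc.
    exact: subspace_continuous_measurable_fun.
  have e : (\int[mu]_s (kern 1 (t - s) * cut T (w j.+1) s)%:E = (w j t)%:E)%E.
    rewrite -h [in RHS](integral_itv_bndoo _ _ mo) [in RHS]integral_mkcond.
    apply: eq_integral => s _; rewrite patchE kern1 subr_gt0.
    rewrite (_ : (s \in `]0, t[%classic) = (0 < s < t)); last first.
      by apply/idP/idP; rewrite inE/= in_itv.
    rewrite cutE; have [st|st] := ltP s t; last by rewrite mul0r andbF.
    by rewrite mul1r (lt_trans st tT) andbT; case: ifP.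
  by rewrite /RI /Rintegral e.
have wi j : (j <= k)%N -> cut T (w 0%N) = iter j (J T 1) (cut T (w j)).
  elim: j => [//|j ih] jk; rewrite iterSr -wJ//; apply: ih; exact: ltnW.
have [c1 _ h1] := EVT_max (ltW T0) (wc k (leqnn k)).
have [c2 _ h2] := EVT_min (ltW T0) (wc k (leqnn k)).
exists (cut T (w k)), (`|w k c1| + `|w k c2|); split.
- exact: mw.
- by move=> x; exact: cut_out.
- move=> x; rewrite cutE; case: ifPn => [/andP[x0 xT]|_]; last by rewrite normr0 addr_ge0.
  have xi : x \in `[0, T] by rewrite in_itv/= !ltW.
  have a1 := h1 x xi; have a2 := h2 x xi.
  rewrite ler_norml; apply/andP; split.
    have := ler_norm (- w k c2); have := normr_ge0 (w k c1); rewrite normrN; lra.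
  have := ler_norm (w k c1); have := normr_ge0 (w k c2); lra.
- by rewrite -w0; exact: wi.
Qed.

Lemma J1_bounded T p h (M : R) : 0 < T -> 1 <= p -> Lz T p h -> (forall x, `|h x| <= M) ->
  forall x, `|J T 1 h x| <= M * T.
Proof.
move=> T0 p1 hh bh x; have M0 : 0 <= M by apply: le_trans (bh 0).
rewrite /J cutE; case: ifPn => [/andP[x0 xT]|_]; last by rewrite normr0 mulr_ge0// ltW.
have := RI1_lipschitz T0 p1 hh bh (ltW x0).
rewrite subr0 [RI 1 h 0]RI_le0 ?subr0//; last by move=> y; exact: Lz_le0 hh.
by move/le_trans; apply; rewrite ler_wpM2l// ltW.
Qed.

Lemma iter_J_Lz T p n h : 0 < T -> 1 <= p -> Lz T p h -> Lz T p (iter n (J T 1) h).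
Proof. by move=> T0 p1 hh; elim: n => [//|n ih]; apply: J_Lz. Qed.

Lemma iter_J1_bounded T p n h (M : R) : 0 < T -> 1 <= p -> Lz T p h ->
  (forall x, `|h x| <= M) -> exists M', forall x, `|iter n (J T 1) h x| <= M'.
Proof.
move=> T0 p1 hh bh; elim: n => [|n [M' ih]]; first by exists M.
by exists (M' * T) => x; apply: (J1_bounded T0 p1 _ ih); exact: iter_J_Lz.
Qed.

Lemma continuous_RI1 T p h (M : R) : 0 < T -> 1 <= p -> Lz T p h -> (forall x, `|h x| <= M) ->
  forall x, {for x, continuous (RI 1 h)}.
Proof.
move=> T0 p1 hh bh x; have M0 : 0 <= M by apply: le_trans (bh 0).
have lip a b : `|RI 1 h b - RI 1 h a| <= M * `|b - a|.
  have [ab|/ltW ba] := leP a b.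
    by rewrite [X in M * X]ger0_norm ?subr_ge0//; exact: (RI1_lipschitz T0 p1 hh bh ab).
  rewrite distrC [X in M * X]distrC [X in M * X]ger0_norm ?subr_ge0//.
  exact: (RI1_lipschitz T0 p1 hh bh ba).
apply/cvgrPdist_lt => e e0.
have M1 : 0 < M + 1 by rewrite ltr_wpDl.
have d0 : 0 < e / (M + 1) by rewrite divr_gt0.
have /cvgrPdist_lt/(_ _ d0) := @cvg_id _ (nbhs x).
apply: filterS => t xt; apply: (le_lt_trans (lip _ _)).
apply: (@le_lt_trans _ _ ((M + 1) * `|x - t|)); first by rewrite ler_wpM2r// lerDl.
by rewrite mulrC -ltr_pdivlMr.
Qed.

Lemma derive_RI1_continuous T p h (t : R) : 0 < T -> 1 <= p -> Lz T p h ->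
  {for t, continuous h} -> is_derive t (1 : R) (RI 1 h) (h t).
Proof.
move=> T0 p1 hh ch; have ih := Lz_integrable T0 p1 hh.
have -> : RI 1 h = fun t => \int[mu]_(s in `]-oo, t]) h s.
  by apply/funext => x; exact: RI1E hh.
have tt : t < t + 1 by rewrite ltrDl.
have iu : mu.-integrable [set` Interval -oo%O (BRight (t + 1))] (EFin \o h).
  exact: integrableS ih.
case: (continuous_FTC1 tt iu _ ch) => [|d1 d2]; first by rewrite ltNyr.
by have := derivableP d1; rewrite -derive1E d2.
Qed.

(** The integration beyond the [k]-th makes the [k]-th derivative continuous. The derivatives are
    written with [RI 1] instead of [J T 1], so that they remain continuous at [T] rather than being
    cut to 0 there. *)
Lemma J1_zero_C T p k h (M : R) : 0 < T -> 1 <= p -> Lz T p h -> (forall x, `|h x| <= M) ->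
  exists2 z, zero_C T k z & cut T z = iter k.+1 (J T 1) h.
Proof.
move=> T0 p1 hh bh; pose g j := iter (k - j) (J T 1) h; pose w j := RI 1 (g j).
have hg j : Lz T p (g j) by exact: iter_J_Lz.
have cw j x : {for x, continuous (w j)}.
  have [M' bM'] := iter_J1_bounded (k - j) T0 p1 hh bh.
  exact: (continuous_RI1 T0 p1 (hg j) bM').
exists (w 0%N); last by rewrite /w /g subn0.
exists w; split => //.
- by move=> j _; apply: continuous_subspaceT => x; exact: cw.
- move=> j jk t; rewrite in_itv/= => tT.
  have gE : g j = J T 1 (g j.+1) by rewrite /g -(subnSK jk).
  have wt : w j.+1 t = g j t by rewrite gE J_in.
  rewrite wt; apply: (derive_RI1_continuous T0 p1 (hg j)).
  have c : w j.+1 x @[x --> t] --> w j.+1 t by exact: cw.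
  rewrite wt in c; apply: cvg_trans c; apply: near_eq_cvg.
  have := @near_in_itvoo R 0 T t; rewrite in_itv/= => /(_ tT).
  by apply: filterS => s; rewrite in_itv/= => sT; rewrite gE J_in.
- by move=> j _; rewrite /w RI_le0// => x; exact: Lz_le0 (hg j).
Qed.

Lemma zero_CB T k v w : zero_C T k v -> zero_C T k w -> zero_C T k (v \- w).
Proof.
move=> [a [a0 ac ad az]] [b [b0 bc bd bz]]; exists (fun j => a j \- b j); split.
- by rewrite a0 b0.
- by move=> j jk x; apply: cvgB; [exact: ac|exact: bc].
- by move=> j jk t tT; have h1 := ad j jk t tT; have h2 := bd j jk t tT; exact: is_deriveB.
- by move=> j jk; rewrite /= az// bz// subrr.
Qed.

End zero_C.

(** * Weak derivatives of zero extensions *)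

Section weak_derivatives.
Context {R : realType}.
Notation mu := (@lebesgue_measure R).
Local Notation "f =ae g" := (ae_eq mu [set: R] f g) (at level 70).
Implicit Types (T p s c : R) (u v w f g h phi : R -> R) (d : nat -> R -> R) (j n : nat).

Lemma Lp_normE T p u : 0 < p -> Lp_norm T p u = (Lpow p (cut T u) `^ p^-1)%E.
Proof.
by move=> p0; rewrite /Lp_norm unlock.
Qed.

Lemma LpP T p u : 0 < p -> Lp T p u <-> Lz T p (cut T u).
Proof.
move=> p0; rewrite /Lp /Lz/= inE; split.
- move=> /andP[mf ff]; split; first by move: mf; rewrite inE.
    by move=> x; exact: cut_out.
  move: ff; rewrite inE /finite_norm/= unlock => /lty_poweRy; rewrite invr_eq0 gt_eqF// => /(_ isT).
  by [].
- move=> [mf _ ff]; apply/andP; split; first by rewrite inE.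
  by rewrite inE /finite_norm/= unlock poweR_lty.
Qed.

Lemma Lz_Lp T p v : 0 < p -> Lz T p v -> Lp T p v.
Proof. by move=> p0 hv; apply: (LpP T v p0).2; rewrite (cut_id hv). Qed.

Lemma ae_onP T u v : ae_on T u v <-> cut T u =ae cut T v.
Proof.
split; apply: aeS => x h.
  by move=> _; rewrite !cutE; case: ifPn => // xT; apply: h; rewrite /= in_itv.
by rewrite /= in_itv/= => xT; have := h I; rewrite !cut_in.
Qed.

Definition wd T j f g := forall phi, test_function T phi ->
  \int[mu]_x (f x * derive1n j phi x) = (-1) ^+ j * \int[mu]_x (g x * phi x).

Lemma Rintegral_cut T f g :
  \int[mu]_(x in `]0, T[) (f x * g x) = \int[mu]_x (cut T f x * g x).
Proof.
rewrite Rintegral_mkcond; apply: eq_Rintegral => x _.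
rewrite cutE patchE (_ : (x \in _) = (0 < x < T)); last by apply/idP/idP; rewrite inE/= in_itv.
by case: ifP => //; rewrite mul0r.
Qed.

Lemma weak_derivE T j u v : is_weak_deriv T j u v <-> wd T j (cut T u) (cut T v).
Proof. by split=> h phi tphi; have := h phi tphi; rewrite !Rintegral_cut. Qed.

Lemma test_function_deriven T n phi : test_function T phi -> test_function T (derive1n n phi).
Proof. by move=> h; elim: n => [//|n ih]; rewrite derive1nS; exact: test_function_derive. Qed.

Lemma integrable_test T p f phi : 0 < T -> 1 <= p -> Lz T p f -> test_function T phi ->
  mu.-integrable [set: R] (EFin \o (fun x => f x * phi x)).
Proof.
move=> T0 p1 hf tphi; have iff := Lz_integrable T0 p1 hf; have [mf _ _] := hf.
have [M M0 bM] := test_function_bounded tphi; have mphi := test_function_measurable tphi.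
have iM : mu.-integrable [set: R] (EFin \o (fun x => M * f x)).
  by have := integrableZl measurableT M iff; apply: eq_integrable.
apply: (le_integrable measurableT _ _ iM).
  by apply/measurable_EFinP; exact: (measurable_funM mf mphi).
move=> x _; rewrite /= lee_fin !normrM mulrC (ger0_norm M0).
by apply: ler_wpM2r.
Qed.

Lemma wd0 T f : wd T 0 f f.
Proof. by move=> phi _; rewrite expr0 mul1r. Qed.

Lemma Rintegral_ae f g phi : measurable_fun [set: R] f -> measurable_fun [set: R] g ->
  measurable_fun [set: R] phi -> f =ae g ->
  \int[mu]_x (f x * phi x) = \int[mu]_x (g x * phi x).
Proof.
move=> mf mg mphi fg; congr fine; apply: ae_eq_integral.
- exact: measurableT.
- by apply/measurable_EFinP; exact: (measurable_funM mf mphi).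
- by apply/measurable_EFinP; exact: (measurable_funM mg mphi).
- by apply: aeS fg => x h _; rewrite h.
Qed.

Lemma wd_ae T p j f f' g g' : Lz T p f -> Lz T p f' -> Lz T p g -> Lz T p g' ->
  f =ae f' -> g =ae g' -> wd T j f g -> wd T j f' g'.
Proof.
move=> [mf _ _] [mf' _ _] [mg _ _] [mg' _ _] ff gg h phi tphi.
have m1 := test_function_measurable tphi.
have m2 := test_function_measurable (test_function_deriven j tphi).
by rewrite -(Rintegral_ae mf mf' m2 ff) -(Rintegral_ae mg mg' m1 gg); exact: h.
Qed.

Lemma wdB T p j f f' g g' : 0 < T -> 1 <= p -> Lz T p f -> Lz T p f' -> Lz T p g -> Lz T p g' ->
  wd T j f g -> wd T j f' g' -> wd T j (fun x => f x - f' x) (fun x => g x - g' x).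
Proof.
move=> T0 p1 hf hf' hg hg' h h' phi tphi; have tj := test_function_deriven j tphi.
have i1 := integrable_test T0 p1 hf tj; have i2 := integrable_test T0 p1 hf' tj.
have i3 := integrable_test T0 p1 hg tphi; have i4 := integrable_test T0 p1 hg' tphi.
under eq_Rintegral do rewrite mulrBl; rewrite (RintegralB measurableT i1 i2).
under [in RHS]eq_Rintegral do rewrite mulrBl; rewrite (RintegralB measurableT i3 i4).
by rewrite mulrBr h// h'.
Qed.

Lemma wdZ T p j c f g : 0 < T -> 1 <= p -> Lz T p f -> Lz T p g ->
  wd T j f g -> wd T j (fun x => c * f x) (fun x => c * g x).
Proof.
move=> T0 p1 hf hg h phi tphi; have tj := test_function_deriven j tphi.
have i1 := integrable_test T0 p1 hf tj; have i3 := integrable_test T0 p1 hg tphi.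
under eq_Rintegral do rewrite -mulrA; rewrite (RintegralZl c measurableT i1).
under [in RHS]eq_Rintegral do rewrite -mulrA; rewrite (RintegralZl c measurableT i3).
by rewrite h// mulrCA.
Qed.

Lemma wd_unique T p j f g g' : 0 < T -> 1 <= p -> Lz T p g -> Lz T p g' ->
  wd T j f g -> wd T j f g' -> g =ae g'.
Proof.
move=> T0 p1 hg hg' h h'.
have : (fun x => g x - g' x) =ae cst 0.
  apply: (test_function_ae0 T0 p1 (LzB p1 hg hg')) => phi tphi.
  rewrite Rintegral_cut (cut_id (LzB p1 hg hg')).
  have i3 := integrable_test T0 p1 hg tphi; have i4 := integrable_test T0 p1 hg' tphi.
  under eq_Rintegral do rewrite mulrBl; rewrite (RintegralB measurableT i3 i4).
  have := h phi tphi; rewrite h'// => /mulfI -> //; last by rewrite signr_eq0.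
  by rewrite subrr.
by apply: aeS => x /(_ I)/eqP; rewrite subr_eq0 => /eqP.
Qed.

(** By induction: [weak_deriv_J1] takes one derivative off the test function and removes the
    outermost [J T 1]. *)
Lemma wd_iter T p j h : 0 < T -> 1 <= p -> Lz T p h -> wd T j (iter j (J T 1) h) h.
Proof.
move=> T0 p1 hh; elim: j => [|j ih] phi tphi; first by rewrite expr0 mul1r.
have tj := test_function_deriven j tphi; have hj := iter_J_Lz j T0 p1 hh.
rewrite iterS derive1nS -(cut_id (J_Lz T0 ltr01 p1 hj)) -Rintegral_cut.
rewrite (weak_deriv_J1 T0 p1 hj tj) Rintegral_cut (cut_id hj) ih// exprS mulN1r mulNr.
by [].
Qed.

(** [weak_deriv] is picked by [get] and determined only almost everywhere. A family [d] supplies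
    convenient representatives, such as iterated integrals, on which Sobolev norms can be
    computed. *)
Definition wfam T p n u d := Lz T p (cut T u) /\
  forall j, (j <= n)%N -> Lz T p (d j) /\ wd T j (cut T u) (d j).

Lemma wfam_unique T p n u d j : 0 < T -> 1 <= p -> wfam T p n u d -> (j <= n)%N ->
  Lz T p (cut T (weak_deriv T p j u)) /\ cut T (weak_deriv T p j u) =ae d j.
Proof.
move=> T0 p1 [hu hd] jn; have p0 : 0 < p by exact: lt_le_trans p1.
have [hdj wdj] := hd j jn.
have [h1 h2] : Lz T p (cut T (weak_deriv T p j u)) /\
    wd T j (cut T u) (cut T (weak_deriv T p j u)).
  case: j jn hdj wdj => [|j] jn hdj wdj; first by split=> //; exact: wd0.
  have hex : exists v, Lp T p v /\ is_weak_deriv T j.+1 u v.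
    exists (d j.+1); split; first exact: Lz_Lp p0 hdj.
    by apply: (weak_derivE T j.+1 u (d j.+1)).2; rewrite (cut_id hdj).
  have [a b] := getPex hex.
  by split; [exact: (LpP T _ p0).1 a|exact: (weak_derivE T j.+1 u _).1 b].
by split=> //; exact: (wd_unique T0 p1 h1 hdj h2 wdj).
Qed.

Lemma wfam_Sobolev_nat T p n u d : 0 < T -> 1 <= p -> wfam T p n u d -> Sobolev_nat T p n u.
Proof.
move=> T0 p1 [hu hd]; have p0 : 0 < p by exact: lt_le_trans p1.
split; first exact: (LpP T u p0).2.
move=> j /andP[_ jn]; have [hdj wdj] := hd j jn; exists (d j).
  exact: Lz_Lp p0 hdj.
by apply: (weak_derivE T j u (d j)).2; rewrite (cut_id hdj).
Qed.

Lemma Sobolev_nat_wfam T p n u : 0 < T -> 1 <= p -> Sobolev_nat T p n u ->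
  exists d, wfam T p n u d.
Proof.
move=> T0 p1 [hu hd]; have p0 : 0 < p by exact: lt_le_trans p1.
have hu' : Lz T p (cut T u) by exact: (LpP T u p0).1.
have hex j : (j <= n)%N -> exists v, Lz T p v /\ wd T j (cut T u) v.
  case: j => [_|j jn]; first by exists (cut T u); split => //; exact: wd0.
  have [v hv wv] := hd j.+1 jn; exists (cut T v); split; first exact: (LpP T v p0).1.
  exact: (weak_derivE T j.+1 u v).1.
exists (fun j => get [set v | Lz T p v /\ wd T j (cut T u) v]); split; first exact: hu'.
move=> j jn; exact: (getPex (hex j jn)).
Qed.

Lemma wfamB T p n u v d e : 0 < T -> 1 <= p -> wfam T p n u d -> wfam T p n v e ->
  wfam T p n (u \- v) (fun j x => d j x - e j x).
Proof.
move=> T0 p1 [hu hd] [hv he].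
have cB : cut T (u \- v) = fun x => cut T u x - cut T v x.
  by apply/funext => x; rewrite !cutE; case: ifP => //; rewrite subrr.
split; first by rewrite cB; exact: LzB.
move=> j jn; have [a b] := hd j jn; have [a' b'] := he j jn.
by rewrite cB; split; [exact: LzB|exact: (wdB T0 p1 hu hv)].
Qed.

End weak_derivatives.

(** * Sobolev norms computed on families of derivatives *)

Section Sobolev_norm.
Context {R : realType}.
Notation mu := (@lebesgue_measure R).
Local Notation "f =ae g" := (ae_eq mu [set: R] f g) (at level 70).
Implicit Types (T p s c theta : R) (u v w f g h : R -> R) (d e : nat -> R -> R) (j n : nat).

Lemma Slobodecki_cut T p theta w : Slobodecki T p theta w = Slobodecki T p theta (cut T w).
Proof.
apply: eq_integral => x; rewrite inE/= in_itv/= => xT.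
apply: eq_integral => t; rewrite inE/= in_itv/= => tT.
by rewrite (cut_in _ xT) (cut_in _ tT).
Qed.

Lemma ae_eq_Slobodecki T p theta w w' : 0 < T -> measurable_fun [set: R] w ->
  measurable_fun [set: R] w' -> w =ae w' ->
  Slobodecki T p theta w = Slobodecki T p theta w'.
Proof.
move=> T0 mw mw' ww; rewrite (SlobodeckiE p theta T0 mw) (SlobodeckiE p theta T0 mw'); apply: ae_eq_integral.
- exact: measurableT.
- exact: measurable_slob_inner.
- exact: measurable_slob_inner.
- apply: aeS (ww) => x /(_ I) hx _; apply: ae_eq_integral.
  + exact: measurableT.
  + by apply/measurable_EFinP; exact: (measurable_fun_pair2 x (measurable_slob_fun T p theta mw)).
  + by apply/measurable_EFinP; exact: (measurable_fun_pair2 x (measurable_slob_fun T p theta mw')).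
  + by apply: aeS ww => t /(_ I) ht _; rewrite /slob_fun/= hx ht.
Qed.

Lemma slob_funB T p theta v w z : 1 <= p ->
  slob_fun T p theta (fun x => v x - w x) z <=
  2 `^ p * (slob_fun T p theta v z + slob_fun T p theta w z).
Proof.
move=> p1; rewrite /slob_fun -mulrDr [leRHS]mulrCA; apply: ler_wpM2l.
  by rewrite mulr_ge0 ?cut1_ge0.
rewrite -mulrDl mulrA; apply: ler_wpM2r; first exact: powR_ge0.
have := normr_powRD (v z.2 - v z.1) (- (w z.2 - w z.1)) p1.
by rewrite normrN; congr (`|_| `^ _ <= _); ring.
Qed.

Lemma SlobodeckiB T p theta v w : 0 < T -> 1 <= p -> measurable_fun [set: R] v ->
  measurable_fun [set: R] w ->
  (Slobodecki T p theta (fun x => v x - w x)%R <=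
   (2 `^ p)%:E * (Slobodecki T p theta v + Slobodecki T p theta w))%E.
Proof.
move=> T0 p1 mv mw; have mvw : measurable_fun [set: R] (fun x => v x - w x).
  exact: (measurable_funB mv mw).
have c0 : 0 <= 2 `^ p :> R by exact: powR_ge0.
rewrite (SlobodeckiE p theta T0 mv) (SlobodeckiE p theta T0 mw) (SlobodeckiE p theta T0 mvw).
have mi := measurable_slob_inner T p theta; have i0 := @slob_inner_ge0 R T p theta.
have mD := emeasurable_funD (mi v mv) (mi w mw).
rewrite -(ge0_integralD mu measurableT (fun x _ => i0 v x) (mi v mv) (fun x _ => i0 w x) (mi w mw)).
have D0 x : (0 <= \int[mu]_t (slob_fun T p theta v (x, t))%:E +
     \int[mu]_t (slob_fun T p theta w (x, t))%:E)%E.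
  by apply: adde_ge0.
rewrite -(ge0_integralZl mu measurableT mD (fun x _ => D0 x)); last by rewrite lee_fin.
apply: ge0_le_integral.
- exact: measurableT.
- by move=> x _; exact: i0.
- exact: mi.
- exact: measurable_funeM.
move=> x _.
have ms f mf := measurable_fun_pair2 x (@measurable_slob_fun R T p theta f mf).
have s0 f t := slob_fun_ge0 T p theta f (x, t).
rewrite -(ge0_integral_EFinD (ms v mv) (s0 v) (ms w mw) (s0 w)).
have mS := measurable_funD (ms v mv) (ms w mw).
have S0 t : 0 <= slob_fun T p theta v (x, t) + slob_fun T p theta w (x, t) by exact: addr_ge0.
rewrite -(ge0_integral_EFinZl c0 mS S0).
apply: (ge0_le_integral_EFin (ms _ mvw) (s0 _)).
  exact: (measurable_funM (measurable_cst _) mS).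
by move=> t; exact: slob_funB.
Qed.

Lemma SlobodeckiZ T p theta c w : 0 < T -> measurable_fun [set: R] w ->
  (Slobodecki T p theta (fun x => c * w x)%R = (`|c| `^ p)%:E * Slobodecki T p theta w)%E.
Proof.
move=> T0 mw; have mcw : measurable_fun [set: R] (fun x => c * w x).
  exact: (measurable_funM (measurable_cst c) mw).
rewrite (SlobodeckiE p theta T0 mw) (SlobodeckiE p theta T0 mcw).
have mi := measurable_slob_inner T p theta; have i0 := @slob_inner_ge0 R T p theta.
rewrite -(ge0_integralZl mu measurableT (mi w mw) (fun x _ => i0 w x)); last first.
  by rewrite lee_fin powR_ge0.
apply: eq_integral => x _.
have ms f mf := measurable_fun_pair2 x (@measurable_slob_fun R T p theta f mf).
have s0 f t := slob_fun_ge0 T p theta f (x, t).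
rewrite -(ge0_integral_EFinZl (powR_ge0 _ _) (ms w mw) (s0 w)).
apply: eq_integral => t _; congr (_%:E); rewrite /slob_fun/= -mulrBr normrM powRM//.
by ring.
Qed.

(** The [p]-th power of [Sobolev_norm] when [d] is a [wfam]. It refers to no choice of weak
    derivatives and obeys a triangle inequality up to 2^p. *)
Definition SobE T p s d : \bar R :=
  (\sum_(j < (Num.truncn s).+1) Lpow p (d j) +
   if (s - (Num.truncn s)%:R)%R == 0%R then 0
   else Slobodecki T p (s - (Num.truncn s)%:R)%R (d (Num.truncn s)))%E.

Lemma SobE_ge0 T p s d : (0 <= SobE T p s d)%E.
Proof.
apply: adde_ge0; first by apply: sume_ge0 => i _; exact: Lpow_ge0.
by case: ifP => // _; exact: Slobodecki_ge0.
Qed.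

Lemma Lpow_le_SobE T p s d j : (j <= Num.truncn s)%N -> (Lpow p (d j) <= SobE T p s d)%E.
Proof.
move=> jn; rewrite /SobE (bigD1 (Ordinal (jn : (j < (Num.truncn s).+1)%N)))//= -addeA leeDl//.
apply: adde_ge0; first by apply: sume_ge0 => i _; exact: Lpow_ge0.
by case: ifP => // _; exact: Slobodecki_ge0.
Qed.

Lemma Slobodecki_le_SobE T p s d : s - (Num.truncn s)%:R != 0 ->
  (Slobodecki T p (s - (Num.truncn s)%:R)%R (d (Num.truncn s)) <= SobE T p s d)%E.
Proof.
move=> /negbTE h; rewrite /SobE h leeDr//.
by apply: sume_ge0 => i _; exact: Lpow_ge0.
Qed.

Lemma poweRK (x : \bar R) p : 0 < p -> (0 <= x)%E -> ((x `^ p^-1) `^ p)%E = x.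
Proof. by move=> p0 x0; rewrite -poweRrM mulVf ?gt_eqF// poweRe1. Qed.

(** The members of the family agree almost everywhere with the chosen weak derivatives, and [Lpow]
    and [Slobodecki] do not see null sets. *)
Lemma Sobolev_normE T p s u d : 0 < T -> 1 <= p -> wfam T p (Num.truncn s) u d ->
  (Sobolev_norm T p s u = SobE T p s d `^ p^-1)%E.
Proof.
move=> T0 p1 hd; have p0 : 0 < p by exact: lt_le_trans p1.
have un j jn := wfam_unique (j := j) T0 p1 hd jn.
have hL j : (j <= Num.truncn s)%N ->
    (Lp_norm T p (weak_deriv T p j u) `^ p = Lpow p (d j))%E.
  move=> jn; have [[mw _ _] wd] := un j jn; have [_ hd2] := hd; have [[mdj _ _] _] := hd2 j jn.
  rewrite (Lp_normE T _ p0) (poweRK p0 (Lpow_ge0 _ _)); exact: ae_eq_Lpow.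
have hS : (\sum_(j < (Num.truncn s).+1) Lp_norm T p (weak_deriv T p j u) `^ p =
    \sum_(j < (Num.truncn s).+1) Lpow p (d j))%E.
  by apply: eq_bigr => i _; apply: hL; rewrite -ltnS.
rewrite /Sobolev_norm /SobE; case: eqP => [_|/eqP _].
  by rewrite adde0 /Sobolev_nat_norm hS.
have S0 : (0 <= \sum_(j < (Num.truncn s).+1) Lpow p (d j))%E.
  by apply: sume_ge0 => i _; exact: Lpow_ge0.
rewrite /Sobolev_nat_norm hS (poweRK p0 S0).
have [[mw _ _] wd] := un _ (leqnn _); have [_ hd2] := hd; have [[mdj _ _] _] := hd2 _ (leqnn _).
by rewrite Slobodecki_cut (ae_eq_Slobodecki _ _ T0 mw mdj wd).
Qed.

Lemma SobolevP T p s u : 0 < T -> 1 <= p -> Sobolev T p s u <->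
  exists2 d, wfam T p (Num.truncn s) u d & (SobE T p s d < +oo)%E.
Proof.
move=> T0 p1; have p0 : 0 < p by exact: lt_le_trans p1.
split.
- move=> [hn hs]; have [d hd] := Sobolev_nat_wfam T0 p1 hn; exists d => //.
  move: hs; rewrite (Sobolev_normE T0 p1 hd) => /lty_poweRy; apply.
  by rewrite invr_eq0 gt_eqF.
- move=> [d hd hs]; split; first exact: wfam_Sobolev_nat hd.
  by rewrite (Sobolev_normE T0 p1 hd) poweR_lty.
Qed.

Lemma SobEB T p s d e : 0 < T -> 1 <= p ->
  (forall j, (j <= Num.truncn s)%N -> measurable_fun [set: R] (d j)) ->
  (forall j, (j <= Num.truncn s)%N -> measurable_fun [set: R] (e j)) ->
  (SobE T p s (fun j x => d j x - e j x)%R <=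
   (2 `^ p)%:E * (SobE T p s d + SobE T p s e))%E.
Proof.
move=> T0 p1 md me; have c0 : (0 <= (2 `^ p)%:E)%E by rewrite lee_fin powR_ge0.
have L0 (f : nat -> R -> R) : (0 <= \sum_(j < (Num.truncn s).+1) Lpow p (f j))%E.
  by apply: sume_ge0 => i _; exact: Lpow_ge0.
have mN j : (j <= Num.truncn s)%N -> measurable_fun [set: R] (fun x => - e j x).
  by move=> jn; apply: measurableT_comp => //; exact: me.
have h1 : (\sum_(j < (Num.truncn s).+1) Lpow p (fun x => d j x - e j x)%R <=
    (2 `^ p)%:E * (\sum_(j < (Num.truncn s).+1) Lpow p (d j) +
      \sum_(j < (Num.truncn s).+1) Lpow p (e j)))%E.
  rewrite -big_split/= ge0_sume_distrr; last first.
    by move=> i _; apply: adde_ge0; exact: Lpow_ge0.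
  apply: lee_sum => i _; have i1 : (i <= Num.truncn s)%N by rewrite -ltnS.
  have := LpowD p1 (md i i1) (mN i i1).
  by rewrite (LpowN p (e i)).
have h2 := SlobodeckiB (s - (Num.truncn s)%:R) T0 p1 (md _ (leqnn _)) (me _ (leqnn _)).
have S0 := Slobodecki_ge0 T p (s - (Num.truncn s)%:R).
move: h1 h2 (L0 d) (L0 e) (S0 (d (Num.truncn s))) (S0 (e (Num.truncn s))); rewrite /SobE.
move: (\sum_(j < _) _)%E (\sum_(j < _) _)%E (\sum_(j < _) _)%E (Slobodecki _ _ _ _)
  (Slobodecki _ _ _ _) (Slobodecki _ _ _ _) => a a1 a2 b b1 b2 h1 h2 a10 a20 b10 b20.
case: ifP => _; first by rewrite !adde0.
rewrite addeACA (ge0_muleDr _ (adde_ge0 a10 a20) (adde_ge0 b10 b20)).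
exact: leeD h1 h2.
Qed.

End Sobolev_norm.

(** * The spaces J^a L^p and the mapping property of the fractional derivative *)

Section Riemann_Liouville.
Context {R : realType}.
Notation mu := (@lebesgue_measure R).
Local Notation "f =ae g" := (ae_eq mu [set: R] f g) (at level 70).
Implicit Types (T p a b c s : R) (u v w f g h : R -> R).

Lemma cut_RL_int T a v t : cut T (RL_int a v) t = (Gamma a)^-1 * J T a (cut T v) t.
Proof.
rewrite /J !(cutE T _ t); case: ifPn => [/andP[t0 tT]|_]; last by rewrite mulr0.
rewrite /RL_int; congr (_ * _); rewrite Rintegral_mkcond /RI; apply: eq_Rintegral => s _.
rewrite patchE (_ : (s \in _) = (0 < s < t)); last by apply/idP/idP; rewrite inE/= in_itv.
rewrite /kern subr_gt0; have [st|st] := ltP s t; last by rewrite andbF mul0r.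
rewrite andbT cutE (lt_trans st tT) andbT; case: ifP => // _.
by rewrite mulr0.
Qed.

Lemma ae_refl f : f =ae f.
Proof. by apply: (aeS (P := fun=> True)) => //; exact: aeW. Qed.

Lemma ae_sym f g : f =ae g -> g =ae f.
Proof. by apply: aeS => x h I'; rewrite h. Qed.

Lemma ae_trans f g h : f =ae g -> g =ae h -> f =ae h.
Proof. by apply: aeS2 => x h1 h2 I'; rewrite h1// h2. Qed.

Lemma ae_scale c f g : f =ae g -> (fun x => c * f x) =ae (fun x => c * g x).
Proof. by apply: aeS => x h I'; rewrite h. Qed.

(* Membership in the range of [J T a] and the corresponding preimage are
   insensitive to the positive factor [(Gamma a)^-1]. *)
Lemma RL_spaceP T p a u : 0 < T -> 0 < a -> 1 <= p -> RL_space T p a u <->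
  Lz T p (cut T u) /\ exists2 w, Lz T p w & cut T u =ae J T a w.
Proof.
move=> T0 a0 p1; have p0 : 0 < p by exact: lt_le_trans p1.
have G0 := Gamma_gt0 a0; rewrite /RL_space gt_eqF//; split.
- move=> [hu [v hv uv]]; have hu' := (LpP T u p0).1 hu; have hv' := (LpP T v p0).1 hv.
  split => //; exists (fun x => (Gamma a)^-1 * cut T v x); first exact: LzZ.
  apply: ae_trans ((ae_onP T u (RL_int a v)).1 uv) _.
  have -> : cut T (RL_int a v) = (fun t => (Gamma a)^-1 * J T a (cut T v) t).
    by apply/funext => t; exact: cut_RL_int.
  exact: ae_sym (JZ _ T0 a0 p1 hv').
- move=> [hu [w hw uw]]; split; first exact: (LpP T u p0).2.
  have hGw := LzZ (Gamma a) hw.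
  exists (fun x => Gamma a * w x); first exact: Lz_Lp hGw.
  apply: (ae_onP T u _).2; apply: (ae_trans uw).
  have -> : cut T (RL_int a (fun x => Gamma a * w x)) =
      (fun t => (Gamma a)^-1 * J T a (fun x => Gamma a * w x) t).
    by apply/funext => t; rewrite cut_RL_int (cut_id hGw).
  apply: aeS (JZ (Gamma a) T0 a0 p1 hw) => t h _.
  by rewrite h// mulrA mulVf ?gt_eqF// mul1r.
Qed.

(** [RL_inv] picks some preimage under [RL_int], and [Gamma a] times [w] is another; [J_injective]
    identifies them. The factor undoes the normalisation of [RL_int]. *)
Lemma RL_invP T p a u w : 0 < T -> 0 < a -> 1 <= p -> Lz T p (cut T u) -> Lz T p w ->
  cut T u =ae J T a w ->
  Lz T p (cut T (RL_inv T p a u)) /\ cut T (RL_inv T p a u) =ae (fun x => Gamma a * w x).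
Proof.
move=> T0 a0 p1 hu hw uw; have p0 : 0 < p by exact: lt_le_trans p1.
have G0 := Gamma_gt0 a0.
have hex : exists v, Lp T p v /\ ae_on T u (RL_int a v).
  have : RL_space T p a u by apply: (RL_spaceP u T0 a0 p1).2; split => //; exists w.
  by rewrite /RL_space gt_eqF// => -[_ [z hz uz]]; exists z.
have [hx ux] := getPex hex; rewrite -/(RL_inv T p a u) in hx ux *.
set x := RL_inv T p a u in hx ux *.
have hx' := (LpP T x p0).1 hx; split; first exact: hx'.
have hGw := LzZ (Gamma a) hw; have hB := LzB p1 hx' hGw.
have : (fun t => cut T x t - Gamma a * w t) =ae cst 0.
  apply: (J_injective T0 a0 p1 hB).
  apply: ae_trans (JB T0 a0 p1 hx' hGw) _.
  have ux' := (ae_onP T u (RL_int a x)).1 ux.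
  have e1 := ae_trans (ae_sym uw) ux'.
  apply: aeS2 e1 (JZ (Gamma a) T0 a0 p1 hw) => t h1 h2 _.
  rewrite h2// h1// cut_RL_int /cst mulrA mulfV ?gt_eqF// mul1r.
  by rewrite subrr.
by apply: aeS => t /(_ I)/eqP; rewrite subr_eq0 => /eqP.
Qed.

Lemma RL_normE T p a u w : 0 < T -> 0 < a -> 1 <= p -> Lz T p (cut T u) -> Lz T p w ->
  cut T u =ae J T a w ->
  Lp_norm T p (RL_inv T p a u) = ((((Gamma a) `^ p)%:E * Lpow p w) `^ p^-1)%E.
Proof.
move=> T0 a0 p1 hu hw uw; have p0 : 0 < p by exact: lt_le_trans p1.
have [[mx _ _] hx] := RL_invP T0 a0 p1 hu hw uw; have [mw _ _] := hw.
have mGw : measurable_fun [set: R] (fun x => Gamma a * w x).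
  exact: (measurable_funM (measurable_cst _) mw).
rewrite (Lp_normE T _ p0) (ae_eq_Lpow _ mx mGw hx) LpowZ//.
by rewrite gtr0_norm// Gamma_gt0.
Qed.

(** [J_semigroup] solved for the higher order, with the Beta constant moved onto the argument. *)
Lemma J_add T p a b v : 0 < T -> 0 < a -> 0 < b -> 1 <= p -> Lz T p v ->
  J T (a + b) v =ae J T a (J T b (fun x => (beta_kern a b)^-1 * v x)).
Proof.
move=> T0 a0 b0 p1 hv; have B0 := beta_kern_gt0 a0 b0.
have hv' := LzZ (beta_kern a b)^-1 hv.
apply: ae_sym; apply: ae_trans (J_semigroup T0 b0 a0 p1 hv') _.
have ab0 : 0 < a + b by rewrite addr_gt0.
rewrite [b + a]addrC; apply: aeS (JZ (beta_kern a b)^-1 T0 ab0 p1 hv) => t h _.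
by rewrite h// mulrA mulfV ?gt_eqF// mul1r.
Qed.

Lemma RL_space_add T p a b u : 0 < T -> 0 < a -> 0 < b -> 1 <= p ->
  RL_space T p (a + b) u <-> Lz T p (cut T u) /\
    exists2 w, RL_space T p b w & Lz T p w /\ cut T u =ae J T a w.
Proof.
move=> T0 a0 b0 p1; have ab0 : 0 < a + b by rewrite addr_gt0.
split=> [/(RL_spaceP u T0 ab0 p1)[hu [v hv uv]]|[hu [w /(RL_spaceP w T0 b0 p1)[hw' [v hv wv]] [hw uw]]]].
  split; first exact: hu.
  have hv' := LzZ (beta_kern a b)^-1 hv; have hJ := J_Lz T0 b0 p1 hv'.
  exists (J T b (fun x => (beta_kern a b)^-1 * v x)).
    apply: (RL_spaceP _ T0 b0 p1).2; rewrite (cut_id hJ); split; first exact: hJ.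
    by exists (fun x => (beta_kern a b)^-1 * v x); [exact: hv'|exact: ae_refl].
  by split; [exact: hJ|exact: ae_trans uv (J_add T0 a0 b0 p1 hv)].
apply: (RL_spaceP u T0 ab0 p1).2; split; first exact: hu.
rewrite (cut_id hw) in wv; have [mw _ _] := hw; have hJ := J_Lz T0 b0 p1 hv; have [mJ _ _] := hJ.
exists (fun x => beta_kern a b * v x); first exact: LzZ.
apply: (ae_trans uw); rewrite (ae_eq_J T a mw mJ wv).
apply: ae_trans (J_semigroup T0 b0 a0 p1 hv) _; rewrite [b + a]addrC.
exact: ae_sym (JZ _ T0 ab0 p1 hv).
Qed.

(** All rests on [key]: W_(a+b) consists of the images under J^a of elements of W_b, including
    [b = 0]. As [RL_inv] returns preimages only up to the factor [Gamma a] and almost everywhere,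
    [inv] supplies the stability of W_b under both. *)
Lemma frac_deriv_image_RL T p a b : 0 < T -> 0 < a -> 0 <= b -> 1 <= p ->
  RL_space T p (a + b) `<=` frac_deriv_dom T p a /\
  frac_deriv_image T p a (RL_space T p (a + b)) = RL_space T p b.
Proof.
move=> T0 a0 b0 p1; have p0 : 0 < p by exact: lt_le_trans p1.
have G0 := Gamma_gt0 a0.
have key u : RL_space T p (a + b) u <-> Lz T p (cut T u) /\
    exists2 w, RL_space T p b w & Lz T p w /\ cut T u =ae J T a w.
  move: b0; rewrite le_eqVlt => /orP[/eqP <-|b0]; last exact: RL_space_add.
  rewrite addr0; split=> [/(RL_spaceP u T0 a0 p1)[hu [w hw uw]]|[hu [w _ [hw uw]]]].
    split; first exact: hu.
    by exists w => //; rewrite /RL_space eqxx; exact: Lz_Lp hw.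
  by apply: (RL_spaceP u T0 a0 p1).2; split; [exact: hu|exists w].
have inv v w c : Lz T p (cut T w) -> RL_space T p b v ->
    cut T w =ae (fun x => c * cut T v x) -> RL_space T p b w.
  move: b0; rewrite le_eqVlt => /orP[/eqP <-|b0] hw.
    by move=> _ _; rewrite /RL_space eqxx; exact: (LpP T w p0).2.
  move=> /(RL_spaceP v T0 b0 p1)[_ [z hz vz]] wv; apply: (RL_spaceP w T0 b0 p1).2.
  split; first exact: hw.
  exists (fun x => c * z x); first exact: LzZ.
  apply: (ae_trans wv); apply: ae_trans (ae_scale c vz) _.
  exact: ae_sym (JZ _ T0 b0 p1 hz).
split.
  move=> u /key [hu [w _ [hw uw]]]; apply: (RL_spaceP u T0 a0 p1).2.
  by split; [exact: hu|exists w].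
apply/seteqP; split=> w /=.
- move=> [hw [u /key [hu [v hv [hv' uv]]] wu]].
  have [hx xv] := RL_invP T0 a0 p1 hu hv' uv.
  apply: (inv v w (Gamma a) ((LpP T w p0).1 hw) hv); rewrite (cut_id hv').
  exact: ae_trans ((ae_onP T w _).1 wu) xv.
- move=> hw; have hw' : Lp T p w by move: hw; rewrite /RL_space; case: ifP => // _ [].
  split; first exact: hw'.
  have hc := (LpP T w p0).1 hw'.
  pose v x := (Gamma a)^-1 * cut T w x; have hv : Lz T p v by exact: LzZ.
  have hJ := J_Lz T0 a0 p1 hv.
  have uJ : cut T (J T a v) =ae J T a v by rewrite (cut_id hJ); exact: ae_refl.
  have huJ : Lz T p (cut T (J T a v)) by rewrite (cut_id hJ); exact: hJ.
  exists (J T a v).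
    apply: (key _).2; split; first exact: huJ.
    exists v; last by split; [exact: hv|exact: uJ].
    apply: (inv w v (Gamma a)^-1); rewrite ?(cut_id hv); [exact: hv|exact: hw|exact: ae_refl].
  apply: (ae_onP T w _).2; have [_ xv] := RL_invP T0 a0 p1 huJ hv uJ.
  apply: ae_trans (ae_sym xv); apply: (aeS _ (ae_refl (cut T w))) => x _ _.
  by rewrite /v mulrA mulfV ?gt_eqF// mul1r.
Qed.

End Riemann_Liouville.

(** * The two norm estimates, for the range of J^a and for smooth functions *)

Section embeddings.
Context {R : realType}.
Notation mu := (@lebesgue_measure R).
Local Notation "f =ae g" := (ae_eq mu [set: R] f g) (at level 70).
Implicit Types (T p a b c s theta : R) (u v w z f g h : R -> R) (d : nat -> R -> R) (j n : nat).

(** The constant is a product of Beta integrals, independent of [v]; the uniform estimates below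
    rely on this. *)
Lemma iter_J T p n a : 0 < T -> 0 < a -> 1 <= p ->
  exists2 c, 0 < c & forall v, Lz T p v ->
    iter n (J T 1) (J T a v) =ae (fun t => c * J T (a + n%:R) v t).
Proof.
move=> T0 a0 p1; elim: n => [|n [c c0 ih]].
  exists 1 => // v hv; rewrite addr0/=; apply: (aeS _ (ae_refl (J T a v))) => t _ _.
  by rewrite mul1r.
have an0 : 0 < a + n%:R by rewrite ltr_wpDr.
exists (c * beta_kern 1 (a + n%:R)); first by rewrite mulr_gt0 ?beta_kern_gt0.
move=> v hv; have hJ := J_Lz T0 an0 p1 hv; have [mJ _ _] := hJ.
have [mI _ _] := iter_J_Lz n T0 p1 (J_Lz T0 a0 p1 hv).
have mcJ : measurable_fun [set: R] (fun t => c * J T (a + n%:R) v t).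
  exact: (measurable_funM (measurable_cst _) mJ).
rewrite iterS (ae_eq_J T 1 mI mcJ (ih v hv)).
apply: ae_trans (JZ c T0 ltr01 p1 hJ) _.
have := ae_scale c (J_semigroup T0 an0 ltr01 p1 hv).
apply: aeS => t h _; rewrite h// mulrA (_ : a + n.+1%:R = a + n%:R + 1)//.
by rewrite -addrA natr1.
Qed.

Lemma iter_J1 T p n : 0 < T -> 1 <= p ->
  exists2 c, 0 < c & forall v, Lz T p v ->
    iter n.+1 (J T 1) v =ae (fun t => c * J T n.+1%:R v t).
Proof.
move=> T0 p1; have [c c0 h] := iter_J n T0 (@ltr01 R) p1.
exists c; first exact: c0.
move=> v hv; rewrite iterSr (_ : n.+1%:R = 1 + n%:R); last by rewrite nat1r.
exact: h.
Qed.

(** Factoring an integral of integer order through J^a exhibits an explicit preimage under J^a of a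
    smooth function. *)
Lemma iter_J1_split T p n a b : 0 < T -> 0 < a -> 0 < b -> 1 <= p -> a + b = n.+1%:R ->
  exists2 c, 0 < c & forall h, Lz T p h ->
    iter n.+1 (J T 1) h =ae J T a (fun t => c * J T b h t).
Proof.
move=> T0 a0 b0 p1 abn; have [c c0 hc] := iter_J1 n T0 p1.
have B0 := beta_kern_gt0 a0 b0.
exists (c / beta_kern a b); first by rewrite divr_gt0.
move=> h hh; apply: ae_trans (hc h hh) _; apply: ae_sym.
have hJ := J_Lz T0 b0 p1 hh.
apply: ae_trans (JZ _ T0 a0 p1 hJ) _.
have := J_semigroup T0 b0 a0 p1 hh; rewrite addrC abn.
apply: aeS => t e _; rewrite e// mulrA divfK// gt_eqF//.
Qed.

Lemma LpowJZ T p a c : 0 < T -> 0 < a -> 1 <= p ->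
  exists2 K, 0 <= K & forall v, Lz T p v ->
    (Lpow p (fun t => c * J T a v t)%R <= K%:E * Lpow p v)%E.
Proof.
move=> T0 a0 p1; exists (`|c| `^ p * (T `^ a / a) `^ p); first by rewrite mulr_ge0 ?powR_ge0.
move=> v hv; have [mJ _ _] := J_Lz T0 a0 p1 hv.
rewrite (LpowZ p c mJ) EFinM -muleA; apply: lee_wpmul2l; first by rewrite lee_fin powR_ge0.
exact: J_Lpow.
Qed.

(** [Slobodecki_J] reaches only orders below 1, so J^a is factored as a multiple of J^b J^(a-b),
    with [b] the midpoint of [theta] and min (1, a), hence below both 1 and [a]. *)
Lemma Slobodecki_J_le T p a theta : 0 < T -> 1 <= p -> 0 < theta < 1 -> theta < a ->
  exists2 K, 0 <= K & forall v, Lz T p v ->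
    (Slobodecki T p theta (J T a v) <= K%:E * Lpow p v)%E.
Proof.
move=> T0 p1 /andP[t0 t1] ta; pose m := Num.min 1 a; pose b := (theta + m) / 2.
have tm : theta < m by rewrite lt_min t1.
have m1 : m <= 1 by rewrite ge_min lexx.
have ma : m <= a by rewrite ge_min lexx orbT.
have tb : theta < b by rewrite /b; lra.
have b1 : b < 1 by rewrite /b; lra.
have b0 : 0 < b by lra.
have ab0 : 0 < a - b by rewrite /b; lra.
have tbb : 0 < theta < b by rewrite t0.
have [K K0 hK] := LpowJZ 1 T0 ab0 p1.
set C := (2 / b) `^ p * (2 * (T `^ ((b - theta) * p) / ((b - theta) * p))).
have p0 : 0 < p by exact: lt_le_trans p1.
have C0 : 0 <= C.
  rewrite mulr_ge0 ?powR_ge0// mulr_ge0// divr_ge0 ?powR_ge0//.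
  by rewrite mulr_ge0 ?(ltW p0)// subr_ge0 ltW.
pose B := `|(beta_kern b (a - b))^-1| `^ p.
exists (C * (K * B)); first exact: mulr_ge0 C0 (mulr_ge0 K0 (powR_ge0 _ _)).
move=> v hv; have hv' := LzZ (beta_kern b (a - b))^-1 hv.
have e := J_add T0 b0 ab0 p1 hv; rewrite (_ : b + (a - b) = a) in e; last by ring.
have a0 : 0 < a by lra.
have hJ := J_Lz T0 ab0 p1 hv'; have [mJ1 _ _] := J_Lz T0 a0 p1 hv.
have [mJ2 _ _] := J_Lz T0 b0 p1 hJ; have [mv _ _] := hv.
rewrite (ae_eq_Slobodecki _ _ T0 mJ1 mJ2 e).
apply: (le_trans (Slobodecki_J T0 p1 tbb b1 hJ)).
rewrite -/C (EFinM C) -muleA; apply: lee_wpmul2l; first by rewrite lee_fin.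
have [mJ3 _ _] := hJ.
have := hK _ hv'; rewrite (LpowZ p 1 mJ3) (LpowZ p _ mv) normr1 powR1 mul1e -/B => h.
by rewrite (EFinM K) -muleA.
Qed.

(** Up to a positive constant the [j]-th derivative of J^a v is J^(a-j) v, of positive order because
    j <= n <= s < a. Young's inequality bounds it, and [Slobodecki_J_le] bounds the seminorm of the
    last one. *)
Lemma J_Sobolev_bound T p a s : 0 < T -> 1 <= p -> 0 <= s -> s < a ->
  exists2 K, 0 <= K & forall u v, Lz T p (cut T u) -> Lz T p v -> cut T u =ae J T a v ->
    exists2 d, wfam T p (Num.truncn s) u d & (SobE T p s d <= K%:E * Lpow p v)%E.
Proof.
move=> T0 p1 s0 sa; set n := Num.truncn s.
have a0 : 0 < a by exact: le_lt_trans sa.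
have ns : n%:R <= s by rewrite truncn_le.
have sn1 : s < n.+1%:R by exact: truncnS_gt.
have jn0 j : (j <= n)%N -> 0 < a - j%:R.
  by move=> jn; rewrite subr_gt0 (le_lt_trans _ sa)// (le_trans _ ns)// ler_nat.
have hc j : exists cK : R * R, (j <= n)%N -> [/\ 0 < cK.1, 0 <= cK.2,
    forall v, Lz T p v -> iter j (J T 1) (J T (a - j%:R) v) =ae (fun t => cK.1 * J T a v t) &
    forall v, Lz T p v -> (Lpow p (fun t => cK.1^-1 * J T (a - j%:R) v t)%R <= cK.2%:E * Lpow p v)%E].
  (* A total statement is required by [choice], so orders beyond [n] receive the dummy constants
     [(0, 0)]. *)
  have [jn|jn] := leqP j n; last by exists (0, 0).
  have [c c0 h1] := iter_J j T0 (jn0 j jn) p1.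
  have [K K0 h2] := LpowJZ c^-1 T0 (jn0 j jn) p1.
  rewrite subrK in h1; exists (c, K) => _; split; [exact: c0|exact: K0|exact: h1|exact: h2].
have [cK hcK] := choice hc.
pose dn v j t := (cK j).1^-1 * J T (a - j%:R) v t.
have [KS KS0 hS] : exists2 K, 0 <= K & forall v, Lz T p v ->
    ((if (s - n%:R)%R == 0%R then 0 else Slobodecki T p (s - n%:R)%R (dn v n)) <= K%:E * Lpow p v)%E.
  case: eqP => [_|/eqP sn0].
    by exists 0 => // v hv; rewrite mul0e.
  have t01 : 0 < s - n%:R < 1.
    rewrite lt_neqAle eq_sym sn0 subr_ge0 ns/= ltrBlDr nat1r; exact: sn1.
  have ta : s - n%:R < a - n%:R by rewrite ltrD2r.
  have [K K0 hK] := Slobodecki_J_le T0 p1 t01 ta.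
  exists (`|(cK n).1^-1| `^ p * K); first by rewrite mulr_ge0 ?powR_ge0.
  move=> v hv; have [mJ _ _] := J_Lz T0 (jn0 n (leqnn n)) p1 hv.
  rewrite /dn SlobodeckiZ// EFinM -muleA; apply: lee_wpmul2l; first by rewrite lee_fin powR_ge0.
  exact: hK.
exists (\sum_(j < n.+1) (cK j).2 + KS).
  rewrite addr_ge0// sumr_ge0// => j _.
  by have [] := hcK j (ltn_ord j : (j <= n)%N).
move=> u v hu hv uv; have L0 := Lpow_ge0 p v.
exists (dn v).
  split; first exact: hu.
  move=> j jn; have [c0 K0 h1 _] := hcK j jn.
  have hJ := J_Lz T0 (jn0 j jn) p1 hv; split; first exact: LzZ.
  have hI := iter_J_Lz j T0 p1 hJ.
  have hZ := wdZ (cK j).1^-1 T0 p1 hI hJ (wd_iter j T0 p1 hJ).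
  apply: (wd_ae (LzZ _ hI) hu (LzZ _ hJ) (LzZ _ hJ) _ (ae_refl _) hZ).
  apply: ae_trans (ae_scale _ (h1 v hv)) _; apply: ae_sym; apply: (ae_trans uv).
  apply: (aeS _ (ae_refl (J T a v))) => t _ _.
  by rewrite mulrA mulVf ?gt_eqF// mul1r.
rewrite /SobE -/n EFinD ge0_muleDl ?lee_fin//; last first.
  by rewrite sumr_ge0// => j _; have [] := hcK j (ltn_ord j : (j <= n)%N).
apply: leeD; last exact: hS.
rewrite -sumEFin ge0_sume_distrl; last first.
  by move=> j _; rewrite lee_fin; have [] := hcK j (ltn_ord j : (j <= n)%N).
apply: lee_sum => j _; have [_ _ _ h2] := hcK j (ltn_ord j : (j <= n)%N).
exact: h2.
Qed.

Lemma smooth_order_ge s : (Num.truncn s <= smooth_order s)%N.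
Proof. by rewrite /smooth_order; case: ifP. Qed.

Lemma zero_C_wfam T p k n z : 0 < T -> 1 <= p -> zero_C T k z -> (n <= k)%N ->
  exists h (M : R), [/\ Lz T p h, (forall x, `|h x| <= M), cut T z = iter k (J T 1) h &
    wfam T p n z (fun j => iter (k - j) (J T 1) h)].
Proof.
move=> T0 p1 hz nk; have p0 : 0 < p by exact: lt_le_trans p1.
have [h [M [mh sh bh ez]]] := zero_C_J1 T0 hz.
have hh := Lz_bounded T0 p0 mh sh bh.
exists h, M; split; [exact: hh|exact: bh|exact: ez|split].
  by rewrite ez; exact: iter_J_Lz.
move=> j jn; have jk := leq_trans jn nk; split; first exact: iter_J_Lz.
have hI := iter_J_Lz (k - j) T0 p1 hh.
have -> : cut T z = iter j (J T 1) (iter (k - j) (J T 1) h) by rewrite ez -iterD subnKC.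
exact: (wd_iter j T0 p1 hI).
Qed.

(** If [a < n], the preimage under J^a is a multiple of J^(n-a) of the [n]-th derivative, and
    Young's inequality controls it. Otherwise n < a < s < n + 1, and it is a multiple of J^(1-b) of
    the (n+1)-st derivative, that is, a fractional derivative of order b = a - n of the [n]-th one,
    controlled by [Lpow_frac_le]. *)
Lemma zero_C_lift T p a s : 0 < T -> 1 <= p -> 0 < a -> a < s ->
  (forall n : nat, a != n%:R) ->
  exists2 K, 0 <= K & forall z, zero_C T (smooth_order s) z ->
    exists d v, [/\ wfam T p (Num.truncn s) z d, Lz T p v, cut T z =ae J T a v &
      (Lpow p v <= K%:E * SobE T p s d)%E].
Proof.
move=> T0 p1 a0 as' aN; set n := Num.truncn s; set k := smooth_order s.
have s0 : 0 <= s by rewrite ltW// (lt_trans a0).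
have nk : (n <= k)%N by exact: smooth_order_ge.
have ns : n%:R <= s by rewrite truncn_le.
have sn1 : s < n.+1%:R by exact: truncnS_gt.
have [an|na] := ltP a n%:R.
  have [n' nE] : exists n', n = n'.+1.
    by move: an; case: (n) => [/(lt_trans a0)|n' _]; [rewrite ltxx|exists n'].
  have b0 : 0 < n%:R - a by rewrite subr_gt0.
  have abn : a + (n%:R - a) = n'.+1%:R by rewrite -nE; ring.
  have [c c0 hc] := iter_J1_split T0 a0 b0 p1 abn.
  have [K K0 hK] := LpowJZ c T0 b0 p1.
  exists K => // z hz; have [h [M [hh bh ez hw]]] := zero_C_wfam T0 p1 hz nk.
  have hg := iter_J_Lz (k - n) T0 p1 hh.
  exists (fun j => iter (k - j) (J T 1) h), (fun t => c * J T (n%:R - a) (iter (k - n) (J T 1) h) t).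
  split; first exact: hw.
  - by apply: LzZ; exact: J_Lz.
  - by rewrite ez -(subnKC nk) iterD {1}nE (subnKC nk); exact: hc.
  - apply: (le_trans (hK _ hg)); apply: lee_wpmul2l; first by rewrite lee_fin.
    exact: (Lpow_le_SobE T p (fun j => iter (k - j) (J T 1) h) (leqnn n)).
(* Noninteger [a] excludes [a = n], where [b] would be 0, outside the range of Marchaud's
   formula. *)
have na' : n%:R < a by rewrite lt_neqAle eq_sym aN.
have sn0 : s - n%:R != 0 by rewrite subr_eq0 gt_eqF// (lt_trans na').
have kE : k = n.+1 by rewrite /k /smooth_order -/n -subr_eq0 (negbTE sn0).
pose b := a - n%:R.
have bt : 0 < b < s - n%:R by rewrite subr_gt0 na' ltrD2r.
have t1 : s - n%:R < 1 by rewrite ltrBlDr nat1r.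
have b10 : 0 < 1 - b by rewrite subr_gt0; case/andP: bt => _ /lt_trans; apply.
have abn : a + (1 - b) = n.+1%:R by rewrite /b -nat1r; ring.
have [c c0 hc] := iter_J1_split T0 a0 b10 p1 abn.
have [C C0 hC] := Lpow_frac_le T0 p1 bt t1.
exists (`|c| `^ p * (C * 2)); first by rewrite !mulr_ge0 ?powR_ge0.
move=> z hz; have [h [M [hh bh ez hw]]] := zero_C_wfam T0 p1 hz nk.
exists (fun j => iter (k - j) (J T 1) h), (fun t => c * J T (1 - b) h t); split.
- exact: hw.
- by apply: LzZ; exact: J_Lz.
- by rewrite ez kE; exact: hc.
have [mJ _ _] := J_Lz T0 b10 p1 hh.
rewrite LpowZ// EFinM -muleA; apply: lee_wpmul2l; first by rewrite lee_fin powR_ge0.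
apply: (le_trans (hC h M hh bh)); rewrite EFinM -muleA; apply: lee_wpmul2l; first by rewrite lee_fin.
have d1 : iter (k - n) (J T 1) h = J T 1 h by rewrite kE subSn// subnn.
have h1 := Lpow_le_SobE T p (fun j => iter (k - j) (J T 1) h) (leqnn n).
have h2 := Slobodecki_le_SobE T p (fun j => iter (k - j) (J T 1) h) sn0.
rewrite -/n /= d1 in h1 h2.
have -> : (2%:E * SobE T p s (fun j => iter (k - j) (J T 1) h) =
   SobE T p s (fun j => iter (k - j) (J T 1) h) + SobE T p s (fun j => iter (k - j) (J T 1) h))%E.
  by rewrite (_ : 2%:E = 1 + 1)%E// ge0_muleDl// !mul1e.
exact: leeD h1 h2.
Qed.

End embeddings.

(** * Density of smooth functions and the upper embedding into the closure *)

Section closures.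
Context {R : realType}.
Notation mu := (@lebesgue_measure R).
Local Notation "f =ae g" := (ae_eq mu [set: R] f g) (at level 70).
Implicit Types (T p a b c s : R) (u v w z f g h : R -> R) (d : nat -> R -> R) (j n k : nat).

Lemma lee_geometric (x y : \bar R) (A : R) :
  (forall n, (x <= y + (A * 2^-1 ^+ n)%:E)%E) -> (x <= y)%E.
Proof.
move=> h; apply/lee_addgt0Pr => e e0.
have c : (fun n => A * 2^-1 ^+ n) @ \oo --> (0 : R).
  rewrite -(mulr0 A); apply: cvgM; first exact: cvg_cst.
  by apply: cvg_expr; rewrite ger0_norm ?invr_ge0// invf_lt1 ?ltr1n.
move/cvgrPdist_lt: c => /(_ e e0)[N _ hN].
apply: (le_trans (h N)); apply: leeD; first exact: lexx.
have := hN N (leqnn N); rewrite /= sub0r normrN => /ltW; rewrite lee_fin.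
by apply: le_trans; exact: ler_norm.
Qed.

Lemma poweR_lt_root (x : \bar R) p e : 0 < p -> 0 < e -> (0 <= x)%E ->
  ((x `^ p^-1 < e%:E) <-> (x < (e `^ p)%:E))%E.
Proof.
move=> p0 e0; case: x => [r||]//.
  rewrite lee_fin => r0; rewrite poweR_EFin !lte_fin.
  have pi0 : 0 < p^-1 by rewrite invr_gt0.
  split=> h.
    have := gt0_ltr_powR p0 _ _ h; rewrite -powRrM mulVf ?gt_eqF// powRr1//; apply.
      by rewrite nnegrE powR_ge0.
    by rewrite nnegrE ltW.
  have := gt0_ltr_powR pi0 _ _ h; rewrite -powRrM mulfV ?gt_eqF// powRr1 ?(ltW e0)//; apply.
    by rewrite nnegrE.
  by rewrite nnegrE powR_ge0.
by move=> _; rewrite poweRyr ?invr_eq0 ?gt_eqF// !ltNge !leey.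
Qed.

Lemma poweR_root_le (x y : \bar R) p K : 0 < p -> (0 <= x)%E -> (0 <= y)%E -> 0 <= K ->
  (x <= K%:E * y)%E -> (x `^ p^-1 <= (K `^ p^-1)%:E * y `^ p^-1)%E.
Proof.
move=> p0 x0 y0 K0 xy; have pi0 : 0 <= p^-1 by rewrite invr_ge0 ltW.
rewrite -poweR_EFin -poweRM ?lee_fin//.
apply: (gt0_ler_poweR pi0 _ _ xy); rewrite in_itv/= leey andbT//.
by apply: mule_ge0; rewrite ?lee_fin.
Qed.

Lemma Lpow_subrr T p v : 0 < p -> Lpow p (fun x => v x - v x) = 0%E.
Proof.
move=> p0; rewrite /Lpow; under eq_integral do rewrite subrr normr0 powR0 ?gt_eqF//.
by rewrite integral0.
Qed.

Lemma LpowB p v w : 1 <= p -> measurable_fun [set: R] v -> measurable_fun [set: R] w ->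
  (Lpow p (fun x => v x - w x)%R <= (2 `^ p)%:E * (Lpow p v + Lpow p w))%E.
Proof.
move=> p1 mv mw; have mNw : measurable_fun [set: R] (fun x => - w x) by apply: measurableT_comp.
by have := LpowD p1 mv mNw; rewrite (LpowN p w).
Qed.

(** Induction: [v] is approximated by J^1 w1, then [w1] by an [n]-fold integral. The second error
    passes through J^1, whose bound [K] dictates the tolerance [e2]. *)
Lemma density_iter T p n v e : 0 < T -> 1 <= p -> Lz T p v -> 0 < e ->
  exists2 w, Lz T p w & (Lpow p (fun x => v x - iter n (J T 1) w x)%R < e%:E)%E.
Proof.
move=> T0 p1; have p0 : 0 < p by exact: lt_le_trans p1.
elim: n v e => [|n ih] v e hv e0.
  by exists v; rewrite ?Lpow_subrr ?lte_fin.
have c20 : 0 < 2 `^ p :> R by rewrite powR_gt0.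
set K := ((T `^ 1 / 1) `^ p : R).
have K0 : 0 <= K by exact: powR_ge0.
pose e1 := e / (4 * 2 `^ p); have e10 : 0 < e1 by rewrite divr_gt0// mulr_gt0.
pose e2 := e1 / (K + 1); have K1 : 0 < K + 1 by rewrite ltr_wpDl.
have e20 : 0 < e2 by rewrite divr_gt0.
have [w1 hw1 lw1] := density_J1 T0 p1 hv e10.
have [w hw lw] := ih w1 e2 hw1 e20; exists w; first exact: hw.
have hI := iter_J_Lz n T0 p1 hw; have hB := LzB p1 hw1 hI.
have [mJ1 _ _] := J_Lz T0 ltr01 p1 hw1; have [mJI _ _] := J_Lz T0 ltr01 p1 hI.
have [mv _ _] := hv; have [mJB _ _] := J_Lz T0 ltr01 p1 hB.
have m1 : measurable_fun [set: R] (fun x => v x - J T 1 w1 x) by exact: (measurable_funB mv mJ1).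
have m2 : measurable_fun [set: R] (fun x => J T 1 w1 x - J T 1 (iter n (J T 1) w) x).
  exact: (measurable_funB mJ1 mJI).
have hd := LpowD p1 m1 m2.
have e3 : (fun x => (v x - J T 1 w1 x) + (J T 1 w1 x - J T 1 (iter n (J T 1) w) x)) =
    (fun x => v x - iter n.+1 (J T 1) w x).
  by apply/funext => x; rewrite iterS; ring.
rewrite e3 in hd; apply: (le_lt_trans hd).
have hL2 : (Lpow p (fun x => J T 1 w1 x - J T 1 (iter n (J T 1) w) x)%R <= e1%:E)%E.
  rewrite -(ae_eq_Lpow p mJB m2 (JB T0 ltr01 p1 hw1 hI)).
  apply: (le_trans (J_Lpow T0 ltr01 p1 hB)); rewrite -/K.
  apply: (@le_trans _ _ (K%:E * e2%:E)%E).
    by apply: lee_wpmul2l; [rewrite lee_fin|exact: ltW].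
  by rewrite -EFinM lee_fin /e2 mulrA ler_pdivrMr// mulrC ler_wpM2l ?(ltW e10)// lerDl.
apply: (@le_lt_trans _ _ ((2 `^ p)%:E * (e1%:E + e1%:E))%E).
  apply: lee_wpmul2l; first by rewrite lee_fin ltW.
  by apply: leeD; [exact: ltW lw1|exact: hL2].
rewrite -EFinD -EFinM lte_fin (_ : _ * _ = e / 2); first by rewrite ltr_pdivrMr// ltr_pMr// ltr1n.
by rewrite /e1; field; rewrite gt_eqF.
Qed.

Lemma J1_Lz_bounded T p g : 0 < T -> 1 <= p -> Lz T p g ->
  exists M, forall x, `|J T 1 g x| <= M.
Proof.
move=> T0 p1 hg; have [mg _ _] := hg; have /integrableP[_ fg] := Lz_integrable T0 p1 hg.
set I := (\int[mu]_x _)%E in fg.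
have I0 : (0 <= I)%E by apply: integral_ge0 => x _; exact: abse_ge0.
have If : I \is a fin_num by rewrite ge0_fin_numE.
exists (fine I) => x; rewrite /J cutE; case: ifP => _; last by rewrite normr0 fine_ge0.
rewrite -lee_fin fineK//; apply: (le_trans (normr_RI_le 1 x mg)).
apply: ge0_le_integral.
- exact: measurableT.
- by move=> s _; rewrite lee_fin mulr_ge0 ?kern_ge0.
- apply/measurable_EFinP; apply: (measurable_funM (measurable_subl x (measurable_kern 1))).
  exact: measurableT_comp.
- by apply: measurableT_comp => //; exact/measurable_EFinP.
- move=> s _; rewrite /= lee_fin kern1; case: (_ < _); first by rewrite mul1r.
  by rewrite mul0r.
Qed.

(** [v] is approximated by an (M+1)-fold integral with M + 1 > b; this has the form c J^b h, and its
    image under J^a is the (N+1)-fold integral of [h], which is smooth to order [k]. *)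
Lemma density_zero_C T p a k v e : 0 < T -> 1 <= p -> 0 < a -> Lz T p v -> 0 < e ->
  exists z v', [/\ zero_C T k z, Lz T p v', cut T z =ae J T a v' &
    (Lpow p (fun x => v x - v' x)%R < e%:E)%E].
Proof.
move=> T0 p1 a0 hv e0.
(* N + 1 > a makes [b] positive, and N >= k + 1 leaves, besides the k + 1 integrations of
   [J1_zero_C], at least one more, which turns [h] into a bounded function. *)
pose N := (maxn (Num.truncn a) k).+1.
have b0 : 0 < N.+1%:R - a.
  rewrite subr_gt0; apply: (lt_le_trans (truncnS_gt a)); rewrite ler_nat /N ltnS.
  by rewrite leqW// leq_maxl.
set b := N.+1%:R - a in b0.
have abN : a + b = N.+1%:R by rewrite /b; ring.
have [c c0 hc] := iter_J1_split T0 a0 b0 p1 abN.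
pose M := Num.truncn b.
have b20 : 0 < M.+1%:R - b by rewrite subr_gt0 truncnS_gt.
have bbM : b + (M.+1%:R - b) = M.+1%:R by ring.
have [c' c'0 hc'] := iter_J1_split T0 b0 b20 p1 bbM.
have [g hg lg] := density_iter M.+1 T0 p1 hv e0.
have hJg := J_Lz T0 b20 p1 hg.
(* The constants are arranged so that c J^b h is, almost everywhere, the (M+1)-fold integral of
   [g]. *)
pose h := fun t => c^-1 * (c' * J T (M.+1%:R - b) g t).
have hh : Lz T p h by apply: LzZ; exact: LzZ.
have Nk : (N - k = (N - k.+1).+1)%N by rewrite subnSK// /N ltnS leq_maxr.
have hI := iter_J_Lz (N - k.+1) T0 p1 hh.
have [B bB] := J1_Lz_bounded T0 p1 hI.
have [z hz ez] := J1_zero_C k T0 p1 (J_Lz T0 ltr01 p1 hI) bB.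
exists z, (fun t => c * J T b h t); split.
- exact: hz.
- by apply: LzZ; exact: J_Lz.
- have -> : cut T z = iter N.+1 (J T 1) h; last exact: hc.
  have -> : iter N.+1 (J T 1) h = iter k.+1 (J T 1) (iter (N - k) (J T 1) h).
    by rewrite -iterD addSn subnKC// /N leqW// leq_maxr.
  by rewrite Nk; exact: ez.
- apply: le_lt_trans lg; rewrite le_eqVlt; apply/orP; left; apply/eqP.
  have [mv _ _] := hv; have [mJ _ _] := J_Lz T0 b0 p1 hh.
  have [mI _ _] := iter_J_Lz M.+1 T0 p1 hg.
  apply: ae_eq_Lpow.
  + exact: (measurable_funB mv (measurable_funM (measurable_cst c) mJ)).
  + exact: (measurable_funB mv mI).
  + apply: aeS2 (hc' g hg) (JZ c^-1 T0 b0 p1 (LzZ c' hJg)) => t e1 e2 _.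
    by rewrite e1// e2// mulrA mulfV ?gt_eqF// mul1r.
Qed.

(** It suffices to approximate the preimage [v] by preimages of smooth functions: [J_Sobolev_bound],
    applied to the difference, controls the Sobolev norm of the error. *)
Lemma RL_zero_Sobolev T p a s u v : 0 < T -> 1 <= p -> 0 <= s -> s < a ->
  Lz T p (cut T u) -> Lz T p v -> cut T u =ae J T a v -> zero_Sobolev T p s u.
Proof.
move=> T0 p1 s0 sa hu hv uv; have p0 : 0 < p by exact: lt_le_trans p1.
have a0 : 0 < a by exact: le_lt_trans sa.
have [K K0 hK] := J_Sobolev_bound T0 p1 s0 sa; split.
  have [d hd bd] := hK u v hu hv uv; apply: (SobolevP s u T0 p1).2.
  exists d; first exact: hd.
  have [_ _ fv] := hv; apply: le_lt_trans bd _.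
  by apply: lte_mul_pinfty; [rewrite lee_fin|by []|exact: fv].
move=> e e0; have K1 : 0 < K + 1 by rewrite ltr_wpDl.
have ep0 : 0 < e `^ p by rewrite powR_gt0.
have d0 : 0 < e `^ p / (K + 1) by rewrite divr_gt0.
have [z [v' [hz hv' zv lv]]] := density_zero_C (smooth_order s) T0 p1 a0 hv d0.
exists z; first exact: hz.
have [_ _ [hz' _]] : [/\ True, True & Lz T p (cut T z) /\ True].
  have [h [M [hh _ ez _]]] := zero_C_wfam (n := 0) T0 p1 hz isT.
  by split; [| |split; [rewrite ez; exact: iter_J_Lz|]].
have cB : cut T (u \- z) = fun x => cut T u x - cut T z x.
  by apply/funext => x; rewrite !cutE; case: ifP => //; rewrite subrr.
have hB := LzB p1 hv hv'.
have uzv : cut T (u \- z) =ae J T a (fun x => v x - v' x).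
  rewrite cB; apply: ae_trans (ae_sym (JB T0 a0 p1 hv hv')).
  by apply: aeS2 uv zv => x h1 h2 _; rewrite h1// h2.
have huz : Lz T p (cut T (u \- z)) by rewrite cB; exact: LzB.
have [d hd bd] := hK _ _ huz hB uzv.
rewrite (Sobolev_normE T0 p1 hd); apply: (poweR_lt_root p0 e0 (SobE_ge0 T p s d)).2.
apply: (le_lt_trans bd); apply: (@le_lt_trans _ _ (K%:E * (e `^ p / (K + 1))%:E)%E).
  by apply: lee_wpmul2l; [rewrite lee_fin|exact: ltW].
by rewrite -EFinM lte_fin mulrA ltr_pdivrMr// mulrC ltr_pM2l// ltrDl.
Qed.

End closures.

(** * Passing the lower embedding to the closure *)

Section closure_lift.
Context {R : realType}.
Notation mu := (@lebesgue_measure R).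
Local Notation "f =ae g" := (ae_eq mu [set: R] f g) (at level 70).
Implicit Types (T p a b c s : R) (u v w z f g h : R -> R) (d : nat -> R -> R) (j n k : nat).

Lemma poweR_root_inj (x y : \bar R) p : 0 < p -> (0 <= x)%E -> (0 <= y)%E ->
  (x `^ p^-1 = y `^ p^-1)%E -> x = y.
Proof. by move=> p0 x0 y0 e; rewrite -(poweRK p0 x0) e poweRK. Qed.

Lemma SobE_unique T p s u d d' : 0 < T -> 1 <= p -> wfam T p (Num.truncn s) u d ->
  wfam T p (Num.truncn s) u d' -> SobE T p s d = SobE T p s d'.
Proof.
move=> T0 p1 hd hd'; have p0 : 0 < p by exact: lt_le_trans p1.
have E := etrans (esym (Sobolev_normE T0 p1 hd)) (Sobolev_normE T0 p1 hd').
exact: (poweR_root_inj p0 (SobE_ge0 T p s d) (SobE_ge0 T p s d') E).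
Qed.

Lemma Lpow_cut_le_SobE T p s u d : 0 < T -> 1 <= p -> wfam T p (Num.truncn s) u d ->
  (Lpow p (cut T u) <= SobE T p s d)%E.
Proof.
move=> T0 p1 [hu hd]; have [hd0 wd0'] := hd 0%N (leq0n _).
have e := wd_unique T0 p1 hu hd0 (@wd0 R T (cut T u)) wd0'.
have [mu' _ _] := hu; have [md _ _] := hd0.
by rewrite (ae_eq_Lpow p mu' md e); exact: Lpow_le_SobE.
Qed.

Lemma SobE_wfamB T p s u v d e : 0 < T -> 1 <= p -> wfam T p (Num.truncn s) u d ->
  wfam T p (Num.truncn s) v e ->
  (SobE T p s (fun j x => d j x - e j x)%R <= (2 `^ p)%:E * (SobE T p s d + SobE T p s e))%E.
Proof.
move=> T0 p1 [_ hd] [_ he]; apply: (SobEB T0 p1) => j jn.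
  by have [[]] := hd j jn.
by have [[]] := he j jn.
Qed.

Lemma zero_C_family T p s z : 0 < T -> 1 <= p -> zero_C T (smooth_order s) z ->
  exists d, wfam T p (Num.truncn s) z d.
Proof.
move=> T0 p1 hz; have [h [M [_ _ _ hw]]] := zero_C_wfam T0 p1 hz (smooth_order_ge s).
by exists (fun j => iter (smooth_order s - j) (J T 1) h).
Qed.

Lemma zero_Sobolev_approx T p s u d (e : R) : 0 < T -> 1 <= p -> zero_Sobolev T p s u ->
  wfam T p (Num.truncn s) u d -> 0 < e ->
  exists z d', [/\ zero_C T (smooth_order s) z, wfam T p (Num.truncn s) z d' &
    (SobE T p s (fun j x => d j x - d' j x)%R < e%:E)%E].
Proof.
move=> T0 p1 [_ hu] hd e0; have p0 : 0 < p by exact: lt_le_trans p1.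
have e10 : 0 < e `^ p^-1 by rewrite powR_gt0.
have [z hz lz] := hu _ e10; have [d' hd'] := zero_C_family T0 p1 hz.
exists z, d'; split; [exact: hz|exact: hd'|].
have hB := wfamB T0 p1 hd hd'; rewrite (Sobolev_normE T0 p1 hB) in lz.
have := (poweR_lt_root p0 e10 (SobE_ge0 _ _ _ _)).1 lz.
by rewrite -powRrM mulVf ?gt_eqF// powRr1// ltW.
Qed.

(** Stability of the closure under differences is what turns the linear estimate into continuity of
    the inclusion. *)
Lemma zero_SobolevB T p s u v : 0 < T -> 1 <= p -> zero_Sobolev T p s u ->
  zero_Sobolev T p s v -> zero_Sobolev T p s (u \- v).
Proof.
move=> T0 p1 hu hv; have p0 : 0 < p by exact: lt_le_trans p1.
have [d hd fd] := (SobolevP s u T0 p1).1 hu.1; have [e he fe] := (SobolevP s v T0 p1).1 hv.1.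
have c20 : 0 < 2 `^ p :> R by rewrite powR_gt0.
have hB := wfamB T0 p1 hd he; split.
  apply: (SobolevP s (u \- v) T0 p1).2; exists (fun j x => d j x - e j x); first exact: hB.
  apply: le_lt_trans (SobE_wfamB T0 p1 hd he) _.
  by apply: lte_mul_pinfty; [rewrite lee_fin ltW|by []|exact: lte_add_pinfty fd fe].
move=> x x0; have xp0 : 0 < x `^ p by rewrite powR_gt0.
pose y := x `^ p / (4 * 2 `^ p); have y0 : 0 < y by rewrite divr_gt0// mulr_gt0.
have [z [dz [hz hdz lz]]] := zero_Sobolev_approx T0 p1 hu hd y0.
have [z' [dz' [hz' hdz' lz']]] := zero_Sobolev_approx T0 p1 hv he y0.
exists (z \- z'); first exact: zero_CB.
have h1 := wfamB T0 p1 hd hdz; have h2 := wfamB T0 p1 he hdz'.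
have h3 := wfamB T0 p1 h1 h2.
have eq : (u \- z) \- (v \- z') = (u \- v) \- (z \- z').
  by apply/funext => t /=; ring.
rewrite eq in h3; rewrite (Sobolev_normE T0 p1 h3).
apply: (poweR_lt_root p0 x0 (SobE_ge0 _ _ _ _)).2.
apply: (le_lt_trans (SobE_wfamB T0 p1 h1 h2)).
apply: (@le_lt_trans _ _ ((2 `^ p)%:E * (y%:E + y%:E))%E).
  apply: lee_wpmul2l; first by rewrite lee_fin ltW.
  by apply: leeD; [exact: ltW lz|exact: ltW lz'].
rewrite -EFinD -EFinM lte_fin (_ : _ * _ = x `^ p / 2); last first.
  by rewrite /y; field; rewrite gt_eqF.
by rewrite ltr_pdivrMr// ltr_pMr// ltr1n.
Qed.

Lemma half_powR_le p n : 1 <= p -> (2^-1 ^+ n) `^ p <= 2^-1 ^+ n :> R.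
Proof.
move=> p1; set x := _ ^+ n.
have x0 : 0 < x by rewrite exprn_gt0.
have x1 : x <= 1 by rewrite exprn_ile1 ?invr_ge0// invf_le1 ?ler1n.
rewrite -[leRHS]mulr1 -[leRHS](mulr1) -[X in _ <= X * _ * _](powRr1 (ltW x0)) !mulr1.
have h0 : 0 <= p - 1 by rewrite subr_ge0.
have := ge0_ler_powR h0 _ _ x1; rewrite powR1 => h.
rewrite -(subrK 1 p) gt0_powRD// ler_piMl ?powR_ge0//; apply: h; rewrite nnegrE//.
exact: ltW.
Qed.

(* Approximants from [zero_C] converge so fast that their preimages under [J T a]
   form a Cauchy sequence, the limit of which is a preimage of [u]. *)
Lemma zero_Sobolev_RL T p a s : 0 < T -> 1 <= p -> 0 < a -> a < s ->
  (forall n : nat, a != n%:R) ->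
  exists2 K, 0 <= K & forall u, zero_Sobolev T p s u ->
    exists d v, [/\ wfam T p (Num.truncn s) u d, Lz T p v, cut T u =ae J T a v &
      (Lpow p v <= K%:E * SobE T p s d)%E].
Proof.
move=> T0 p1 a0 as' aN; have p0 : 0 < p by exact: lt_le_trans p1.
have [K K0 hK] := zero_C_lift T0 p1 a0 as' aN.
set c2 : R := 2 `^ p; have c20 : 0 < c2 by rewrite powR_gt0.
have c20E : (0 <= c2%:E)%E by rewrite lee_fin ltW.
have K0E : (0 <= K%:E)%E by rewrite lee_fin.
pose r n : R := 2^-1 ^+ n.
have r0 n : 0 < r n by rewrite exprn_gt0.
have rS n : r n.+1 = 2^-1 * r n by rewrite /r exprS.
have r1 n : r n <= 1 by rewrite exprn_ile1 ?invr_ge0// invf_le1 ?ler1n.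
exists (c2 * (K * c2)); first by rewrite !mulr_ge0 ?(ltW c20).
move=> u hu; have [d hd fd] := (SobolevP s u T0 p1).1 hu.1.
(* [rho] is the size of increments demanded by [Lpow_complete]. The accuracy [eta] in Sobolev energy
   is chosen so that two successive errors, amplified by K 2^p, stay below it. *)
pose rho n := r n `^ p * r n.+1.
have rho0 n : 0 < rho n by rewrite mulr_gt0 ?powR_gt0.
have rhoS n : rho n.+1 <= rho n.
  have rr : r n.+1 <= r n by rewrite rS; have := r0 n; lra.
  have rr' : r n.+2 <= r n.+1 by rewrite (rS n.+1); have := r0 n.+1; lra.
  apply: ler_pM; rewrite ?powR_ge0 ?(ltW (r0 _))//.
  by apply: (ge0_ler_powR (ltW p0) _ _ rr); rewrite nnegrE ltW.
have K1 : 0 < K + 1 by rewrite ltr_wpDl.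
pose eta n := rho n / (2 * c2 * (K + 1)).
have den0 : 0 < 2 * c2 * (K + 1) by rewrite !mulr_gt0.
have eta0 n : 0 < eta n by rewrite divr_gt0.
have etaS n : eta n.+1 <= eta n by rewrite ler_pM2r ?invr_gt0.
have c21 : 1 <= c2.
  have h2 : 1 <= 2 :> R by lra.
  by have := ler_powR h2 (ltW p0); rewrite powRr0.
have eta_r n : eta n <= r n.
  apply: (@le_trans _ _ (rho n)).
    rewrite ler_pdivrMr// ler_peMr ?(ltW (rho0 n))//.
    have h1 : 1 <= 2 * c2 by lra.
    by apply: (le_trans h1); rewrite ler_peMr ?mulr_ge0 ?(ltW c20)// lerDr.
  rewrite /rho; apply: (@le_trans _ _ (1 * r n)); last by rewrite mul1r.
  apply: ler_pM; rewrite ?powR_ge0 ?(ltW (r0 _))//.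
    exact: le_trans (half_powR_le n p1) (r1 n).
  by rewrite rS; have := r0 n; lra.
have hz n : exists zd : (R -> R) * ((nat -> R -> R) * (R -> R)),
    [/\ zero_C T (smooth_order s) zd.1, wfam T p (Num.truncn s) zd.1 zd.2.1,
     Lz T p zd.2.2, cut T zd.1 =ae J T a zd.2.2 &
     (SobE T p s (fun j x => d j x - zd.2.1 j x)%R <= (eta n)%:E)%E /\
     (Lpow p zd.2.2 <= K%:E * SobE T p s zd.2.1)%E].
  have [z [d' [h1 h2 h3]]] := zero_Sobolev_approx T0 p1 hu hd (eta0 n).
  have [e [v [g1 g2 g3 g4]]] := hK z h1.
  exists (z, (d', v)) => /=; split; [exact: h1|exact: h2|exact: g2|exact: g3|split].
    exact: ltW.
  by rewrite -(SobE_unique T0 p1 g1 h2).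
have [zd hzd] := choice hz.
pose z n := (zd n).1; pose dz n := (zd n).2.1; pose v_ n := (zd n).2.2.
have zC n : zero_C T (smooth_order s) (z n) by have [] := hzd n.
have wz n : wfam T p (Num.truncn s) (z n) (dz n) by have [] := hzd n.
have hv n : Lz T p (v_ n) by have [] := hzd n.
have zv n : cut T (z n) =ae J T a (v_ n) by have [] := hzd n.
have sz n : (SobE T p s (fun j x => d j x - dz n j x)%R <= (eta n)%:E)%E by have [_ _ _ _ []] := hzd n.
have vz n : (Lpow p (v_ n) <= K%:E * SobE T p s (dz n))%E by have [_ _ _ _ []] := hzd n.
have wuz n := wfamB T0 p1 hd (wz n).
have inc n : (Lpow p (fun x => v_ n.+1 x - v_ n x)%R <= ((2^-1 ^+ n) `^ p * 2^-1 ^+ n.+1)%R%:E)%E.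
  have zz := zero_CB (zC n.+1) (zC n).
  have [e [w [he hw zw lw]]] := hK _ zz.
  have hB := LzB p1 (hv n.+1) (hv n).
  (* By injectivity the lift of the difference is the difference of the lifts, so the estimate in
     [hK] applies to the increments of [v_]. *)
  have e1 : w =ae (fun x => v_ n.+1 x - v_ n x).
    have hwB := LzB p1 hw hB.
    have : (fun x => w x - (v_ n.+1 x - v_ n x)) =ae cst 0.
      apply: (J_injective T0 a0 p1 hwB).
      apply: ae_trans (JB T0 a0 p1 hw hB) _.
      have cB : cut T (z n.+1 \- z n) = fun x => cut T (z n.+1) x - cut T (z n) x.
        by apply/funext => x; rewrite !cutE; case: ifP => //; rewrite subrr.
      rewrite cB in zw.
      have zz' : (fun t => J T a w t) =ae (fun t => J T a (v_ n.+1) t - J T a (v_ n) t).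
        apply: ae_trans (ae_sym zw) _.
        by apply: aeS2 (zv n.+1) (zv n) => x h1 h2 _; rewrite h1// h2.
      apply: aeS2 zz' (JB T0 a0 p1 (hv n.+1) (hv n)) => x h1 h2 _.
      by rewrite h1// h2// subrr.
    by apply: aeS => x /(_ I)/eqP; rewrite subr_eq0 => /eqP.
  have [mw _ _] := hw; have [mB _ _] := hB.
  rewrite -(ae_eq_Lpow p mw mB e1); apply: (le_trans lw).
  have h3 := wfamB T0 p1 (wuz n) (wuz n.+1).
  have eqz : (u \- z n) \- (u \- z n.+1) = z n.+1 \- z n by apply/funext => t /=; ring.
  rewrite eqz in h3; rewrite (SobE_unique T0 p1 he h3).
  apply: (@le_trans _ _ (K%:E * (c2%:E * ((eta n)%:E + (eta n)%:E)))%E).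
    apply: lee_wpmul2l; first exact: K0E.
    apply: (le_trans (SobE_wfamB T0 p1 (wuz n) (wuz n.+1))); apply: lee_wpmul2l; first exact: c20E.
    apply: leeD; first exact: sz.
    by apply: (le_trans (sz n.+1)); rewrite lee_fin.
  rewrite -EFinD -!EFinM lee_fin -/(r n) -/(r n.+1) -/(rho n).
  rewrite (_ : K * _ = rho n * (K / (K + 1))); last first.
    by rewrite /eta; field; rewrite !gt_eqF.
  by rewrite ler_piMr ?(ltW (rho0 n))// ler_pdivrMr// mul1r lerDl.
have [v hvL lv] := Lpow_complete p1 hv inc.
have rate n : (2 * 2^-1 ^+ n) `^ p <= c2 * r n.
  by rewrite powRM ?exprn_ge0 ?invr_ge0// ler_pM2l//; exact: half_powR_le.
have [mv _ _] := hvL; have [mc _ _] := hd.1; have [mJ _ _] := J_Lz T0 a0 p1 hvL.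
set A := ((T `^ a / a) `^ p : R); have A0 : 0 <= A by exact: powR_ge0.
exists d, v; split; [exact: hd|exact: hvL| |].
- have mB : measurable_fun [set: R] (fun x => cut T u x - J T a v x) by exact: (measurable_funB mc mJ).
  (* [u] and J^a v are compared through [z n] and its lift; both errors decay geometrically in
     [n]. *)
  have : (fun x => cut T u x - J T a v x) =ae cst 0.
    apply: (Lpow_eq0 p0 mB); apply/eqP; rewrite eq_le Lpow_ge0 andbT.
    apply: (@lee_geometric R _ 0%E (c2 * (1 + A * c2))) => n; rewrite add0e.
    have hBn := LzB p1 hvL (hv n); have [mJB _ _] := J_Lz T0 a0 p1 hBn.
    have [mcz _ _] := (wuz n).1.
    have e1 : (fun x => cut T u x - J T a v x) =ae
        (fun x => cut T (u \- z n) x - J T a (fun x => v x - v_ n x) x).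
      have cB : cut T (u \- z n) = fun x => cut T u x - cut T (z n) x.
        by apply/funext => x; rewrite !cutE; case: ifP => //; rewrite subrr.
      rewrite cB; apply: aeS2 (zv n) (JB T0 a0 p1 hvL (hv n)) => x h1 h2 _.
      by rewrite h1// h2//; ring.
    have mB2 : measurable_fun [set: R]
        (fun x => cut T (u \- z n) x - J T a (fun x => v x - v_ n x) x).
      exact: (measurable_funB mcz mJB).
    rewrite (ae_eq_Lpow p mB mB2 e1); apply: (le_trans (LpowB p1 mcz mJB)).
    apply: (@le_trans _ _ (c2%:E * ((r n)%:E + A%:E * (c2 * r n)%:E))%E).
      apply: lee_wpmul2l; first exact: c20E.
      apply: leeD.
        apply: (le_trans (Lpow_cut_le_SobE T0 p1 (wuz n))); apply: (le_trans (sz n)).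
        by rewrite lee_fin; exact: eta_r.
      apply: (le_trans (J_Lpow T0 a0 p1 hBn)); apply: lee_wpmul2l; first by rewrite lee_fin.
      by apply: (le_trans (lv n)); rewrite lee_fin; exact: rate.
    rewrite -(EFinM A) -EFinD -EFinM lee_fin -/(r n) le_eqVlt; apply/orP; left; apply/eqP; ring.
  by apply: aeS => x /(_ I)/eqP; rewrite subr_eq0 => /eqP.
(* The bound on [v] is inherited from [v_ n]. One factor 2^p comes from splitting off [v - v_ n],
   the other from bounding the energy of [z n] by that of [u]. *)
- apply: (@lee_geometric R _ _ (c2 * (c2 + K * c2))) => n; rewrite -/(r n).
  have hBn := LzB p1 hvL (hv n); have [mvn _ _] := hv n; have [mBn _ _] := hBn.
  have := LpowD p1 mBn mvn.
  have -> : (fun x => v x - v_ n x + v_ n x) = v by apply/funext => x; rewrite subrK.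
  move=> h1; apply: (le_trans h1).
  have wzz := wfamB T0 p1 hd (wuz n).
  have eqz : u \- (u \- z n) = z n by apply/funext => t /=; ring.
  rewrite eqz in wzz.
  have hzn : (SobE T p s (dz n) <= c2%:E * (SobE T p s d + (eta n)%:E))%E.
    rewrite (SobE_unique T0 p1 (wz n) wzz); apply: (le_trans (SobE_wfamB T0 p1 hd (wuz n))).
    by apply: lee_wpmul2l; [exact: c20E|apply: leeD; [exact: lexx|exact: sz]].
  have hvn : (Lpow p (v_ n) <= K%:E * (c2%:E * (SobE T p s d + (eta n)%:E)))%E.
    by apply: (le_trans (vz n)); apply: lee_wpmul2l; [exact: K0E|exact: hzn].
  apply: (@le_trans _ _ (c2%:E * ((c2 * r n)%:E +
      K%:E * (c2%:E * (SobE T p s d + (eta n)%:E))))%E).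
    apply: lee_wpmul2l; first exact: c20E.
    by apply: leeD; [apply: (le_trans (lv n)); rewrite lee_fin; exact: rate|exact: hvn].
  have Sfin : SobE T p s d \is a fin_num by rewrite ge0_fin_numE// SobE_ge0.
  have S0 := SobE_ge0 T p s d; move: Sfin S0; case: (SobE T p s d) => // x _; rewrite lee_fin => x0.
  rewrite -(EFinD x) -(EFinM c2 (x + _)) -(EFinM K) -(EFinD (c2 * r n)) -(EFinM c2)
    -(EFinM (c2 * (K * c2)) x) -(EFinD (c2 * (K * c2) * x)) lee_fin.
  have h2 : c2 * (K * c2) * eta n <= c2 * (K * c2) * r n.
    by apply: ler_wpM2l (eta_r n); rewrite !mulr_ge0 ?(ltW c20).
  rewrite -subr_ge0; rewrite -subr_ge0 in h2; apply: (le_trans h2).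
  by rewrite le_eqVlt; apply/orP; left; apply/eqP; ring.
Qed.

End closure_lift.

(** * From energies to norms, and the theorem *)

Section bounds.
Context {R : realType}.
Notation mu := (@lebesgue_measure R).
Local Notation "f =ae g" := (ae_eq mu [set: R] f g) (at level 70).
Implicit Types (T p a s K : R) (u v : R -> R).

(** A linear bound gives continuity because [A] is stable under differences; dividing by [K + 1]
    covers [K = 0]. *)
Lemma bounded_continuously_included (A : set (R -> R)) (nA : (R -> R) -> \bar R)
    (B : set (R -> R)) (nB : (R -> R) -> \bar R) K : 0 <= K -> A `<=` B ->
  (forall u v, A u -> A v -> A (u \- v)) ->
  (forall u, A u -> (nB u <= K%:E * nA u)%E) -> continuously_included A nA B nB.
Proof.
move=> K0 AB AD hK; split=> // u Au e e0; have K1 : 0 < K + 1 by rewrite ltr_wpDl.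
exists (e / (K + 1)); first by rewrite divr_gt0.
move=> v Av lt; apply: (le_lt_trans (hK _ (AD _ _ Av Au))).
apply: (@le_lt_trans _ _ (K%:E * (e / (K + 1))%:E)%E).
  by apply: lee_wpmul2l; [rewrite lee_fin|exact: ltW].
by rewrite -EFinM lte_fin mulrA ltr_pdivrMr// mulrC ltr_pM2l// ltrDl.
Qed.

Lemma Sobolev_norm_ge0 T p s u : (0 <= Sobolev_norm T p s u)%E.
Proof. by rewrite /Sobolev_norm /Sobolev_nat_norm; case: ifP => _; exact: poweR_ge0. Qed.

Lemma RL_spaceB T p a u v : 0 < T -> 0 < a -> 1 <= p -> RL_space T p a u ->
  RL_space T p a v -> RL_space T p a (u \- v).
Proof.
move=> T0 a0 p1 /(RL_spaceP u T0 a0 p1)[hu [x hx ux]] /(RL_spaceP v T0 a0 p1)[hv [y hy vy]].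
have cB : cut T (u \- v) = fun t => cut T u t - cut T v t.
  by apply/funext => t; rewrite !cutE; case: ifP => //; rewrite subrr.
apply: (RL_spaceP _ T0 a0 p1).2; rewrite cB; split; first exact: LzB.
exists (fun t => x t - y t); first exact: LzB.
apply: ae_trans (ae_sym (JB T0 a0 p1 hx hy)).
by apply: aeS2 ux vy => t h1 h2 _; rewrite h1// h2.
Qed.

(** The p-th root of the estimate in [zero_Sobolev_RL]; [Gamma a] appears because [RL_inv] inverts
    the normalised integral. *)
Lemma RL_inv_le_Sobolev T p a s : 0 < T -> 1 <= p -> 0 < a -> a < s ->
  (forall n : nat, a != n%:R) ->
  exists2 K, 0 <= K & forall u, zero_Sobolev T p s u -> RL_space T p a u /\
    (Lp_norm T p (RL_inv T p a u) <= K%:E * Sobolev_norm T p s u)%E.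
Proof.
move=> T0 p1 a0 as' aN; have p0 : 0 < p by exact: lt_le_trans p1.
have [K K0 hK] := zero_Sobolev_RL T0 p1 a0 as' aN.
have GK0 : 0 <= Gamma a `^ p * K by rewrite mulr_ge0 ?powR_ge0.
exists ((Gamma a `^ p * K) `^ p^-1); first exact: powR_ge0.
move=> u hu; have [d [v [hd hv uv lv]]] := hK u hu.
split; first by apply: (RL_spaceP u T0 a0 p1).2; split; [exact: hd.1|exists v].
rewrite (RL_normE T0 a0 p1 hd.1 hv uv) (Sobolev_normE T0 p1 hd).
apply: (poweR_root_le p0 _ (SobE_ge0 T p s d) GK0).
  by apply: mule_ge0; [rewrite lee_fin powR_ge0|exact: Lpow_ge0].
rewrite (EFinM (Gamma a `^ p)) -muleA; apply: lee_wpmul2l; last exact: lv.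
by rewrite lee_fin powR_ge0.
Qed.

Lemma Sobolev_le_RL_inv T p a s : 0 < T -> 1 <= p -> 0 <= s -> s < a ->
  exists2 K, 0 <= K & forall u, RL_space T p a u -> zero_Sobolev T p s u /\
    (Sobolev_norm T p s u <= K%:E * Lp_norm T p (RL_inv T p a u))%E.
Proof.
move=> T0 p1 s0 sa; have p0 : 0 < p by exact: lt_le_trans p1.
have a0 : 0 < a by exact: le_lt_trans sa.
have [K K0 hK] := J_Sobolev_bound T0 p1 s0 sa.
have G0 : 0 < Gamma a `^ p by rewrite powR_gt0// Gamma_gt0.
have GK0 : 0 <= K / Gamma a `^ p by rewrite divr_ge0// ltW.
exists ((K / Gamma a `^ p) `^ p^-1); first exact: powR_ge0.
move=> u /(RL_spaceP u T0 a0 p1)[hu [v hv uv]].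
have [d hd lv] := hK u v hu hv uv.
split; first exact: (RL_zero_Sobolev T0 p1 s0 sa hu hv uv).
rewrite (RL_normE T0 a0 p1 hu hv uv) (Sobolev_normE T0 p1 hd).
apply: (poweR_root_le p0 (SobE_ge0 T p s d) _ GK0).
  by apply: mule_ge0; [rewrite lee_fin ltW|exact: Lpow_ge0].
by rewrite muleA -EFinM divfK ?gt_eqF.
Qed.

End bounds.

Theorem theorem2p2 (R : realType) (T p alpha sigma eps : R) (m : nat)
    (hT : 0 < T) (hp : 1 <= p) (hm : (1 <= m)%N)
    (halpha : alpha = m%:R - 1 + sigma) (hsigma : 0 < sigma < 1)
    (heps : 0 < eps < alpha) :
  [/\ continuously_included
        (zero_Sobolev T p (alpha + eps)) (Sobolev_norm T p (alpha + eps))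
        (frac_deriv_dom T p alpha) (RL_norm T p alpha),
      continuously_included
        (frac_deriv_dom T p alpha) (RL_norm T p alpha)
        (zero_Sobolev T p (alpha - eps)) (Sobolev_norm T p (alpha - eps)),
      (exists2 C : R, 0 < C &
        forall u : R -> R, zero_Sobolev T p (alpha + eps) u ->
          (C^-1%:E * Sobolev_norm T p (alpha - eps) u
             <= Lp_norm T p (frac_deriv T p alpha u))%E /\
          (Lp_norm T p (frac_deriv T p alpha u)
             <= C%:E * Sobolev_norm T p (alpha + eps) u)%E) &
      (forall beta : R, 0 <= beta ->
        RL_space T p (alpha + beta) `<=` frac_deriv_dom T p alpha /\
        frac_deriv_image T p alpha (RL_space T p (alpha + beta)) =
          RL_space T p beta)].
Proof.
have /andP[e0 ea] := heps; have a0 : 0 < alpha by exact: lt_trans ea.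
(* [alpha] lies strictly between the consecutive integers m - 1 and m. *)
have aN (n : nat) : alpha != n%:R.
  move: hsigma halpha; case: (m) hm => // k _ /andP[s0 s1].
  rewrite -natr1 addrK => ak; apply/eqP => an.
  have h1 : (k%:R : R) < n%:R by rewrite -an ak ltrDl.
  have h2 : (n%:R : R) < k.+1%:R by rewrite -an ak -natr1 ltrD2l.
  by move: h1 h2; rewrite !ltr_nat ltnS => h1 /(leq_trans h1); rewrite ltnn.
have ap : alpha < alpha + eps by rewrite ltrDl.
have am : alpha - eps < alpha by rewrite ltrBlDr ltrDl.
have am0 : 0 <= alpha - eps by rewrite subr_ge0 ltW.
have [K1 K10 h1] := RL_inv_le_Sobolev hT hp a0 ap aN.
have [K2 K20 h2] := Sobolev_le_RL_inv hT hp am0 am.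
have RLn u : RL_norm T p alpha u = Lp_norm T p (RL_inv T p alpha u).
  by rewrite /RL_norm gt_eqF.
split.
- apply: (bounded_continuously_included K10).
  + by move=> u /h1[].
  + by move=> u v; exact: zero_SobolevB.
  + by move=> u /h1[_]; rewrite RLn.
- apply: (bounded_continuously_included K20).
  + by move=> u /h2[].
  + by move=> u v; exact: RL_spaceB.
  + by move=> u /h2[_]; rewrite RLn.
(* One constant serves both inequalities: it dominates [K1] and [K2], and the summand 1 makes it
   positive. *)
- have C0 : 0 < K1 + K2 + 1 by rewrite ltr_wpDl// addr_ge0.
  exists (K1 + K2 + 1); first exact: C0.
  move=> u hu; have [hRL b1] := h1 u hu; have [_ b2] := h2 u hRL.
  rewrite /frac_deriv; split.
    have N0 : (0 <= Lp_norm T p (RL_inv T p alpha u))%E by exact: Lnorm_ge0.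
    move: N0 b2; move: (Lp_norm _ _ _) (Sobolev_norm _ _ _ _) => N S N0 b2.
    have b3 : (S <= (K1 + K2 + 1)%:E * N)%E.
      apply: (le_trans b2); apply: (lee_wpmul2r N0); rewrite lee_fin; lra.
    have Ci0 : (0 <= (K1 + K2 + 1)^-1%:E)%E by rewrite lee_fin invr_ge0 ltW.
    apply: (le_trans (lee_wpmul2l Ci0 b3)).
    by rewrite muleA -EFinM mulVf ?gt_eqF// mul1e.
  apply: (le_trans b1); apply: lee_wpmul2r; first exact: Sobolev_norm_ge0.
  by rewrite lee_fin; lra.
- move=> beta b0; exact: frac_deriv_image_RL.
Qed.
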